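(* Let $\Omega\subseteq\mathbb{R}^N$ be open with finite measure and, for given $p\ge 1$, suppose that (i) $H:\mathbb{R}^N\to[0,\infty[$ is convex, $H(0)=0$, and $H(z)\ge c\,|z|^p$ for some $c>0$ and all $z\in\mathbb{R}^N$; (ii) $f:\Omega\times\mathbb{R}\to\mathbb{R}$ is a Carathéodory function and fulfills $\sup_{x\in\Omega,\ |s|\le t}|f(x,s)|<\infty$ for all $t>0$; (iii) there exist $\mu,\theta\ge 0$ and $1\le q\le p^*$ such that $$\operatorname{sign}(t)\,f(x,t)\le \mu\,(|t|+\theta)^{q-1}\qquad\text{for a.e. } x\in\Omega\text{ and all }t\in\mathbb{R}.$$ Let $F(x,t)=\int_0^tf(x,s)\,ds$ and $J(v)=\int_\Omega H(Dv)-F(x,v)\,dx$. Then any energy critical point $u\in W^{1,p}_0(\Omega)$ of $J$ is bounded. If additionally $q<p^*$, the estimate $$\|u\|_{L^\infty(\Omega)}\le\max\left\{\theta,\ C\left((\mu/c)^{\frac Np}\int_\Omega|u|^q\,dx\right)^{\frac{p}{p\,q+(p-q)\,N}}\right\}$$ holds true for some constant $C=C(N,p,q)$ (depending only on $N,p,q$) which, for any fixed $N$, is positive and continuous in $(p,q)$ on the domain $p\ge 1$, $1\le q<p^*$.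
   Context: $p^*=Np/(N-p)$ if $p<N$, $p^*=\infty$ if $p>N$, and $p^*$ is any finite number if $p=N$ (so for $p=N$ both $q\le p^*$ and $q<p^*$ just mean $q<\infty$). Assumption (iii) is understood to be empty when $q=\infty$ (which can only occur if $p>N$). Suprema over $x\in\Omega$ are essential suprema, i.e. (ii) means $\sup_{|s|\le t}\|f(\cdot,s)\|_{L^\infty(\Omega)}<\infty$. $W^{1,p}_0(\Omega)$ is the closure of $C^\infty_c(\Omega)$ with respect to $\|Dv\|_{L^p}$. Under these assumptions the negative part of $H(Dv)-F(\cdot,v)$ is integrable for every $v\in W^{1,p}_0(\Omega)$, so $J$ is well defined with values in $]-\infty,+\infty]$. Energy critical point: $u\in W^{1,p}_0(\Omega)$ is an energy critical point of $J$ if $J(u)<\infty$, $f(\cdot,u)\,u\in L^1(\Omega)$, and $u$ minimises the convex functional $$J_u(v)=\int_\Omega H(Dv)-f(x,u)\,v\,dx$$ over the space $V_u=\{v\in W^{1,p}_0(\Omega): f(\cdot,u)\,v\in L^1(\Omega)\}$. *)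

(* Defs.v *)
From HB Require Import structures.
From mathcomp Require Import all_boot all_order all_algebra.
From mathcomp Require Import all_classical all_reals all_analysis.
From mathcomp Require Import lra.

Set Implicit Arguments.
Unset Strict Implicit.
Unset Printing Implicit Defensive.
Import Order.TTheory GRing.Theory Num.Theory.
Import numFieldNormedType.Exports.

Local Open Scope classical_set_scope.
Local Open Scope ring_scope.

Section product_sigma_algebra.
Variable R : realType.

(* 'rV[R]_n carries no sigma-algebra in the library; borel_rV is its product
   (that is, Borel) sigma-algebra. *)
Definition rV_generators n : set (set 'rV[R]_n) :=
  [set [set x : 'rV[R]_n | B (x ord0 i)] | i in [set: 'I_n] & B in (@measurable _ R)].

Definition borel_rV n := g_sigma_algebraType (@rV_generators n).

Lemma measurable_coord n (i : 'I_n) :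
  measurable_fun [set: borel_rV n] (fun x : borel_rV n => (x : 'rV[R]_n) ord0 i).
Proof.
move=> _ B mB; rewrite setTI; apply: sub_sigma_algebra.
by exists i => //; exists B.
Qed.

Lemma measurable_fun_coordP d (T : measurableType d) n (g : T -> borel_rV n) :
  (forall i, measurable_fun [set: T] (fun x => (g x : 'rV[R]_n) ord0 i)) ->
  measurable_fun [set: T] g.
Proof.
move=> mg; apply: (@measurability _ _ T (borel_rV n) _ _ (@rV_generators n)) => //.
by move=> _ [_ [i _ [B mB <-]] <-]; exact: mg.
Qed.

Definition rV_cons n (z : R * borel_rV n) : borel_rV n.+1 :=
  (\row_i oapp (fun j => (z.2 : 'rV[R]_n) ord0 j) z.1 (unlift ord0 i)
    : 'rV[R]_n.+1).

Definition rV_uncons n (x : borel_rV n.+1) : R * borel_rV n :=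
  ((x : 'rV[R]_n.+1) ord0 ord0,
   (\row_i (x : 'rV[R]_n.+1) ord0 (lift ord0 i) : 'rV[R]_n)).

Lemma rV_consK n : cancel (@rV_cons n) (@rV_uncons n).
Proof.
move=> [a x]; congr pair; first by rewrite mxE unlift_none.
by apply/rowP => i; rewrite !mxE liftK.
Qed.

Lemma measurable_rV_cons n : measurable_fun [set: R * borel_rV n] (@rV_cons n).
Proof.
apply: measurable_fun_coordP => i.
have [j|] := unliftP ord0 i => ->.
- rewrite (_ : (fun _ => _) =
    (fun x : borel_rV n => (x : 'rV[R]_n) ord0 j) \o snd); last first.
    by apply/funext => z /=; rewrite mxE liftK.
  by apply: measurableT_comp => //; exact: measurable_coord.
- rewrite (_ : (fun _ => _) = fst)//.
  by apply/funext => z /=; rewrite mxE unlift_none.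
Qed.

Lemma measurable_rV_uncons n :
  measurable_fun [set: borel_rV n.+1] (@rV_uncons n).
Proof.
apply/measurable_fun_pairP; split; first exact: measurable_coord.
apply: measurable_fun_coordP => i.
rewrite (_ : (fun _ => _) =
    fun x : borel_rV n.+1 => (x : 'rV[R]_n.+1) ord0 (lift ord0 i)).
  exact: measurable_coord.
by apply/funext => x /=; rewrite mxE.
Qed.

End product_sigma_algebra.

Section lebesgue_step.
Variables (R : realType) (n : nat).
Variable m : {sigma_finite_measure set (borel_rV R n) -> \bar R}.
Local Open Scope ereal_scope.

Definition lebesgue_step : set (borel_rV R n.+1) -> \bar R :=
  pushforward (@lebesgue_measure R \x m) (@rV_cons R n).

Let lebesgue_step0 : lebesgue_step set0 = 0.
Proof. by rewrite /lebesgue_step /pushforward preimage_set0 measure0. Qed.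

Let lebesgue_step_ge0 A : 0 <= lebesgue_step A.
Proof. exact: integral_ge0. Qed.

Let lebesgue_step_sigma_additive : semi_sigma_additive lebesgue_step.
Proof.
move=> F mF tF mUF; rewrite /lebesgue_step /pushforward preimage_bigcup.
have mpre A : measurable A -> measurable (@rV_cons R n @^-1` A).
  by rewrite -[X in _ -> measurable X]setTI; exact: measurable_rV_cons.
apply: measure_semi_sigma_additive.
- by move=> k; exact: mpre.
- apply/trivIsetP => /= i j _ _ ij; rewrite -preimage_setI.
  by move/trivIsetP : tF => /(_ _ _ _ _ ij) ->//; rewrite preimage_set0.
- by rewrite -preimage_bigcup; exact: mpre.
Qed.

HB.instance Definition _ := isMeasure.Build _ _ _ lebesgue_step
  lebesgue_step0 lebesgue_step_ge0 lebesgue_step_sigma_additive.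

Let lebesgue_step_sigma_finite : sigma_finite setT lebesgue_step.
Proof.
have /sigma_finiteP[F [TF ndF F_]] := sigma_finiteT (@lebesgue_measure R).
have /sigma_finiteP[G [TG ndG G_]] := sigma_finiteT m.
exists (fun k => @rV_uncons R n @^-1` (F k `*` G k)).
  apply/esym; rewrite -subTset => x _.
  have [i _ Fi] : (\bigcup_k F k) (rV_uncons x).1 by rewrite -TF.
  have [j _ Gj] : (\bigcup_k G k) (rV_uncons x).2 by rewrite -TG.
  exists (maxn i j) => //; split => /=.
  - by move: Fi; exact/subsetPset/ndF/leq_maxl.
  - by move: Gj; exact/subsetPset/ndG/leq_maxr.
move=> k; have [mF Foo] := F_ k; have [mG Goo] := G_ k; split.
  rewrite -[X in measurable X]setTI; apply: measurable_rV_uncons => //.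
  exact: measurableX.
rewrite /lebesgue_step /pushforward.
rewrite (_ : _ @^-1` _ = F k `*` G k); last first.
  by apply/funext => z; rewrite /preimage /mkset rV_consK.
by rewrite product_measure1E// lte_mul_pinfty// ge0_fin_numE.
Qed.

HB.instance Definition _ := Measure_isSigmaFinite.Build _ _ _ lebesgue_step
  lebesgue_step_sigma_finite.
End lebesgue_step.

(* The n-fold product of the Lebesgue measure of the line, on Borel sets. *)
Fixpoint borel_lebesgue (R : realType) (n : nat) :
    {sigma_finite_measure set (borel_rV R n) -> \bar R} :=
  match n with
  | 0 => @dirac _ (borel_rV R 0) (0 : 'rV[R]_0) R
  | n.+1 => lebesgue_step (borel_lebesgue R n)
  end.

Lemma measurable_box (R : realType) (n : nat) (A : 'I_n -> set R) :
  (forall i, measurable (A i)) ->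
  measurable
    ([set x : 'rV[R]_n | forall i, A i (x ord0 i)] : set (borel_rV R n)).
Proof.
move=> mA.
rewrite (_ : [set x : 'rV[R]_n | forall i, A i (x ord0 i)] =
    \bigcap_(i in [set: 'I_n])
    ((fun x : borel_rV R n => (x : 'rV[R]_n) ord0 i) @^-1` A i)); last first.
  by apply/seteqP; split => x /= h i; [move=> _; exact: h|exact: h].
apply: fin_bigcap_measurable => // i _.
by rewrite -[X in measurable X]setTI; exact: measurable_coord.
Qed.

Lemma borel_lebesgue_box (R : realType) (n : nat) (A : 'I_n -> set R) :
  (forall i, measurable (A i)) ->
  borel_lebesgue R n [set x : 'rV[R]_n | forall i, A i (x ord0 i)] =
  (\prod_(i < n) @lebesgue_measure R (A i))%E.
Proof.
elim: n A => [|n IHn] A mA.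
  by rewrite big_ord0 /= diracE mem_set// => -[].
rewrite big_ord_recl /= /lebesgue_step /pushforward.
rewrite (_ : _ @^-1` _ =
    A ord0 `*` [set x : 'rV[R]_n | forall i : 'I_n, A (lift ord0 i) (x ord0 i)]); last first.
  apply/seteqP; split => -[a x] /=.
    move=> h; split => [|i]; first by have := h ord0; rewrite mxE unlift_none.
    by have := h (lift ord0 i); rewrite mxE liftK.
  move=> [h0 h] i; rewrite mxE.
  by case: unliftP => [j ->|->] //=; exact: h.
rewrite product_measure1E//.
- by congr (_ * _)%E; exact: IHn.
- exact: mA.
- by apply: (@measurable_box _ _ (fun i : 'I_n => A (lift ord0 i))) => i.
Qed.

(* The type 'rV[R]_N with its Lebesgue (completed Borel) sigma-algebra. *)
Definition euclidean (R : realType) (N : nat) :=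
  caratheodory_type (borel_lebesgue R N)^*%mu.

Definition lebesgue_rV (R : realType) (N : nat) :
    set (euclidean R N) -> \bar R :=
  @completed_measure_extension _ _ R (borel_lebesgue R N).

HB.instance Definition _ (R : realType) (N : nat) :=
  Measure.on (@lebesgue_rV R N).

Lemma borel_lebesgueE (R : realType) (N : nat) (A : set (borel_rV R N)) :
  measurable A -> lebesgue_rV A = borel_lebesgue R N A.
Proof. exact: measurable_mu_extE. Qed.

Lemma measurable_borel_rV (R : realType) (N : nat) (A : set 'rV[R]_N) :
  measurable (A : set (borel_rV R N)) -> measurable (A : set (euclidean R N)).
Proof. exact: caratheodory_measurable_mu_ext. Qed.

Lemma lebesgue_rV_box (R : realType) (N : nat) (a b : 'I_N -> R) :
  (forall i, a i <= b i) ->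
  lebesgue_rV [set x : 'rV[R]_N | forall i, a i <= x ord0 i <= b i] =
  (\prod_(i < N) (b i - a i))%:E.
Proof.
move=> ab; pose A i : set R := `[a i, b i]%classic.
have mA i : measurable (A i) by exact: measurable_itv.
rewrite (_ : [set x | _] = [set x : 'rV[R]_N | forall i, A i (x ord0 i)]).
  rewrite borel_lebesgueE; last exact: measurable_box.
  rewrite borel_lebesgue_box// -prodEFin; apply: eq_bigr => i _.
  rewrite lebesgue_measure_itv/= lte_fin lt_neqAle ab andbT.
  by have [->|_] /= := eqVneq (a i) (b i); rewrite ?subrr// EFinB.
by apply/seteqP; split => x h i; have := h i; rewrite /A /= in_itv.
Qed.

Lemma open_measurable_rV (R : realType) (N : nat) (U : set 'rV[R]_N) :
  open U -> measurable (U : set (euclidean R N)).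
Proof.
move=> oU; apply: measurable_borel_rV.
pose box (z : 'rV[rat]_N * 'rV[rat]_N) : set 'rV[R]_N :=
  [set x | forall i, x ord0 i \in `]ratr (z.1 ord0 i), ratr (z.2 ord0 i)[].
pose B z := if `[< box z `<=` U >] then box z else set0.
have -> : U = \bigcup_z B z.
  apply/seteqP; split => [x Ux|x [z _]]; last first.
    by rewrite /B; case: asboolP => // zU /zU.
  have /nbhs_ballP[e /= e0 eU] := open_nbhs_nbhs (conj oU Ux).
  have ha i : exists q : rat, x ord0 i - e < ratr q < x ord0 i.
    have [q qx] := rat_in_itvoo (ltr_pwDr e0 (lexx (x ord0 i - e))).
    by exists q; move: qx; rewrite in_itv /= subrK.
  have hb i : exists q : rat, x ord0 i < ratr q < x ord0 i + e.
    have [q qx] := rat_in_itvoo (ltr_pwDr e0 (lexx (x ord0 i))).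
    by exists q; move: qx; rewrite in_itv.
  have [a ha'] := choice ha; have [b hb'] := choice hb.
  pose z := (\row_i a i, \row_i b i).
  have zU : box z `<=` U.
    move=> y yz; apply: eU; split => // j i; rewrite ord1 /ball /= ltr_norml.
    move: (yz i) (ha' i) (hb' i); rewrite /= !mxE in_itv /=.
    by move=> /andP[y1 y2] /andP[a1 a2] /andP[b1 b2]; lra.
  exists z => //; rewrite /B asboolT// => i /=.
  by move: (ha' i) (hb' i); rewrite !mxE in_itv /= => /andP[_ ->] /andP[->].
apply: countable_bigcupT_measurable; first exact: countableP.
move=> z; rewrite /B; case: ifP => // _.
by apply: (@measurable_box R N (fun i => `]_, _[%classic)) => i.
Qed.

Section sobolev.
Variables (R : realType) (N : nat).
Implicit Types (Omega : set 'rV[R]_N) (p : R) (w : 'rV[R]_N -> R).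

(* The norm that the library puts on 'rV[R]_N is the sup norm. *)
Definition enorm (z : 'rV[R]_N) : R := Num.sqrt (\sum_(i < N) z ord0 i ^+ 2).

Definition partial (i : 'I_N) w : 'rV[R]_N -> R :=
  fun x => 'D_(delta_mx ord0 i) w x.

Definition gradient w (x : 'rV[R]_N) : 'rV[R]_N := \row_i partial i w x.

(* All iterated partial derivatives exist everywhere and are continuous. *)
Definition smooth w := forall s : seq 'I_N,
  continuous (foldr partial w s) /\
  forall i x, derivable (foldr partial w s) x (delta_mx ord0 i).

Definition support w := closure [set x | w x != 0].

Definition Cc_infty Omega w :=
  [/\ smooth w, compact (support w) & support w `<=` Omega].

(* 'N[_]_p is an integral (p finite) or essential supremum (p = +oo) over the
   whole space; extending w by 0 outside Omega gives the norm of L^p(Omega). *)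
Definition LnormOn Omega (q : \bar R) w : \bar R :=
  'N[@lebesgue_rV R N]_q[EFin \o (w \_ Omega)].

(* The completion of C_c^oo(Omega) for |Dv|_p, realised in L^p(Omega): an
   element is a function v together with its gradient Dv, obtained as
   simultaneous L^p limits of test functions and of their gradients. As Omega
   has finite measure, convergence of the gradients forces convergence of the
   functions (Poincare inequality); integrating by parts against test functions
   shows that Dv is the weak gradient of v, so it is determined a.e. by v. *)
Record W01p Omega p := {
  Wfun :> 'rV[R]_N -> R ;
  Wgrad : 'rV[R]_N -> 'rV[R]_N ;
  Wfun_measurable : measurable_fun (Omega : set (euclidean R N)) Wfun ;
  Wgrad_measurable : forall i,
    measurable_fun (Omega : set (euclidean R N)) (fun x => Wgrad x ord0 i) ;
  W_closure : exists phi : nat -> 'rV[R]_N -> R,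
    [/\ forall k, Cc_infty Omega (phi k),
        LnormOn Omega p%:E (fun x => phi k x - Wfun x) @[k --> \oo] --> 0%E &
        LnormOn Omega p%:E (fun x => enorm (gradient (phi k) x - Wgrad x))
          @[k --> \oo] --> 0%E] }.

End sobolev.

Section functional.
Variables (R : realType) (N : nat).
Local Notation leb := (@lebesgue_rV R N).
Variables (Omega : set 'rV[R]_N) (p : R).
Variables (H : 'rV[R]_N -> R) (f : 'rV[R]_N -> R -> R).

Definition caratheodory_function :=
  (forall s, measurable_fun (Omega : set (euclidean R N)) (f ^~ s)) /\
  (\forall x \ae leb, Omega x -> continuous (f x)).

Definition locally_bounded := forall t : R, 0 < t ->
  (ereal_sup [set LnormOn Omega +oo%E (f ^~ s) | s in [set s | (`|s| <= t)%R]]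
     < +oo)%E.

Definition sign_growth (mu theta : R) (q : \bar R) :=
  match q with
  | r%:E => \forall x \ae leb, Omega x ->
      forall t : R, Num.sg t * f x t <= mu * (`|t| + theta) `^ (r - 1)
  | _ => True
  end.

Definition primitive (g : R -> R) (t : R) : R :=
  if 0 <= t then \int[lebesgue_measure]_(s in `[0, t]) g s
  else - \int[lebesgue_measure]_(s in `[t, 0]) g s.

Definition J (v : W01p Omega p) : \bar R :=
  (\int[leb]_(x in Omega) (H (Wgrad v x) - primitive (f x) (v x))%:E)%E.

Definition J_at (u v : W01p Omega p) : \bar R :=
  (\int[leb]_(x in Omega) (H (Wgrad v x) - f x (u x) * v x)%:E)%E.

Definition in_V (u v : W01p Omega p) :=
  leb.-integrable Omega (fun x => (f x (u x) * v x)%:E).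

Definition energy_critical_point (u : W01p Omega p) :=
  [/\ (J u < +oo)%E, in_V u u & forall v, in_V u v -> (J_at u u <= J_at u v)%E].

End functional.

Section critical_exponent.
Variables (R : realType) (N : nat) (p : R).

Definition sobolev_conjugate : R := N%:R * p / (N%:R - p).

(* q <= p^* and q < p^*, where p^* = +oo if p > N, and p^* stands for an
   arbitrary finite number if p = N. *)
Definition le_pstar (q : \bar R) : bool :=
  if p < N%:R then (q <= sobolev_conjugate%:E)%E
  else if p == N%:R then (q < +oo)%E else true.

Definition lt_pstar (q : \bar R) : bool :=
  if p < N%:R then (q < sobolev_conjugate%:E)%E else (q < +oo)%E.

End critical_exponent.

Definition exponent_domain (R : realType) (N : nat) : set (R * R) :=
  [set z | [/\ 1 <= z.1, 1 <= z.2 & lt_pstar N z.1 z.2%:E]].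

(* Main.v *)
From HB Require Import structures.
Require Import Defs.
From mathcomp Require Import all_boot all_order all_algebra.
From mathcomp Require Import all_classical all_reals all_analysis.
From mathcomp Require Import measurable_realfun ess_sup_inf ring lra.

(** Write A(k) = {|u| >= k}, a(k) = |A(k)|, and let D(k) and d(k, h) be the
    integrals of |Du|^p over A(k) and over the strip {k <= |u| <= h}. Two
    inequalities between these functions of the level carry the proof.

    Energy. Compare u with G(u), where G is a smooth version of the truncation
    T_k at height k, so that 0 <= G' <= 1, and G' <= 1/2 on A(k). Since |G(u)|
    is at most |u|, the competitor is admissible; convexity and H(0) = 0 give
    H(G'(u) Du) <= G'(u) H(Du), and minimality of u then bounds (c/2) D(k) by
    the integral of f(x,u) (u - T_k u) ([energy_superlevel]). By the sign
    condition this is at most the integral of mu (|u| + theta)^(q-1) (|u| - k)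
    over A(k) ([truncation_growth]).

    Gap between levels. If |A| < b^N, every test function w satisfies
    int_A |w| <= b sum_i int |d_i w| ([small_set_poincare_borel], by induction
    on the dimension). Applied to T_h u - T_k u on A(h), with the best b and
    Hoelder's inequality, it yields ([level_measure_step])
      (h - k) a(h) <= 2 N a(k)^(1 + 1/N - 1/p) d(k, h)^(1/p),
    which does the work of the Sobolev inequality for all p >= 1 at once.

    As soon as (h - k) a(h) <= B a(k)^(1 + e) with e > 0, the classical
    iteration of Stampacchia ([stampacchia]) makes a vanish at a finite level,
    that is, u is bounded. For p > N the bound D(k) <= D(0) is enough. For
    p <= N one first shows that a decays faster than every power of the level.
    If p = N, the gap inequality between the levels 2^j and 2^(j+1) says
    directly that a(2^(j+1)) / a(2^j) is O(2^-j). If p < N, put r = p^* and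
    Y_j = int_(A(2^j)) |u|^r. The energy inequality gives D(2^j) <= C Y_j; the
    gap inequality, Young's inequality and the fact that each point lies in
    boundedly many strips give Y_(j+1) <= C Y_j^(1 + 1/N) as soon as Y_j <= 1;
    and Y_j tends to 0 because it is a tail of a convergent integral. Hence u
    has all moments ([rapid_decay_critical], [moments_of_rapid_decay]), so
    D(k) <= C a(k)^(1 - eta) for eta as small as desired, and Stampacchia's
    iteration applies ([bounded_of_moments]).

    For the estimate, let M be the essential supremum of |u| and suppose
    theta < M. Then D(k) <= 2^q (mu/c) M^q a(k), and Stampacchia's iteration,
    started from the level M/2, would end below M unless
    M <= C (mu/c)^(1/p) M^(q/p) a(M/2)^(1/N). Raising this to the power N and
    using Chebyshev's inequality for a(M/2) leaves
    M^(N + q - qN/p) <= C (mu/c)^(N/p) int |u|^q ([sup_power_bound]), where the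
    exponent of M is positive exactly when q < p^*. *)

Set Implicit Arguments.
Unset Strict Implicit.
Unset Printing Implicit Defensive.
Import Order.TTheory GRing.Theory Num.Theory.
Import numFieldNormedType.Exports.

Local Open Scope classical_set_scope.
Local Open Scope ring_scope.

(** * A Poincare inequality on sets of small measure *)

Section borel_structure.
Variable R : realType.

(** An open set is the union of the sup-norm balls with rational centre and
    radius 1/(k+1) that it contains. Borel measurability, and not just
    Lebesgue measurability, is needed to slice along a coordinate. *)
Lemma open_borel n (U : set 'rV[R]_n) :
  open U -> measurable (U : set (borel_rV R n)).
Proof.
move=> oU.
pose cube (z : 'rV[rat]_n * nat) : set 'rV[R]_n :=
  ball (map_mx ratr z.1 : 'rV[R]_n) (z.2.+1%:R^-1).
pose B z := if `[< cube z `<=` U >] then cube z else set0.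
have -> : U = \bigcup_z B z.
  apply/seteqP; split => [x Ux|x [z _]]; last first.
    by rewrite /B; case: asboolP => // zU /zU.
  have /nbhs_ballP[e /= e0 eU] := open_nbhs_nbhs (conj oU Ux).
  have e20 : 0 < e / 2 by rewrite divr_gt0.
  have [k ke] := ltr_add_invr (y := 0) (x := e / 2) e20.
  rewrite add0r in ke.
  have k0 : 0 < k.+1%:R^-1 :> R by rewrite invr_gt0.
  set d : R := k.+1%:R^-1 in ke k0.
  have /choice[q hq] : forall i, exists q : rat,
      `|x ord0 i - ratr q| < d.
    move=> i; have [|q] := @rat_in_itvoo R (x ord0 i - d) (x ord0 i + d); first lra.
    by rewrite in_itv /= => /andP[q1 q2]; exists q; rewrite ltr_norml; lra.
  exists (\row_i q i, k) => //; rewrite /B asboolT /cube /=.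
    by split => // j i; rewrite ord1 /ball /= !mxE distrC.
  move=> y [_ hy]; apply: eU; split => // j i; rewrite ord1 /ball /=.
  have := hy ord0 i; rewrite /ball /= !mxE => h2.
  have h1 := hq i.
  have := ler_normD (x ord0 i - ratr (q i)) (ratr (q i) - y ord0 i).
  rewrite subrKA => h3; apply: (le_lt_trans h3).
  apply: (lt_le_trans (ltrD h1 h2)); rewrite -/d; lra.
apply: countable_bigcupT_measurable; first exact: countableP.
move=> [z k]; rewrite /B; case: ifP => // _.
rewrite (_ : cube (z, k) = [set x : 'rV[R]_n | forall i,
    ball (ratr (z ord0 i) : R) (k.+1%:R^-1) (x ord0 i)]).
  apply: (@measurable_box R n (fun i => ball (ratr (z ord0 i) : R) k.+1%:R^-1)).
  by move=> i; exact: measurable_ball.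
apply/seteqP; split => x /=; rewrite /cube /=.
  by move=> [_ h] i; have := h ord0 i; rewrite mxE.
by move=> h; split => // j i; rewrite ord1 mxE.
Qed.

Lemma continuous_borel n (w : 'rV[R]_n -> R) :
  continuous w -> measurable_fun [set: borel_rV R n] (w : borel_rV R n -> R).
Proof.
move=> cw; apply: (measurability _ (RGenOpens.measurableE R)) => //.
move=> _ [_ [a [b ->]] <-]; rewrite setTI; apply: open_borel.
by apply: open_comp => [x _|]; [exact: cw|exact: interval_open].
Qed.

(** The class on which the induction on the dimension runs: unlike smoothness
    with compact support in an open set, it passes to slices at no cost. *)
Definition C1_bounded_support n (w : 'rV[R]_n -> R) :=
  [/\ continuous w,
      forall i x, derivable w x (delta_mx ord0 i),
      forall i, continuous (partial i w) &
      exists r, forall (x : 'rV[R]_n) i, r < `|x ord0 i| -> w x = 0].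

Let cons n (t : R) (x : 'rV[R]_n) : 'rV[R]_n.+1 := rV_cons (t, x).

Lemma rV_cons0 n t (x : 'rV[R]_n) : cons t x ord0 ord0 = t.
Proof. by rewrite mxE unlift_none. Qed.

Lemma rV_consS n t (x : 'rV[R]_n) i : cons t x ord0 (lift ord0 i) = x ord0 i.
Proof. by rewrite mxE liftK. Qed.

Lemma continuous_rV_cons n t : continuous (@cons n t).
Proof.
move=> x; apply/(@cvg_ballP _ _ _ (nbhs x) (nbhs_filter x)) => e e0.
apply: filterS (nbhsx_ballx x e e0) => y [_ h]; split => // j i.
rewrite [j]ord1; have [k ->|->] := unliftP ord0 i.
  by rewrite !rV_consS; exact: h.
by rewrite !rV_cons0; exact: ballxx.
Qed.

Lemma rV_cons_shift0 n (h t : R) (x : 'rV[R]_n) :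
  cons (h + t) x = h *: delta_mx ord0 ord0 + cons t x.
Proof.
apply/rowP => i; rewrite !mxE; case: unliftP => [j ->|->] /=.
  by rewrite mulr0 add0r.
by rewrite mulr1.
Qed.

Lemma rV_cons_shiftS n (h t : R) (x : 'rV[R]_n) i :
  cons t (h *: delta_mx ord0 i + x) =
  h *: delta_mx ord0 (lift ord0 i) + cons t x.
Proof.
apply/rowP => j; rewrite !mxE; case: unliftP => [k ->|->] /=.
  by rewrite !mxE (inj_eq lift_inj).
by rewrite /= mulr0 add0r.
Qed.

Lemma continuous_rV_cons1 n (x : 'rV[R]_n) : continuous (fun t => cons t x).
Proof.
move=> t; apply/cvg_ballP => e e0.
have := nbhsx_ballx t e e0; apply: (@filterS _ _ (nbhs_filter t)) => s h; split => // j i.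
rewrite [j]ord1; have [k ->|->] := unliftP ord0 i.
  by rewrite !rV_consS; exact: ballxx.
by rewrite !rV_cons0.
Qed.

(** Directional derivatives only see the restriction to a line, which allows
    derivatives in different spaces to be compared. *)
Lemma eq_on_line (V W : normedModType R) (f : V -> R) (g : W -> R) a v b u :
  (forall h : R, f (h *: v + a) = g (h *: u + b)) ->
  'D_v f a = 'D_u g b /\ (derivable f a v <-> derivable g b u).
Proof.
move=> fg; rewrite /derive /derivable.
have -> : (fun h : R => h^-1 *: ((f \o shift a) (h *: v) - f a)) =
          (fun h : R => h^-1 *: ((g \o shift b) (h *: u) - g b)).
  apply/funext => h /=; rewrite fg.
  by have := fg 0; rewrite !scale0r !add0r => ->.
by [].
Qed.

Lemma derive_rV_consS n (w : 'rV[R]_n.+1 -> R) t (x : 'rV[R]_n) i :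
  partial i (w \o cons t) x = partial (lift ord0 i) w (cons t x) /\
  (derivable (w \o cons t) x (delta_mx ord0 i) <->
   derivable w (cons t x) (delta_mx ord0 (lift ord0 i))).
Proof. by apply: eq_on_line => h /=; rewrite rV_cons_shiftS. Qed.

Lemma derive_rV_cons0 n (w : 'rV[R]_n.+1 -> R) t (x : 'rV[R]_n) :
  'D_1 (fun s => w (cons s x)) t = partial ord0 w (cons t x) /\
  (derivable (fun s => w (cons s x)) t 1 <->
   derivable w (cons t x) (delta_mx ord0 ord0)).
Proof.
by apply: eq_on_line => h /=; rewrite -rV_cons_shift0 [h *: _]mulr1.
Qed.

Lemma C1_bounded_support_section n (w : 'rV[R]_n.+1 -> R) t :
  C1_bounded_support w -> C1_bounded_support (w \o cons t).
Proof.
move=> [cw dw cdw [r wr]]; split.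
- move=> x; apply: continuous_comp; [exact: continuous_rV_cons|exact: cw].
- by move=> i x; apply/(derive_rV_consS w t x i).2; exact: dw.
- move=> i; rewrite (_ : partial i _ = partial (lift ord0 i) w \o cons t).
    move=> x; apply: continuous_comp; [exact: continuous_rV_cons|exact: cdw].
  by apply/funext => x; exact: (derive_rV_consS w t x i).1.
- by exists r => x i; rewrite -(rV_consS t x) => /wr.
Qed.

(** Integrate g' from a point left of the support up to t. *)
Lemma abs_le_integral_derive (g : R -> R) (r t : R) :
  (forall s, r < `|s| -> g s = 0) -> (forall s, derivable g s 1) ->
  continuous (fun s => 'D_1 g s) ->
  ((`|g t|)%:E <= \int[lebesgue_measure]_s (`|'D_1 g s|)%:E)%E.
Proof.
(* A point to the left of both t and the support. *)
move=> gr dg cg; pose a := - (`|r| + `|t| + 1).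
have at_ : a < t by rewrite /a; have := ler_norm (- t); rewrite normrN; have := normr_ge0 r; lra.
have ga : g a = 0.
  apply: gr; rewrite /a normrN ger0_norm; last first.
    by have := normr_ge0 r; have := normr_ge0 t; lra.
  by have := ler_norm r; have := normr_ge0 t; lra.
have cdg s : {for s, continuous g}.
  by apply/differentiable_continuous; exact/derivable1_diffP.
have mdg : measurable_fun setT (fun s => 'D_1 g s).
  exact: continuous_measurable_fun.
have /= E := @continuous_FTC2 R (fun s => 'D_1 g s) g a t at_.
rewrite ga sube0 in E; rewrite -[leLHS]/(`|(g t)%:E|)%E -E; first last.
- by move=> s _; rewrite derive1E.
- split => //.
  + exact: (@cvg_at_right_filter _ _ g _ _ (cdg a)).
  + exact: (@cvg_at_left_filter _ _ g _ _ (cdg t)).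
- exact: continuous_subspaceT.
apply: (le_trans (le_abse_integral _ _ _)) => //.
  by apply/measurable_EFinP; exact: measurable_funS mdg.
apply: ge0_subset_integral => //.
by apply/measurable_EFinP; exact: measurableT_comp.
Qed.

Section slicing.
Variables (n : nat) (F : borel_rV R n.+1 -> \bar R).
Hypotheses (mF : measurable_fun setT F) (F0 : forall x, (0 <= F x)%E).
Let m := borel_lebesgue R n.

Let mcF : measurable_fun setT (F \o @rV_cons R n).
Proof. by apply: measurableT_comp => //; exact: measurable_rV_cons. Qed.

Let cF0 z : (0 <= (F \o @rV_cons R n) z)%E. Proof. exact: F0. Qed.

Lemma integral_borel_lebesgueS :
  (\int[borel_lebesgue R n.+1]_x F x =
   \int[lebesgue_measure]_t \int[m]_x F (cons t x))%E.
Proof.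
rewrite [LHS](_ : _ = \int[pushforward (@lebesgue_measure R \x m)
  (@rV_cons R n)]_x F x)%E; last by [].
rewrite ge0_integral_pushforward//; last exact: measurable_rV_cons.
by rewrite preimage_setT fubini_tonelli1.
Qed.

Lemma integral_borel_lebesgueS_swap :
  (\int[borel_lebesgue R n.+1]_x F x =
   \int[m]_x \int[lebesgue_measure]_t F (cons t x))%E.
Proof.
rewrite integral_borel_lebesgueS.
exact: (@fubini_tonelli _ _ _ _ _ lebesgue_measure m (F \o @rV_cons R n)).
Qed.

Lemma measurable_integral_slice :
  measurable_fun [set: R] (fun t => \int[m]_x F (cons t x))%E.
Proof. exact: (@measurable_fun_fubini_tonelli_F _ _ _ _ _ m (F \o @rV_cons R n)). Qed.

Lemma measurable_integral_line : measurable_fun [set: borel_rV R n]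
  (fun x => \int[lebesgue_measure]_t F (cons t x))%E.
Proof. exact: (@measurable_fun_fubini_tonelli_G _ _ _ _ _ lebesgue_measure (F \o @rV_cons R n)). Qed.

Lemma measurable_slice t : measurable_fun [set: borel_rV R n] (fun x => F (cons t x)).
Proof. exact: (measurableT_comp mcF (pair1_measurable t)). Qed.

End slicing.

(** Induction on the dimension, slicing orthogonally to the first axis. Call a
    slice bad if the section of A has measure at least b^n. On a good slice the
    induction hypothesis applies; on every slice, bad ones included,
    int |w(t,.)| is at most the integral of |d_0 w| over the whole space. By
    Chebyshev's inequality the bad slices fill a set of t of measure at most
    |A| / b^n <= b, so that they contribute at most b int |d_0 w|. The strict
    bound on |A| is what forces A to be null in dimension 0. *)
Lemma small_set_poincare_borel n (A : set (borel_rV R n)) (w : 'rV[R]_n -> R) (b : R) :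
  0 < b -> C1_bounded_support w -> measurable A ->
  (borel_lebesgue R n A < (b ^+ n)%:E)%E ->
  (\int[borel_lebesgue R n]_(x in A) (`|w x|)%:E <=
   b%:E * \sum_(i < n) \int[borel_lebesgue R n]_x (`|partial i w x|)%:E)%E.
Proof.
move=> b0; elim: n A w => [|n IHn] A w Cw mA Ab.
  have A0 : borel_lebesgue R 0 A = 0%E.
    by move: Ab; rewrite expr0 /= diracE; case: (_ \in _); rewrite //= ltxx.
  rewrite big_ord0 mule0 null_set_integral//.
  apply/measurable_EFinP; apply: measurableT_comp => //.
  by apply: measurable_funTS; apply: continuous_borel; case: Cw.
pose m := borel_lebesgue R n.
have mabs k (u : 'rV[R]_k -> R) : continuous u ->
    measurable_fun [set: borel_rV R k] (fun x => (`|u x|)%:E).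
  move=> cu; apply/measurable_EFinP; apply: measurableT_comp => //.
  exact: continuous_borel.
have [cw dw cdw [r wr]] := Cw.
pose F := ((fun x => (`|w x|)%:E) \_ A).
have mF : measurable_fun setT F.
  by apply/(measurable_restrictT _ mA); apply: measurable_funTS; exact: mabs.
have F0 x : (0 <= F x)%E by apply: erestrict_ge0 => y _; rewrite lee_fin.
pose A' : set (R * borel_rV R n) := @rV_cons R n @^-1` A.
have mA' : measurable A'.
  by rewrite -[A']setTI; exact: measurable_rV_cons.
pose phi t := (\int[m]_(x in xsection A' t) (`|w (cons t x)|)%:E)%E.
have phiE t : phi t = (\int[m]_x F (cons t x))%E.
  rewrite /phi integral_mkcond; apply: eq_integral => x _.
  rewrite !patchE; congr (if _ then _ else _); apply/idP/idP;
    by rewrite !inE /xsection /= inE.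
pose T : set R := [set t | (b ^+ n)%:E <= m (xsection A' t)]%E.
have mT : measurable T.
  rewrite -[T]setTI; apply: emeasurable_fun_c_infty => //.
  exact: measurable_fun_xsection.
pose G := (\int[borel_lebesgue R n.+1]_x (`|partial ord0 w x|)%:E)%E.
have G0 : (0 <= G)%E by apply: integral_ge0 => x _; rewrite lee_fin.
pose S t := (\sum_(i < n)
  \int[m]_x (`|partial (lift ord0 i) w (cons t x)|)%:E)%E.
have S0 t : (0 <= S t)%E.
  by apply: sume_ge0 => i _; apply: integral_ge0 => x _; rewrite lee_fin.
have mS : measurable_fun [set: R] S.
  apply: emeasurable_sum => i.
  by apply: (measurable_integral_slice (mabs _ _ (cdw (lift ord0 i)))) => x;
    rewrite lee_fin.
have phi_le t : (phi t <= b%:E * S t + G * (\1_T t)%:E)%E.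
  have [tT|tT] := boolP (t \in T); rewrite indicE ?tT ?(negbTE tT).
    rewrite mule1 (le_trans (y := G)) ?leeDr ?mule_ge0 ?lee_fin ?(ltW b0)//.
    rewrite /G integral_borel_lebesgueS_swap; last 2 first.
    - exact: mabs.
    - by move=> x; rewrite lee_fin.
    rewrite phiE; apply: ge0_le_integral => //.
    - exact: measurable_slice.
    - by apply: (measurable_integral_line (mabs _ _ (cdw ord0))) => x; rewrite lee_fin.
    - move=> x _; rewrite /F patchE; case: ifPn => _; last first.
        by apply: integral_ge0 => s _; rewrite lee_fin.
      have -> : (fun s => (`|partial ord0 w (cons s x)|)%:E) =
          (fun s => (`|'D_1 (fun s => w (cons s x)) s|)%:E).
        by apply/funext => s; rewrite (derive_rV_cons0 w s x).1.
      apply: (@abs_le_integral_derive (fun s => w (cons s x)) r).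
      + by move=> s; rewrite -{1}(rV_cons0 s x); exact: wr.
      + by move=> s; apply/(derive_rV_cons0 w s x).2; exact: dw.
      + have -> : (fun s => 'D_1 (fun s => w (cons s x)) s) =
            (fun s => partial ord0 w (cons s x)).
          by apply/funext => s; rewrite (derive_rV_cons0 w s x).1.
        move=> s; apply: continuous_comp; first exact: continuous_rV_cons1.
        exact: cdw.
  have -> : S t = (\sum_(i < n)
      \int[m]_x (`|partial i (w \o cons t) x|)%:E)%E.
    apply: eq_bigr => i _; apply: eq_integral => x _.
    by rewrite (derive_rV_consS w t x i).1.
  rewrite mule0 adde0; apply: IHn; first exact: C1_bounded_support_section.
    exact: measurable_xsection.
  by rewrite ltNge; apply/negP => h; move/negP: tT; apply; rewrite inE.
(* Chebyshev: each bad slice takes up at least b^n of the measure of A. *)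
have bT : (lebesgue_measure T <= b%:E)%E.
  have bn0 : 0 < b ^+ n by rewrite exprn_gt0.
  have h : ((b ^+ n)%:E * lebesgue_measure T <= (b ^+ n.+1)%:E)%E.
    apply: le_trans (ltW Ab).
    rewrite -integral_cst// [leRHS](_ : _ = \int[lebesgue_measure]_t m (xsection A' t))%E; last by [].
    apply: (@le_trans _ _ (\int[lebesgue_measure]_(t in T) m (xsection A' t))%E).
      apply: ge0_le_integral => //.
      - by move=> t _; rewrite lee_fin ltW.
      - by apply: measurable_funTS; exact: measurable_fun_xsection.
    by apply: ge0_subset_integral => //; exact: measurable_fun_xsection.
  rewrite -(@lee_pmul2l _ (b ^+ n)%:E) ?lte_fin// -EFinM -exprSr.
  exact: h.
rewrite integral_mkcond integral_borel_lebesgueS//.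
have -> : (\int[lebesgue_measure]_t \int[m]_x F (cons t x) =
    \int[lebesgue_measure]_t phi t)%E.
  by apply: eq_integral => t _; rewrite phiE.
apply: (@le_trans _ _ (\int[lebesgue_measure]_t
   (b%:E * S t + G * (\1_T t)%:E)))%E.
  apply: ge0_le_integral => //.
  - by move=> t _; rewrite phiE; exact: integral_ge0.
  - by rewrite (_ : phi = fun t => \int[m]_x F (cons t x))%E;
      [exact: measurable_integral_slice|exact/funext].
  - apply: emeasurable_funD; apply: measurable_funeM => //.
    by apply/measurable_EFinP.
rewrite ge0_integralD//; last 4 first.
- by move=> t _; rewrite mule_ge0// lee_fin ltW.
- exact: measurable_funeM.
- by move=> t _; rewrite mule_ge0// lee_fin.
- by apply: measurable_funeM; exact/measurable_EFinP.
rewrite ge0_integralZl//; last by rewrite lee_fin ltW.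
rewrite ge0_integralZl//; last exact/measurable_EFinP.
have intS : (\int[lebesgue_measure]_t S t = \sum_(i < n)
    \int[borel_lebesgue R n.+1]_x (`|partial (lift ord0 i) w x|)%:E)%E.
  rewrite ge0_integral_sum//; last 2 first.
  - move=> i; apply: (measurable_integral_slice (mabs _ _ (cdw (lift ord0 i)))).
    by move=> x; rewrite lee_fin.
  - by move=> i t _; apply: integral_ge0 => x _; rewrite lee_fin.
  apply: eq_bigr => i _; rewrite integral_borel_lebesgueS//; exact: mabs.
rewrite integral_indic// setIT intS big_ord_recl -/G [leRHS]ge0_muleDr//; last first.
  by apply: sume_ge0 => i _; apply: integral_ge0 => x _; rewrite lee_fin.
by rewrite addeC leeD// muleC lee_wpmul2r.
Qed.

End borel_structure.

(** * Smooth truncations *)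

Section smooth_calculus.
Variables (R : realType) (N : nat).
Implicit Types (w : 'rV[R]_N -> R).

(** The class C^n. Smoothness is the conjunction of all these, and they allow
    closure properties to be proved by induction on n. *)
Fixpoint class_C n w : Prop :=
  continuous w /\
  if n is m.+1 then
    (forall i x, derivable w x (delta_mx ord0 i)) /\
    forall i, class_C m (partial i w)
  else True.

Lemma class_CS n w : class_C n.+1 w -> class_C n w.
Proof.
elim: n w => [|n IHn] w [cw [dw pw]]; first by [].
by split=> //; split => // i; apply: IHn; exact: pw.
Qed.

Lemma smoothP w : smooth w <-> forall n, class_C n w.
Proof.
split=> [|h].
  move=> + n; elim: n w => [|n IHn] w sw; split; first exact: (sw [::]).1.
  - by [].
  - exact: (sw [::]).1.
  - split=> [|i]; first exact: (sw [::]).2.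
    by apply: IHn => s; have := sw (rcons s i); rewrite foldr_rcons.
move=> s; elim/last_ind: s w h => [|s i IHs] w h.
  by have [cw [dw _]] := h 1%N; split.
rewrite foldr_rcons; apply: IHs => n.
by have [_ [_ pw]] := h n.+1; exact: pw.
Qed.

Lemma class_C_cst n c : class_C n (cst c : 'rV[R]_N -> R).
Proof.
elim: n c => [|n IHn] c; (split; first exact: cst_continuous) => //.
split=> [i x|i]; first exact: derivable_cst.
rewrite (_ : partial i _ = cst 0); first exact: IHn.
by apply/funext => x; rewrite /partial derive_cst.
Qed.

Lemma class_CD n w1 w2 : class_C n w1 -> class_C n w2 -> class_C n (fun x => w1 x + w2 x).
Proof.
elim: n w1 w2 => [|n IHn] w1 w2 [c1 p1] [c2 p2]; split=> //.
- by move=> x; exact: (continuousD (c1 x) (c2 x)).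
- by move=> x; exact: (continuousD (c1 x) (c2 x)).
- have [[d1 {}p1] [d2 {}p2]] := (p1, p2).
  split=> [i x|i]; first exact: derivableD.
  rewrite (_ : partial i _ = fun x => partial i w1 x + partial i w2 x).
    by apply: IHn; [exact: p1|exact: p2].
  by apply/funext => x; rewrite /partial deriveD.
Qed.

(** By Leibniz' rule the partial derivative of a product is again made of sums
    and products of functions of class C^n. *)
Lemma class_CM n w1 w2 : class_C n w1 -> class_C n w2 -> class_C n (fun x => w1 x * w2 x).
Proof.
elim: n w1 w2 => [|n IHn] w1 w2 k1 k2; have [c1 p1] := k1; have [c2 p2] := k2;
  (split; first by move=> x; exact: (continuousM (c1 x) (c2 x))) => //.
have [[d1 {}p1] [d2 {}p2]] := (p1, p2).
split=> [i x|i]; first exact: derivableM.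
rewrite (_ : partial i _ =
    fun x => w1 x * partial i w2 x + w2 x * partial i w1 x).
  by apply: class_CD; apply: IHn; [exact: class_CS|exact: p2|exact: class_CS|exact: p1].
by apply/funext => x; rewrite /partial deriveM.
Qed.

(** The chain rule for a function of one variable after a function that is
    merely derivable along one direction. *)
Lemma is_derive_comp_line (F : R -> R) (F' : R) w x i :
  is_derive (w x) 1 F F' -> derivable w x (delta_mx ord0 i) ->
  is_derive x (delta_mx ord0 i) (F \o w) (F' * partial i w x).
Proof.
move=> dF dw; set e := delta_mx ord0 i.
pose l h : R := w (h *: e + x).
have [wE dwE] : 'D_e w x = 'D_1 l 0 /\ (derivable w x e <-> derivable l 0 1).
  by apply: eq_on_line => h; rewrite /l addr0 [h *: 1]mulr1.
have [FE dFE] : 'D_e (F \o w) x = 'D_1 (F \o l) 0 /\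
    (derivable (F \o w) x e <-> derivable (F \o l) 0 1).
  by apply: eq_on_line => h /=; rewrite /l addr0 [h *: 1]mulr1.
have l0 : l 0 = w x by rewrite /l scale0r add0r.
have dl : is_derive (0 : R) (1 : R) l ('D_e w x).
  by rewrite wE; apply: derivableP; exact/dwE.
have dF0 : is_derive (l 0) 1 F F' by rewrite l0.
have [dFl eFl] := is_derive1_comp dF0 dl.
by split; [exact/dFE|rewrite FE].
Qed.

End smooth_calculus.

Section smoothed_truncation.
Variable R : realType.
Implicit Types e t s k : R.

(** Regularisations, at scale e, of |t|, of its inverse, of the sign of t, and
    of the truncation T_k t = (|t + k| - |t - k|) / 2 with its derivative. The
    derivative of the truncation is smooth because that of [inv_smooth_abs] is
    a polynomial in t and [inv_smooth_abs] itself. *)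
Definition smooth_abs e t := Num.sqrt (t ^+ 2 + e ^+ 2).
Definition inv_smooth_abs e t := (smooth_abs e t)^-1.
Definition smooth_sgn e t := t * inv_smooth_abs e t.
Definition smooth_trunc e k t := (smooth_abs e (t + k) - smooth_abs e (t - k)) / 2.
Definition smooth_trunc_deriv e k t := (smooth_sgn e (t + k) - smooth_sgn e (t - k)) / 2.

Lemma smooth_abs_gt0 e t : 0 < e -> 0 < smooth_abs e t.
Proof.
by move=> e0; rewrite sqrtr_gt0 ltr_wpDl ?sqr_ge0 ?exprn_gt0.
Qed.

Lemma sqr_smooth_abs e t : smooth_abs e t ^+ 2 = t ^+ 2 + e ^+ 2.
Proof. by rewrite sqr_sqrtr// addr_ge0 ?sqr_ge0. Qed.

Lemma le_norm_smooth_abs e t : `|t| <= smooth_abs e t.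
Proof. by rewrite -sqrtr_sqr ler_wsqrtr// lerDl sqr_ge0. Qed.

Lemma smooth_abs_le_norm e t : 0 <= e -> smooth_abs e t <= `|t| + e.
Proof.
move=> e0; rewrite -(@ler_pXn2r _ 2)// ?nnegrE ?addr_ge0 ?sqrtr_ge0//.
rewrite sqr_smooth_abs sqrrD real_normK ?num_real// addrAC lerDl.
by rewrite mulrn_wge0// mulr_ge0.
Qed.

Lemma smooth_abs_lip e s t : 0 < e -> `|smooth_abs e s - smooth_abs e t| <= `|s - t|.
Proof.
move=> e0; have s0 := smooth_abs_gt0 s e0; have t0 := smooth_abs_gt0 t e0.
rewrite -(@ler_pM2r _ (smooth_abs e s + smooth_abs e t)) ?addr_gt0//.
rewrite -{1}(ger0_norm (ltW (addr_gt0 s0 t0))) -normrM -subr_sqr !sqr_smooth_abs.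
have -> : s ^+ 2 + e ^+ 2 - (t ^+ 2 + e ^+ 2) = (s - t) * (s + t) by ring.
rewrite normrM ler_wpM2l// (le_trans (ler_normD _ _))//.
by rewrite lerD// le_norm_smooth_abs.
Qed.

Lemma is_derive_smooth_abs e t : 0 < e -> is_derive t 1 (smooth_abs e) (smooth_sgn e t).
Proof.
move=> e0.
have st0 : 0 < t ^+ 2 + e ^+ 2 by rewrite ltr_wpDl ?sqr_ge0 ?exprn_gt0.
have d1 : is_derive t 1 (fun t : R => t ^+ 2 + e ^+ 2) (2 * t).
  apply: is_derive_eq; rewrite /GRing.scale /=; ring.
have := @is_derive1_comp R Num.sqrt (fun t => t ^+ 2 + e ^+ 2) t _ _
  (is_derive1_sqrt st0) d1.
move=> /is_derive_eq; apply; rewrite /smooth_sgn /inv_smooth_abs -/(smooth_abs e t).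
by have h := smooth_abs_gt0 t e0; field; rewrite gt_eqF.
Qed.

Lemma is_derive_inv_smooth_abs e t : 0 < e ->
  is_derive t 1 (inv_smooth_abs e) (- t * inv_smooth_abs e t ^+ 3).
Proof.
move=> e0; have st := smooth_abs_gt0 t e0.
have := is_deriveV (lt0r_neq0 st) (is_derive_smooth_abs t e0).
move=> /is_derive_eq; apply; rewrite /smooth_sgn /inv_smooth_abs /GRing.scale /=.
by field; rewrite gt_eqF.
Qed.

Lemma is_derive_translate (F : R -> R) t a F' :
  is_derive (t + a) 1 F F' -> is_derive t 1 (fun s => F (s + a)) F'.
Proof.
move=> dF; have da : is_derive t 1 (fun s => s + a) 1.
  by apply: is_derive_eq; rewrite addr0.
have := @is_derive1_comp R F (fun s => s + a) t _ _ dF da.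
by move=> /is_derive_eq; apply; rewrite mulr1.
Qed.

Lemma is_derive_smooth_trunc e k t : 0 < e ->
  is_derive t 1 (smooth_trunc e k) (smooth_trunc_deriv e k t).
Proof.
move=> e0.
have d1 := is_derive_translate (is_derive_smooth_abs (t + k) e0).
have d2 := is_derive_translate (is_derive_smooth_abs (t - k) e0).
have := is_deriveZ 2^-1 (is_deriveB d1 d2).
rewrite (_ : _ \*: _ = smooth_trunc e k) => [/is_derive_eq|]; first apply.
  by rewrite /smooth_trunc_deriv /GRing.scale /= mulrC.
by apply/funext => s; rewrite /smooth_trunc mulrC.
Qed.

Lemma smooth_trunc0 e k : smooth_trunc e k 0 = 0.
Proof. by rewrite /smooth_trunc add0r sub0r /smooth_abs sqrrN subrr mul0r. Qed.

Lemma inv_smooth_abs_ge0 e t : 0 <= inv_smooth_abs e t.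
Proof. by rewrite invr_ge0 sqrtr_ge0. Qed.

Lemma smooth_sgnN e t : smooth_sgn e (- t) = - smooth_sgn e t.
Proof. by rewrite /smooth_sgn /inv_smooth_abs /smooth_abs sqrrN mulNr. Qed.

Lemma norm_smooth_sgn e t : 0 < e -> `|smooth_sgn e t| <= 1.
Proof.
move=> e0; have st := smooth_abs_gt0 t e0.
rewrite normrM (ger0_norm (inv_smooth_abs_ge0 _ _)) /inv_smooth_abs ler_pdivrMr// mul1r.
exact: le_norm_smooth_abs.
Qed.

Lemma smooth_sgn_homo e s t : 0 < e -> s <= t -> smooth_sgn e s <= smooth_sgn e t.
Proof.
move=> e0.
have pos x y : 0 <= x -> x <= y -> smooth_sgn e x <= smooth_sgn e y.
  move=> x0 xy; have y0 := le_trans x0 xy.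
  have [sx sy] := (smooth_abs_gt0 x e0, smooth_abs_gt0 y e0).
  rewrite /smooth_sgn /inv_smooth_abs ler_pdivrMr// mulrAC ler_pdivlMr//.
  rewrite -(@ler_pXn2r _ 2)// ?nnegrE ?mulr_ge0// ?(ltW sx) ?(ltW sy)//.
  rewrite !exprMn !sqr_smooth_abs !mulrDr [y ^+ 2 * x ^+ 2]mulrC lerD2l.
  by rewrite ler_wpM2r ?sqr_ge0// ler_pXn2r.
have sg0 x : 0 <= x -> 0 <= smooth_sgn e x.
  by move=> x0; rewrite mulr_ge0// inv_smooth_abs_ge0.
move=> st; have [s0|s0] := leP 0 s; first exact: pos.
have [t0|t0] := leP 0 t.
  rewrite (le_trans _ (sg0 _ t0))// -oppr_ge0 -smooth_sgnN sg0//.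
  by rewrite oppr_ge0 ltW.
by rewrite -lerN2 -!smooth_sgnN; apply: pos; rewrite ?lerN2// oppr_ge0 ltW.
Qed.

Lemma smooth_sgn_lip e s t : 0 < e -> `|smooth_sgn e s - smooth_sgn e t| <= 2 / e * `|s - t|.
Proof.
move=> e0; have [ss st] := (smooth_abs_gt0 s e0, smooth_abs_gt0 t e0).
have isabs_le x : inv_smooth_abs e x <= e^-1.
  rewrite lef_pV2 ?posrE ?smooth_abs_gt0// -(@ler_pXn2r _ 2)// ?nnegrE ?sqrtr_ge0//.
    by rewrite sqr_smooth_abs lerDr sqr_ge0.
  exact: ltW.
have -> : smooth_sgn e s - smooth_sgn e t = (s - t) * inv_smooth_abs e s +
    smooth_sgn e t * (inv_smooth_abs e s * (smooth_abs e t - smooth_abs e s)).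
  by rewrite /smooth_sgn /inv_smooth_abs; field; rewrite !gt_eqF.
have -> : 2 / e * `|s - t| = `|s - t| / e + `|s - t| / e by ring.
rewrite (le_trans (ler_normD _ _))// lerD//.
  by rewrite normrM ler_wpM2l// ger0_norm ?inv_smooth_abs_ge0.
rewrite normrM -[leRHS]mul1r ler_pM ?norm_smooth_sgn//.
by rewrite normrM mulrC (distrC s) ler_pM ?smooth_abs_lip// ger0_norm ?inv_smooth_abs_ge0.
Qed.

Lemma smooth_trunc_deriv_ge0 e k t : 0 < e -> 0 <= k -> 0 <= smooth_trunc_deriv e k t.
Proof.
by move=> e0 k0; rewrite divr_ge0// subr_ge0 smooth_sgn_homo//; lra.
Qed.

Lemma smooth_trunc_deriv_le1 e k t : 0 < e -> smooth_trunc_deriv e k t <= 1.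
Proof.
move=> e0; have := norm_smooth_sgn (t + k) e0; have := norm_smooth_sgn (t - k) e0.
by rewrite /smooth_trunc_deriv !ler_norml => /andP[? ?] /andP[? ?]; lra.
Qed.

(** For |t| >= k one of the two terms of the derivative is nonpositive and the
    other is at most 1/2. *)
Lemma smooth_trunc_deriv_le_half e k t : 0 < e -> k <= `|t| -> smooth_trunc_deriv e k t <= 2^-1.
Proof.
move=> e0; have := norm_smooth_sgn (t + k) e0; have := norm_smooth_sgn (t - k) e0.
rewrite /smooth_trunc_deriv !ler_norml => /andP[? ?] /andP[? ?].
have sg0 x : 0 <= x -> 0 <= smooth_sgn e x.
  by move=> x0; rewrite mulr_ge0// inv_smooth_abs_ge0.
rewrite ler_normr => /orP[kt|kt].
  by have := sg0 (t - k); rewrite subr_ge0 => /(_ kt) ?; lra.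
have := sg0 (- (t + k)); rewrite smooth_sgnN !oppr_ge0 => h.
by have : smooth_sgn e (t + k) <= 0; [apply: h; lra|lra].
Qed.

Lemma smooth_trunc_deriv_lip e k s t : 0 < e ->
  `|smooth_trunc_deriv e k s - smooth_trunc_deriv e k t| <= 2 / e * `|s - t|.
Proof.
move=> e0; have := smooth_sgn_lip (s + k) (t + k) e0.
have := smooth_sgn_lip (s - k) (t - k) e0.
rewrite (_ : s - k - (t - k) = s - t); last by ring.
rewrite (_ : s + k - (t + k) = s - t); last by ring.
move: (2 / e * _) => B.
by rewrite /smooth_trunc_deriv !ler_norml => /andP[? ?] /andP[? ?]; lra.
Qed.

Lemma smooth_trunc_lip e k s t : 0 < e ->
  `|smooth_trunc e k s - smooth_trunc e k t| <= `|s - t|.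
Proof.
move=> e0; have := smooth_abs_lip (s + k) (t + k) e0.
have := smooth_abs_lip (s - k) (t - k) e0.
rewrite (_ : s - k - (t - k) = s - t); last by ring.
rewrite (_ : s + k - (t + k) = s - t); last by ring.
move: (`|s - t|) => B; rewrite /smooth_trunc !ler_norml.
by move=> /andP[? ?] /andP[? ?]; apply/andP; split; lra.
Qed.

Definition trunc k t := (`|t + k| - `|t - k|) / 2.

Lemma smooth_trunc_close e k t : 0 <= e -> `|smooth_trunc e k t - trunc k t| <= e.
Proof.
move=> e0; have := smooth_abs_le_norm (t + k) e0; have := smooth_abs_le_norm (t - k) e0.
have := le_norm_smooth_abs e (t + k); have := le_norm_smooth_abs e (t - k).
by move=> *; rewrite /smooth_trunc /trunc ler_norml; apply/andP; split; lra.
Qed.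

(** Rationalising the difference of square roots. It exhibits the smooth
    truncation of t as a multiple of t, by a factor between 0 and 1 that is
    continuous even at t = 0; hence f(x,u) times a truncation of u is measurable and
    dominated as soon as f(x,u) u is. *)
Lemma smooth_truncE e k t : 0 < e ->
  smooth_trunc e k t = t * (2 * k / (smooth_abs e (t + k) + smooth_abs e (t - k))).
Proof.
move=> e0; have sp := smooth_abs_gt0 (t + k) e0; have sm := smooth_abs_gt0 (t - k) e0.
have h : (smooth_abs e (t + k) - smooth_abs e (t - k)) * (smooth_abs e (t + k) + smooth_abs e (t - k)) =
    4 * t * k by rewrite -subr_sqr !sqr_smooth_abs; ring.
apply: (@mulIf _ (2 * (smooth_abs e (t + k) + smooth_abs e (t - k)))).
  by rewrite gt_eqF// mulr_gt0// addr_gt0.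
transitivity (4 * t * k); [rewrite -h /smooth_trunc|]; field => //.
by rewrite gt_eqF// addr_gt0.
Qed.

Lemma smooth_trunc_factor e k t : 0 < e -> 0 <= k ->
  exists2 r, 0 <= r <= 1 & smooth_trunc e k t = t * r.
Proof.
move=> e0 k0; rewrite smooth_truncE//; eexists; last by [].
have sp := smooth_abs_gt0 (t + k) e0; have sm := smooth_abs_gt0 (t - k) e0.
rewrite divr_ge0 ?mulr_ge0// ?addr_ge0// ?(ltW sp) ?(ltW sm)//=.
rewrite ler_pdivrMr ?addr_gt0// mul1r.
have := le_norm_smooth_abs e (t + k); have := le_norm_smooth_abs e (t - k).
by have := ler_norm (t + k); have := ler_norm (- (t - k)); rewrite normrN; lra.
Qed.

Definition trunc_deriv k t := (Num.sg (t + k) - Num.sg (t - k)) / 2.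

Lemma smooth_sgn_close e t : 0 < e -> `|smooth_sgn e t - Num.sg t| <= e / `|t|.
Proof.
move=> e0; have [->|t0] := eqVneq t 0.
  by rewrite /smooth_sgn mul0r sgr0 subr0 normr0 invr0 mulr0.
have nt : 0 < `|t| by rewrite normr_gt0.
have st := smooth_abs_gt0 t e0.
have -> : smooth_sgn e t - Num.sg t = - (Num.sg t * ((smooth_abs e t - `|t|) / smooth_abs e t)).
  by rewrite /smooth_sgn {1}(numEsg t) /inv_smooth_abs; field; rewrite gt_eqF.
have h1 := le_norm_smooth_abs e t; have h2 := smooth_abs_le_norm t (ltW e0).
rewrite normrN normrM normr_sg t0 mul1r ger0_norm; last first.
  by rewrite divr_ge0 ?subr_ge0// ltW.
rewrite ler_pdivrMr// mulrAC ler_pdivlMr//.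
by apply: ler_pM => //; [rewrite subr_ge0|lra].
Qed.

Lemma cvg_of_dist (u v : nat -> R) (l : R) :
  (forall n, `|u n - l| <= v n) -> v @ \oo --> (0 : R) -> u @ \oo --> l.
Proof.
move=> uv v0; apply/subr_cvg0; apply: norm_cvg0.
apply: (squeeze_cvgr _ (cvg_cst (0 : R)) v0).
by apply: nearW => n /=; rewrite normr_ge0 uv.
Qed.

Lemma smooth_trunc_deriv_cvg k t :
  smooth_trunc_deriv n.+1%:R^-1 k t @[n --> \oo] --> trunc_deriv k t.
Proof.
have cv s : smooth_sgn n.+1%:R^-1 s @[n --> \oo] --> Num.sg s.
  apply: (@cvg_of_dist _ (fun n => n.+1%:R^-1 / `|s|)).
    by move=> n; rewrite smooth_sgn_close.
  by rewrite -(mul0r `|s|^-1); apply: cvgM; [exact: cvg_harmonic|exact: cvg_cst].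
by apply: cvgM; [apply: cvgB; exact: cv|exact: cvg_cst].
Qed.

Lemma smooth_trunc_cvg k t : smooth_trunc n.+1%:R^-1 k t @[n --> \oo] --> trunc k t.
Proof.
by apply: cvg_of_dist cvg_harmonic => n; rewrite smooth_trunc_close.
Qed.

Lemma truncE k t : 0 <= k ->
  trunc k t = if `|t| <= k then t else Num.sg t * k.
Proof.
move=> k0; rewrite /trunc; case: ifPn => [|].
  rewrite ler_norml => /andP[h1 h2].
  by rewrite ger0_norm ?ler0_norm; lra.
rewrite -ltNge ltr_normr => /orP[h|h].
  by rewrite gtr0_sg ?ger0_norm ?ger0_norm; lra.
by rewrite ltr0_sg ?ler0_norm ?ler0_norm; lra.
Qed.

Lemma trunc_deriv01 k t : 0 <= k -> 0 <= trunc_deriv k t <= 1.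
Proof.
move=> k0; have sg01 (x : R) : -1 <= Num.sg x <= 1.
  by case: sgrP => _; apply/andP; split; lra.
have /andP[? ?] := sg01 (t + k); have /andP[? ?] := sg01 (t - k).
have : Num.sg (t - k) <= Num.sg (t + k).
  have : t - k <= t + k by lra.
  by case: (sgrP (t - k)) => ?; case: (sgrP (t + k)) => ? ?; lra.
by move=> ?; apply/andP; split; rewrite /trunc_deriv; lra.
Qed.

(** The truncations at the heights h and k only differ in slope on the strip
    between k and h. *)
Lemma norm_trunc_derivB k h t : 0 <= k -> k <= h ->
  `|trunc_deriv h t - trunc_deriv k t| <= (k <= `|t| <= h)%R%:R.
Proof.
move=> k0 kh; have h0 := le_trans k0 kh.
have [kt|kt] /= := leP k `|t|; last first.
  have := kt; rewrite ltr_norml => /andP[? ?].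
  rewrite /trunc_deriv (gtr0_sg (x := t + h)) ?(ltr0_sg (x := t - h)); try lra.
  rewrite (gtr0_sg (x := t + k)) ?(ltr0_sg (x := t - k)); try lra.
  by rewrite subrr normr0.
have [ht|ht] /= := leP `|t| h.
  have /andP[? ?] := trunc_deriv01 t k0; have /andP[? ?] := trunc_deriv01 t h0.
  by rewrite ler_norml; apply/andP; split; lra.
move: ht; rewrite ltr_normr => /orP[ht|ht]; rewrite /trunc_deriv.
  by rewrite !gtr0_sg; try lra; rewrite !subrr ?mul0r normr0.
by rewrite !ltr0_sg; try lra; rewrite !subrr ?mul0r normr0.
Qed.

End smoothed_truncation.

Lemma continuous_lipschitz (R : realType) (f : R -> R) (L : R) : 0 <= L ->
  (forall s t, `|f s - f t| <= L * `|s - t|) -> continuous f.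
Proof.
move=> L0 fL t; apply/cvgrPdist_le => e e0.
have L10 : 0 < L + 1 by rewrite ltr_wpDl.
have d0 : 0 < e / (L + 1) by rewrite divr_gt0.
have : \forall s \near t, `|t - s| < e / (L + 1).
  exact: (nbhsx_ballx t _ d0).
apply: (@filterS _ _ (nbhs_filter t)) => s ts; rewrite (le_trans (fL _ _))//.
rewrite (@le_trans _ _ ((L + 1) * `|t - s|)) ?ler_wpM2r ?lerDl//.
by rewrite mulrC -ler_pdivlMr// ltW.
Qed.

Section smooth_truncation_composition.
Variables (R : realType) (N : nat).
Implicit Types (w : 'rV[R]_N -> R).

(** Differentiating 1/sqrt(w^2 + e^2) yields -w d_i w / sqrt(w^2 + e^2)^3, so
    the class is closed under composition by induction on n. *)
Lemma class_C_comp_inv_smooth_abs e n w : 0 < e -> class_C n w -> class_C n (inv_smooth_abs e \o w).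
Proof.
move=> e0.
have cont : continuous w -> continuous (inv_smooth_abs e \o w).
  move=> cw x; apply: continuous_comp; first exact: cw.
  apply/differentiable_continuous; apply/derivable1_diffP.
  by have [] := is_derive_inv_smooth_abs (w x) e0.
elim: n => [|n IHn] kw.
  by have [cw _] := kw; split => //; exact: cont.
have [cw [dw pw]] := kw; split; first exact: cont.
split=> [i x|i].
  by have [] := is_derive_comp_line (is_derive_inv_smooth_abs (w x) e0) (dw i x).
have wn := class_CS kw.
have r1 := IHn wn; have r3 := class_CM r1 (class_CM r1 r1).
have := class_CM (class_CM (class_C_cst N n (-1)) (class_CM wn r3)) (pw i).
rewrite [X in class_C n X -> _](_ : _ = partial i (inv_smooth_abs e \o w))//.
apply/funext => x; rewrite /partial.
have [_ ->] := is_derive_comp_line (is_derive_inv_smooth_abs (w x) e0) (dw i x).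
by rewrite /partial /=; ring.
Qed.

Lemma smooth_comp_trunc_deriv e k w : 0 < e -> smooth w -> smooth (smooth_trunc_deriv e k \o w).
Proof.
move=> e0 /smoothP sw; apply/smoothP => n.
have ks c : class_C n (smooth_sgn e \o (fun x => w x + c)).
  have wc : class_C n (fun x => w x + c) by apply: class_CD => //; exact: class_C_cst.
  exact: (class_CM wc (class_C_comp_inv_smooth_abs e0 wc)).
have := class_CM (class_CD (ks k) (class_CM (class_C_cst N n (-1)) (ks (- k)))) (class_C_cst N n 2^-1).
rewrite [X in class_C n X -> _](_ : _ = smooth_trunc_deriv e k \o w)//.
by apply/funext => x; rewrite /smooth_trunc_deriv /= /cst mulN1r.
Qed.

Lemma smoothB w1 w2 : smooth w1 -> smooth w2 -> smooth (fun x => w1 x - w2 x).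
Proof.
move=> /smoothP s1 /smoothP s2; apply/smoothP => n.
have := class_CD (s1 n) (class_CM (class_C_cst N n (-1)) (s2 n)).
rewrite [X in class_C n X -> _](_ : _ = fun x => w1 x - w2 x)//.
by apply/funext => x /=; rewrite mulN1r.
Qed.

(** Smoothness of F o w is only asked of the derivative f: the partial
    derivatives of F o w are products of f o w and partial derivatives of w. *)
Lemma smooth_comp (F f : R -> R) w :
  (forall t : R, is_derive t (1 : R) F (f t)) -> smooth w -> smooth (f \o w) ->
  smooth (F \o w) /\
  (forall i x, partial i (F \o w) x = f (w x) * partial i w x).
Proof.
move=> dF /smoothP sw /smoothP sf.
have [cw [dw pw]] := sw 1%N.
have d i x := is_derive_comp_line (dF (w x)) (dw i x).
have pE i x : partial i (F \o w) x = f (w x) * partial i w x.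
  by have [_ <-] := d i x.
split => //; apply/smoothP => n; apply: class_CS; split; last split=> [i x|i].
- move=> x; apply: continuous_comp; first exact: cw.
  apply/differentiable_continuous; apply/derivable1_diffP.
  by have [] := dF (w x).
- by have [] := d i x.
- rewrite (_ : partial i _ = fun x => f (w x) * partial i w x).
    by apply: class_CM; [exact: sf|have [_ [_]] := sw n.+1; exact].
  by apply/funext => x; exact: pE.
Qed.

End smooth_truncation_composition.

(** * From test functions to the Sobolev space *)

Section lebesgue_rV_integrals.
Variables (R : realType) (N : nat).
Local Notation leb := (@lebesgue_rV R N).
Local Notation E := (euclidean R N).

Lemma measurable_fun_borel_rV (F : 'rV[R]_N -> \bar R) :
  measurable_fun [set: borel_rV R N] F -> measurable_fun [set: E] F.
Proof.
move=> mF _ Y mY; apply: measurable_borel_rV; exact: mF.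
Qed.

Lemma integral_lebesgue_rV_borel (F : 'rV[R]_N -> \bar R) :
  measurable_fun [set: borel_rV R N] F -> (forall x, 0 <= F x)%E ->
  (\int[leb]_x F x = \int[borel_lebesgue R N]_x F x)%E.
Proof.
move=> mF F0.
pose idb : E -> borel_rV R N := fun x => x.
have mid : measurable_fun setT idb.
  by move=> _ Y mY; rewrite setTI; exact: measurable_borel_rV.
rewrite [RHS](_ : _ = \int[pushforward leb idb]_x F x)%E.
  by rewrite ge0_integral_pushforward// preimage_setT.
by apply: eq_measure_integral => A mA _; apply/esym; exact: borel_lebesgueE.
Qed.

Lemma integral_lebesgue_rV_borel_on (B : set (borel_rV R N))
    (F : 'rV[R]_N -> \bar R) :
  measurable B -> measurable_fun [set: borel_rV R N] F ->
  (forall x, 0 <= F x)%E ->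
  (\int[leb]_(x in B) F x = \int[borel_lebesgue R N]_(x in B) F x)%E.
Proof.
move=> mB mF F0; rewrite [LHS]integral_mkcond [RHS]integral_mkcond.
apply: integral_lebesgue_rV_borel.
- by apply/(measurable_restrictT _ mB); exact: measurable_funTS.
- by move=> x; apply: erestrict_ge0 => y _; exact: F0.
Qed.

(** A Lebesgue measurable set is covered by a Borel set of almost the same
    measure, to which the Borel version applies. *)
Lemma small_set_poincare (A : set E) (w : 'rV[R]_N -> R) (b : R) :
  0 < b -> C1_bounded_support w -> measurable A ->
  (leb A < (b ^+ N)%:E)%E ->
  (\int[leb]_(x in A) (`|w x|)%:E <=
   b%:E * \sum_(i < N) \int[leb]_x (`|partial i w x|)%:E)%E.
Proof.
move=> b0 Cw mA /ereal_inf_lt[_ [F [mF AF] <-] Fb].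
have mabs (u : 'rV[R]_N -> R) : continuous u ->
    measurable_fun [set: borel_rV R N] (fun x => (`|u x|)%:E).
  move=> cu; apply/measurable_EFinP; apply: measurableT_comp => //.
  exact: continuous_borel.
have [cw dw cdw _] := Cw.
pose B : set (borel_rV R N) := \bigcup_k F k.
have mB : measurable B by exact: bigcupT_measurable.
have Bb : (borel_lebesgue R N B < (b ^+ N)%:E)%E.
  apply: le_lt_trans Fb; exact: measure_sigma_subadditive.
have := small_set_poincare_borel b0 Cw mB Bb.
rewrite [X in (_ <= _ * X)%E -> _](_ : _ =
    \sum_(i < N) \int[leb]_x (`|partial i w x|)%:E)%E; last first.
  apply: eq_bigr => i _; rewrite integral_lebesgue_rV_borel//.
  exact: mabs.
apply: le_trans; rewrite -integral_lebesgue_rV_borel_on//; last exact: mabs.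
apply: ge0_subset_integral; [exact: mA|exact: measurable_borel_rV| | |exact: AF].
- by apply: measurable_funTS; apply: measurable_fun_borel_rV; exact: mabs.
- by move=> x _; rewrite lee_fin.
Qed.

End lebesgue_rV_integrals.

Opaque lebesgue_rV borel_lebesgue lebesgue_step.

Section integral_tools.
Context {d} {T : measurableType d} {R : realType}.
Variable mu : {measure set T -> \bar R}.
Implicit Types (A : set T) (s : T -> R).

(** A form of Young's inequality, and the substitute for Hoelder's inequality
    throughout: optimising over l after integration gives the Hoelder bound
    of int_A s in terms of |A| and int_A s^p. *)
Lemma le_split_powR (p l t : R) : 1 <= p -> 0 < l -> 0 <= t ->
  t <= l + l `^ (1 - p) * t `^ p.
Proof.
move=> p1 l0 t0; have [tl|lt] := leP t l.
  by rewrite (le_trans tl)// lerDl mulr_ge0// powR_ge0.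
have t00 : 0 < t by exact: lt_trans lt.
rewrite (le_trans _ (_ : l `^ (1 - p) * t `^ p <= _)) ?lerDr ?(ltW l0)//.
rewrite -{1}(powRr1 t0) -{1}(subrK p 1) powRD; last first.
  by rewrite (gt_eqF t00) implybT.
rewrite ler_wpM2r ?powR_ge0//.
rewrite -(opprB p 1) !powRN lef_pV2 ?posrE ?powR_gt0//.
by rewrite ge0_ler_powR ?nnegrE ?subr_ge0// ltW.
Qed.

Lemma integral_le_split A s (p l : R) : measurable A ->
  measurable_fun A s -> (forall x, A x -> 0 <= s x) -> 1 <= p -> 0 < l ->
  (\int[mu]_(x in A) (s x)%:E <=
   l%:E * mu A + (l `^ (1 - p))%:E * \int[mu]_(x in A) (s x `^ p)%:E)%E.
Proof.
move=> mA ms s0 p1 l0.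
have msp : measurable_fun A (fun x => (s x `^ p)%:E).
  apply/measurable_EFinP.
  by apply: (@measurableT_comp _ _ _ _ _ _ (@powR R ^~ p)); [exact: measurable_powR|].
rewrite -integral_cst// -ge0_integralZl//; last 2 first.
- by move=> x _; rewrite lee_fin powR_ge0.
- by rewrite lee_fin powR_ge0.
rewrite -ge0_integralD//; last 3 first.
- by move=> x _; rewrite lee_fin ltW.
- by move=> x _; rewrite mule_ge0// lee_fin powR_ge0.
- exact: measurable_funeM.
apply: ge0_le_integral => //.
- exact/measurable_EFinP.
- apply: emeasurable_funD => //; exact: measurable_funeM.
- move=> x Ax; rewrite -EFinM -EFinD lee_fin.
  by apply: le_split_powR => //; exact: s0.
Qed.

Lemma cvge0P (u : nat -> \bar R) : (forall n, 0 <= u n)%E ->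
  u @ \oo --> 0%E <-> forall e : R, 0 < e -> \forall n \near \oo, (u n <= e%:E)%E.
Proof.
move=> u0; split=> [cu e e0|h].
  have [fu /cvgr0_norm_le cfu] := (fine_cvgP _ _).1 cu.
  near=> n.
  have fn : u n \is a fin_num by near: n; exact: fu.
  rewrite -(fineK fn) lee_fin (le_trans (ler_norm _))//.
  by near: n; exact: cfu.
apply/fine_cvgP; split.
  by apply: filterS (h 1 ltr01) => n un1; rewrite ge0_fin_numE// (le_lt_trans un1)// ltry.
apply/cvgr0Pnorm_le => e e0; near=> n.
have ue : (u n <= e%:E)%E by near: n; exact: h.
have fn : u n \is a fin_num by rewrite ge0_fin_numE// (le_lt_trans ue)// ltry.
by rewrite /= ger0_norm ?fine_ge0// -lee_fin fineK.
Unshelve. all: by end_near. Qed.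

(** The inequality for w with an explicit error when it is transferred to v, in
    terms of bounds for w - v and for the difference r of the gradients in L^1. *)
Lemma small_set_poincare_limit (I : finType) A O (v w r : T -> R) (Dv Dw : I -> T -> R)
    (b dlt : R) :
  measurable A -> measurable O -> A `<=` O -> 0 <= b -> 0 <= dlt ->
  measurable_fun O v -> measurable_fun O w -> measurable_fun O r ->
  (forall i, measurable_fun O (Dv i)) -> (forall i, measurable_fun O (Dw i)) ->
  (\int[mu]_(x in A) (`|w x|)%:E <=
    b%:E * \sum_i \int[mu]_(x in O) (`|Dw i x|)%:E)%E ->
  (\int[mu]_(x in O) (`|w x - v x|)%:E <= dlt%:E)%E ->
  (forall x, 0 <= r x) ->
  (forall i x, O x -> `|Dw i x - Dv i x| <= r x) ->
  (\int[mu]_(x in O) (r x)%:E <= dlt%:E)%E ->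
  (\int[mu]_(x in A) (`|v x|)%:E <=
    b%:E * \sum_i \int[mu]_(x in O) (`|Dv i x|)%:E + ((1 + b * #|I|%:R) * dlt)%:E)%E.
Proof.
move=> mA mO AO b0 d0 mv mw mr mDv mDw Hw wv r0 Dr rd.
have mabs (B : set T) (g : T -> R) : measurable_fun B g ->
    measurable_fun B (fun x => (`|g x|)%:E).
  by move=> mg; apply/measurable_EFinP; exact: measurableT_comp.
have mA' (g : T -> R) : measurable_fun O g -> measurable_fun A g.
  by move=> mg; exact: measurable_funS AO mg.
have mwv : measurable_fun O (fun x => w x - v x) by exact: measurable_funB.
have h1 : (\int[mu]_(x in A) (`|v x|)%:E <= \int[mu]_(x in A) (`|w x|)%:E +
    \int[mu]_(x in O) (`|w x - v x|)%:E)%E.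
  apply: (@le_trans _ _ (\int[mu]_(x in A) (`|w x|)%:E +
      \int[mu]_(x in A) (`|w x - v x|)%:E)%E); last first.
    by apply: leeD => //; apply: ge0_subset_integral => //; exact: mabs.
  rewrite -ge0_integralD//; [|exact/mabs/mA'|exact/mabs/mA'].
  apply: ge0_le_integral => //; first exact/mabs/mA'.
    by apply: emeasurable_funD; exact/mabs/mA'.
  move=> x Ax; rewrite -EFinD lee_fin -{1}(subKr (w x) (v x)).
  exact: ler_normB.
have h2 i : (\int[mu]_(x in O) (`|Dw i x|)%:E <=
    \int[mu]_(x in O) (`|Dv i x|)%:E + dlt%:E)%E.
  apply: (@le_trans _ _ (\int[mu]_(x in O) (`|Dv i x|)%:E +
    \int[mu]_(x in O) (r x)%:E)%E); last exact: leeD.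
  rewrite -ge0_integralD//; last 3 first.
  - exact: mabs.
  - by move=> x _; rewrite lee_fin.
  - exact/measurable_EFinP.
  apply: ge0_le_integral => //; first exact: mabs.
    by apply: emeasurable_funD; [exact: mabs|exact/measurable_EFinP].
  move=> x Ox; rewrite -EFinD lee_fin -{1}(subrK (Dv i x) (Dw i x)) addrC.
  by rewrite (le_trans (ler_normD _ _))// lerD2l Dr.
apply: (le_trans h1); apply: (le_trans (leeD Hw wv)).
have -> : (1 + b * #|I|%:R) * dlt = b * (#|I|%:R * dlt) + dlt by ring.
rewrite EFinD addeA leeD2r// EFinM -ge0_muleDr.
- rewrite lee_wpmul2l ?lee_fin//.
  apply: (@le_trans _ _ (\sum_i
     (\int[mu]_(x in O) (`|Dv i x|)%:E + dlt%:E))%E); first exact: lee_sum.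
  by rewrite big_split /= leeD2l// sumEFin sumr_const mulr_natl.
- by apply: sume_ge0 => i _; exact: integral_ge0.
- by rewrite lee_fin mulr_ge0.
Qed.

End integral_tools.

Section W01p_basics.
Variables (R : realType) (N : nat).
Local Notation leb := (@lebesgue_rV R N).
Local Notation E := (euclidean R N).
Variables (Omega : set 'rV[R]_N) (p : R).
Hypotheses (p1 : 1 <= p) (oO : open Omega).
Hypothesis fO : (leb Omega < +oo)%E.

Let p0 : 0 < p. Proof. exact: lt_le_trans p1. Qed.

Let mO : measurable (Omega : set E).
Proof. exact: open_measurable_rV. Qed.

Lemma le_poweR2 (x y : \bar R) (r : R) :
  0 <= r -> (0 <= x)%E -> (x <= y)%E -> (x `^ r <= y `^ r)%E.
Proof.
move=> r0 x0 xy; apply: gt0_ler_poweR => //; rewrite in_itv /= ?leey ?andbT//.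
exact: le_trans xy.
Qed.

Lemma LnormOn_powR (w : 'rV[R]_N -> R) :
  (LnormOn Omega p%:E w `^ p = \int[leb]_(x in Omega) (`|w x| `^ p)%:E)%E.
Proof.
rewrite [RHS]integral_mkcond /LnormOn powR_Lnorm; last by rewrite gt_eqF.
apply: eq_integral => x _; rewrite /= !patchE; case: ifPn => // _.
by change ((`|0 : R| `^ p)%:E = 0%E); rewrite normr0 powR0 ?gt_eqF.
Qed.

Lemma LnormOn_cvg0 (w : nat -> 'rV[R]_N -> R) :
  LnormOn Omega p%:E (w k) @[k --> \oo] --> 0%E <->
  (\int[leb]_(x in Omega) (`|w k x| `^ p)%:E @[k --> \oo] --> 0)%E.
Proof.
have I0 k : (0 <= \int[leb]_(x in Omega) (`|w k x| `^ p)%:E)%E.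
  by apply: integral_ge0 => x _; rewrite lee_fin powR_ge0.
have L0 k : (0 <= LnormOn Omega p%:E (w k))%E by exact: Lnorm_ge0.
have pV0 : 0 <= p^-1 by rewrite invr_ge0 ltW.
split=> h; [apply/(cvge0P I0)|apply/(cvge0P L0)] => e e0.
  have /((cvge0P L0).1 h) : 0 < e `^ p^-1 by rewrite powR_gt0.
  apply: filterS => k Lk; rewrite -LnormOn_powR.
  have := le_poweR2 (ltW p0) (Lnorm_ge0 _ _ _) Lk.
  by rewrite poweR_EFin -powRrM mulVf ?gt_eqF// powRr1// ltW.
have /((cvge0P I0).1 h) : 0 < e `^ p by rewrite powR_gt0.
apply: filterS => k; rewrite -LnormOn_powR => Ik.
have := le_poweR2 pV0 (poweR_ge0 _ _) Ik.
rewrite -poweRrM divff ?gt_eqF// poweRe1//.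
by rewrite poweR_EFin -powRrM divff ?gt_eqF// powRr1// ltW.
Qed.

(** Apply [integral_le_split] with l small, |Omega| being finite. *)
Lemma cvg_L1_of_Lp (w : nat -> 'rV[R]_N -> R) :
  (forall k, measurable_fun (Omega : set E) (w k)) ->
  (forall k x, 0 <= w k x) ->
  (\int[leb]_(x in Omega) (w k x `^ p)%:E @[k --> \oo] --> 0)%E ->
  (\int[leb]_(x in Omega) (w k x)%:E @[k --> \oo] --> 0)%E.
Proof.
move=> mw w0 h.
have Ip0 k : (0 <= \int[leb]_(x in Omega) (w k x `^ p)%:E)%E.
  by apply: integral_ge0 => x _; rewrite lee_fin powR_ge0.
apply/cvge0P => [k|e e0].
  by apply: integral_ge0 => x _; rewrite lee_fin.
pose V := fine (leb Omega).
have VE : leb Omega = V%:E by rewrite fineK// ge0_fin_numE.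
have V0 : 0 <= V by rewrite fine_ge0.
pose l := e / 2 / (V + 1).
have l0 : 0 < l by rewrite !divr_gt0// ltr_wpDl.
pose d := e / 2 / (l `^ (1 - p)).
have d0 : 0 < d by rewrite !divr_gt0// powR_gt0.
have := (cvge0P Ip0).1 h d d0; apply: filterS => k Ik.
apply: (le_trans (integral_le_split leb mO (mw k) (fun x _ => w0 k x) p1 l0)).
apply: (@le_trans _ _ ((e / 2)%:E + (e / 2)%:E)%E).
  apply: leeD.
    apply: (@le_trans _ _ (l%:E * V%:E)%E); first by rewrite -VE.
    rewrite -EFinM lee_fin /l mulrAC ler_pdivrMr ?ltr_wpDl//.
    by rewrite ler_wpM2l ?lerDl// divr_ge0// ltW.
  apply: (@le_trans _ _ ((l `^ (1 - p))%:E * d%:E)%E).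
    by rewrite lee_wpmul2l// lee_fin powR_ge0.
  by rewrite -EFinM lee_fin /d mulrCA divff ?mulr1// gt_eqF// powR_gt0.
by rewrite -EFinD lee_fin -splitr.
Qed.

Lemma C1_bounded_support_of_Cc_infty (w : 'rV[R]_N -> R) : Cc_infty Omega w -> C1_bounded_support w.
Proof.
move=> [sw /compact_bounded [M [_ bM]] _]; split.
- exact: (sw [::]).1.
- exact: (sw [::]).2.
- by move=> i; exact: (sw [:: i]).1.
- exists (M + 1) => x i Mx; apply/eqP/negPn/negP => wx.
  have /bM /(_ x) : M < M + 1 by rewrite ltrDl.
  have : Defs.support w x by apply: subset_closure; exact: wx.
  move=> sx /(_ sx); apply/negP; rewrite -ltNge (lt_le_trans Mx)//.
  by rewrite /Num.norm /= mx_normrE (le_bigmax_cond _ (fun z => `|x z.1 z.2|) (j := (ord0, i))).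
Qed.

Lemma partial_eq0 (w : 'rV[R]_N -> R) i x : Cc_infty Omega w ->
  ~ Omega x -> partial i w x = 0.
Proof.
move=> [sw _ sO] Ox.
rewrite /partial -(derive_cst (0 : R) x (delta_mx ord0 i)).
apply: near_eq_derive.
have : nbhs x (~` Defs.support w).
  apply: open_nbhs_nbhs; split; last by move=> /sO.
  by apply: closed_openC; exact: closed_closure.
apply: filterS => y sy; apply/eqP/negPn/negP => wy.
by apply: sy; apply: subset_closure; exact: wy.
Qed.

Lemma enorm_ge0 (z : 'rV[R]_N) : 0 <= enorm z.
Proof. exact: sqrtr_ge0. Qed.

Lemma sqr_enorm (z : 'rV[R]_N) : enorm z ^+ 2 = \sum_(i < N) z ord0 i ^+ 2.
Proof. by rewrite sqr_sqrtr// sumr_ge0// => i _; exact: sqr_ge0. Qed.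

Lemma norm_coord_le_enorm (z : 'rV[R]_N) i : `|z ord0 i| <= enorm z.
Proof.
rewrite -sqrtr_sqr ler_wsqrtr// (bigD1 i)//= lerDl sumr_ge0// => j _.
exact: sqr_ge0.
Qed.

Lemma enormZ (a : R) (z : 'rV[R]_N) : enorm (a *: z) = `|a| * enorm z.
Proof.
rewrite /enorm -sqrtr_sqr -sqrtrM ?sqr_ge0// mulr_sumr.
by congr Num.sqrt; apply: eq_bigr => i _; rewrite mxE exprMn.
Qed.

(** A quasi-triangle inequality, from (a + b)^2 <= 2 (a^2 + b^2) in every
    coordinate. *)
Lemma enormD (y z : 'rV[R]_N) : enorm (y + z) <= 2 * (enorm y + enorm z).
Proof.
have [y0 z0] := (enorm_ge0 y, enorm_ge0 z).
rewrite -(@ler_pXn2r _ 2)// ?nnegrE ?enorm_ge0 ?mulr_ge0 ?addr_ge0//.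
apply: (@le_trans _ _ (2 * (enorm y ^+ 2 + enorm z ^+ 2))); last by nra.
rewrite !sqr_enorm mulrDr !mulr_sumr -big_split /=.
apply: ler_sum => i _; rewrite mxE.
by have := sqr_ge0 (y ord0 i - z ord0 i); nra.
Qed.

Lemma measurable_enorm (A : set E) (g : E -> 'rV[R]_N) :
  (forall i, measurable_fun A (fun x => g x ord0 i)) ->
  measurable_fun A (fun x => enorm (g x)).
Proof.
move=> mg.
apply: (@measurableT_comp _ _ _ _ _ _ (@Num.sqrt R) _
  (fun x => \sum_(i < N) g x ord0 i ^+ 2)).
  by apply: continuous_measurable_fun; exact: sqrt_continuous.
by apply: measurable_sum => i; exact: measurable_funX.
Qed.

Lemma gradientE (w : 'rV[R]_N -> R) x i : gradient w x ord0 i = partial i w x.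
Proof. by rewrite mxE. Qed.

Lemma measurable_continuous_rV (w : 'rV[R]_N -> R) :
  continuous w -> measurable_fun [set: E] w.
Proof.
move=> cw _ Y mY; apply: measurable_borel_rV; exact: continuous_borel.
Qed.

Lemma measurable_gradient (w : 'rV[R]_N -> R) i : smooth w ->
  measurable_fun [set: E] (fun x => gradient w x ord0 i).
Proof.
move=> sw; rewrite (_ : (fun _ => _) = partial i w).
  by apply: measurable_continuous_rV; exact: (sw [:: i]).1.
by apply/funext => x; exact: gradientE.
Qed.

Lemma W01p_approx (v : W01p Omega p) : exists phi : nat -> 'rV[R]_N -> R,
  [/\ forall k, Cc_infty Omega (phi k),
      (\int[leb]_(x in Omega) (`|phi k x - v x| `^ p)%:E @[k --> \oo] --> 0)%E &
      (\int[leb]_(x in Omega) (enorm (gradient (phi k) x - Wgrad v x) `^ p)%:E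
        @[k --> \oo] --> 0)%E].
Proof.
have [phi [h1 /LnormOn_cvg0 h2 /LnormOn_cvg0 h3]] := W_closure v.
exists phi; split; [exact: h1|exact: h2|].
have E1 : (fun k => \int[leb]_(x in Omega)
    (`|enorm (gradient (phi k) x - Wgrad v x)| `^ p)%:E)%E =
  (fun k => \int[leb]_(x in Omega)
    (enorm (gradient (phi k) x - Wgrad v x) `^ p)%:E)%E.
  apply/funext => k; apply: eq_integral => x _.
  by rewrite ger0_norm// enorm_ge0.
by rewrite -E1; exact: h3.
Qed.

Lemma small_set_poincare_W01p (v : W01p Omega p) (A : set E) (b : R) :
  0 < b -> measurable A -> A `<=` Omega -> (leb A < (b ^+ N)%:E)%E ->
  (\int[leb]_(x in A) (`|v x|)%:E <=
   b%:E * \sum_(i < N) \int[leb]_(x in Omega) (`|Wgrad v x ord0 i|)%:E)%E.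
Proof.
move=> b0 mA AO Ab; have [phi [Cphi cphi cgrad]] := W01p_approx v.
have smphi k : smooth (phi k) by case: (Cphi k).
have mphi k : measurable_fun [set: E] (phi k).
  by apply: measurable_continuous_rV; exact: (smphi k [::]).1.
have mdiff k : measurable_fun (Omega : set E) (fun x => phi k x - v x).
  by apply: measurable_funB; [exact: measurable_funTS|exact: Wfun_measurable].
have mgdiff k : measurable_fun (Omega : set E)
    (fun x => enorm (gradient (phi k) x - Wgrad v x)).
  apply: measurable_enorm => i.
  rewrite (_ : (fun _ => _) = fun x =>
      gradient (phi k) x ord0 i - Wgrad v x ord0 i).
    apply: measurable_funB; last exact: Wgrad_measurable.
    by apply: measurable_funTS; exact: measurable_gradient.
  by apply/funext => x; rewrite !mxE.
have I1 : (\int[leb]_(x in Omega) (`|phi k x - v x|)%:E @[k --> \oo] --> 0)%E.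
  apply: (@cvg_L1_of_Lp (fun k x => `|phi k x - v x|)) cphi => [k|k x].
    by apply: measurableT_comp => //; exact: mdiff.
  exact: normr_ge0.
have I2 : (\int[leb]_(x in Omega)
    (enorm (gradient (phi k) x - Wgrad v x))%:E @[k --> \oo] --> 0)%E.
  apply: (@cvg_L1_of_Lp (fun k x => enorm (gradient (phi k) x - Wgrad v x)))
    cgrad => [k|k x]; [exact: mgdiff|exact: enorm_ge0].
apply/lee_addgt0Pr => e e0.
pose dlt := e / (1 + b * N%:R).
have bN0 : 0 < 1 + b * N%:R by rewrite ltr_wpDr// mulr_ge0// ltW.
have d0 : 0 < dlt by rewrite divr_gt0.
have dE : (1 + b * N%:R) * dlt = e by rewrite /dlt mulrC divfK// gt_eqF.
have [k [I1k I2k]] : exists k,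
    (\int[leb]_(x in Omega) (`|phi k x - v x|)%:E <= dlt%:E)%E /\
    (\int[leb]_(x in Omega)
      (enorm (gradient (phi k) x - Wgrad v x))%:E <= dlt%:E)%E.
  near \oo => k; exists k; split; near: k.
    move: I1 => /cvge0P; apply => // k; apply: integral_ge0 => x _.
    by rewrite lee_fin.
  move: I2 => /cvge0P; apply => // k; apply: integral_ge0 => x _.
  by rewrite lee_fin enorm_ge0.
have mPphi j i : measurable_fun (Omega : set E) (partial i (phi j)).
  apply: measurable_funTS; apply: measurable_continuous_rV.
  exact: (smphi j [:: i]).1.
have Hphi j : (\int[leb]_(x in A) (`|phi j x|)%:E <= b%:E *
    \sum_(i < N) \int[leb]_(x in Omega) (`|partial i (phi j) x|)%:E)%E.
  have := small_set_poincare b0 (C1_bounded_support_of_Cc_infty (Cphi j)) mA Ab.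
  rewrite [X in (_ <= _ * X)%E -> _](_ : _ = \sum_(i < N)
    \int[leb]_(x in Omega) (`|partial i (phi j) x|)%:E)%E; first exact.
  apply: eq_bigr => i _; rewrite [RHS]integral_mkcond.
  apply: eq_integral => x _; rewrite patchE; case: ifPn => [//|/negP xO].
  rewrite (partial_eq0 _ (Cphi j)) ?normr0; first by [].
  by move=> Ox; apply: xO; rewrite inE.
have := @small_set_poincare_limit _ E R leb _ A Omega v (phi k)
  (fun x => enorm (gradient (phi k) x - Wgrad v x))
  (fun i x => Wgrad v x ord0 i) (fun i => partial i (phi k)) b dlt
  mA mO AO (ltW b0) (ltW d0) (Wfun_measurable v)
  (measurable_funTS (mphi k)) (mgdiff k) (Wgrad_measurable v) (mPphi k)
  (Hphi k) I1k (fun x => enorm_ge0 _).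
rewrite card_ord dE; apply; last exact: I2k.
move=> i x _; have := norm_coord_le_enorm (gradient (phi k) x - Wgrad v x) i.
by rewrite !mxE.
Unshelve. all: by end_near. Qed.

End W01p_basics.

(** * The chain rule in the Sobolev space *)

Section composition_convergence.
Context {d} {T : measurableType d} {R : realType}.
Variable mu : {measure set T -> \bar R}.
Implicit Types (A O : set T) (s t g : T -> R).

Lemma measurable_powR_fun A g (p : R) : measurable_fun A g ->
  measurable_fun A (fun x => (g x `^ p)%:E).
Proof.
move=> mg; apply/measurable_EFinP.
by apply: (@measurableT_comp _ _ _ _ _ _ (@powR R ^~ p)); [exact: measurable_powR|].
Qed.

(** Dominated convergence. *)
Lemma integral_tail O g t : measurable O -> measurable_fun O g ->
  measurable_fun O t -> (forall x, O x -> 0 <= g x) ->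
  (\int[mu]_(x in O) (g x)%:E < +oo)%E ->
  (\int[mu]_(x in O `&` [set x | (n%:R < t x)%R]) (g x)%:E @[n --> \oo] --> 0)%E.
Proof.
move=> mO mg mt g0 ig.
have mS n : measurable (O `&` [set x | (n%:R < t x)%R]).
  by have := mt mO `]n%:R, +oo[%classic (measurable_itv _);
    rewrite (_ : O `&` _ = O `&` [set x | (n%:R < t x)%R])//;
    apply/seteqP; split=> x /= [Ox]; rewrite in_itv /= andbT.
pose f n := (fun x => (g x)%:E) \_ (O `&` [set x | (n%:R < t x)%R]).
have E1 n : (\int[mu]_(x in O `&` [set x | (n%:R < t x)%R]) (g x)%:E =
    \int[mu]_(x in O) f n x)%E.
  rewrite [LHS]integral_mkcond [RHS]integral_mkcond; apply: eq_integral => x _.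
  rewrite /f [RHS]patchE; case: ifPn => //; rewrite notin_setE => Ox.
  by rewrite patchE ifN// notin_setE => -[].
have -> : (fun n : nat =>
     \int[mu]_(x in O `&` [set x | (n%:R < t x)%R]) (g x)%:E)%E =
    (fun n : nat => \int[mu]_(x in O) f n x)%E by apply/funext.
have mgE : measurable_fun O (fun x => (g x)%:E) by exact/measurable_EFinP.
have gint : mu.-integrable O (fun x => (g x)%:E).
  apply/integrableP; split=> //; rewrite (eq_integral (fun x => (g x)%:E))//.
  by move=> x; rewrite inE => Ox; rewrite gee0_abs// lee_fin g0.
have mf n : measurable_fun O (f n).
  apply/(measurable_restrict _ (mS n) mO).
  by apply: measurable_funS mgE => //; exact: subIset.
have fcvg : {ae mu, forall x, O x -> f n x @[n --> \oo] --> 0%E}.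
  apply: aeW => x Ox; apply: cvg_near_cst; near=> n.
  rewrite /f patchE ifN// notin_setE => -[_ /=]; apply/negP; rewrite -leNgt.
  by near: n; exact: nbhs_infty_ger.
have fle : {ae mu, forall x n, O x -> (`|f n x| <= (g x)%:E)%E}.
  apply: aeW => x n Ox; rewrite /f patchE; case: ifPn => _.
    by rewrite gee0_abs// lee_fin g0.
  by rewrite abse0 lee_fin g0.
have [_ _] := dominated_convergence mO mf (measurable_cst 0%E) fcvg gint fle.
by rewrite integral0.
Unshelve. all: by end_near. Qed.

Lemma ge0_integral_lin O (g h : T -> R) (a b : R) : measurable O ->
  measurable_fun O g -> measurable_fun O h ->
  (forall x, O x -> 0 <= g x) -> (forall x, O x -> 0 <= h x) ->
  0 <= a -> 0 <= b ->
  (\int[mu]_(x in O) (a * g x + b * h x)%:E =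
   a%:E * \int[mu]_(x in O) (g x)%:E + b%:E * \int[mu]_(x in O) (h x)%:E)%E.
Proof.
move=> mO mg mh g0 h0 a0 b0.
have mge : measurable_fun O (fun x => (g x)%:E) by exact/measurable_EFinP.
have mhe : measurable_fun O (fun x => (h x)%:E) by exact/measurable_EFinP.
rewrite -ge0_integralZl// -ge0_integralZl// -ge0_integralD//.
- by move=> x Ox; rewrite mule_ge0// lee_fin g0.
- exact: measurable_funeM.
- by move=> x Ox; rewrite mule_ge0// lee_fin h0.
- exact: measurable_funeM.
Qed.

Lemma ge0_le_integral_real O (g h : T -> R) : measurable O ->
  measurable_fun O g -> measurable_fun O h ->
  (forall x, O x -> 0 <= g x) -> (forall x, O x -> g x <= h x) ->
  (\int[mu]_(x in O) (g x)%:E <= \int[mu]_(x in O) (h x)%:E)%E.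
Proof.
move=> mO mg mh g0 gh; apply: ge0_le_integral => //.
- exact/measurable_EFinP.
- exact/measurable_EFinP.
Qed.

(** Convergence of f(w_k) Dw_k to f(v) Dv in L^p, with s = |Dv|,
    r_k = |Dw_k - Dv| and q_k the distance between the two products. The
    difficult term |f(w_k) - f(v)| s is split according to the size of s: where
    s <= m it is at most L m |w_k - v|, and on {s > m} it is at most 2 s, whose
    p-th power has small integral there when m is large. Convergence of the
    norms thus suffices, without almost everywhere convergence along a subsequence. *)
Lemma composition_cvg O (p L : R) (w : nat -> T -> R) (v s : T -> R)
    (r q : nat -> T -> R) (f : R -> R) :
  measurable O -> 1 <= p -> 0 <= L ->
  (forall k, measurable_fun O (w k)) -> measurable_fun O v ->
  measurable_fun O s -> (forall k, measurable_fun O (r k)) ->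
  (forall k, measurable_fun O (q k)) ->
  (forall x, 0 <= s x) -> (forall k x, 0 <= r k x) -> (forall k x, 0 <= q k x) ->
  (forall a, `|f a| <= 1) -> (forall a b, `|f a - f b| <= L * `|a - b|) ->
  (forall k x, q k x <= 2 * (r k x + `|f (w k x) - f (v x)| * s x)) ->
  (\int[mu]_(x in O) (s x `^ p)%:E < +oo)%E ->
  (\int[mu]_(x in O) (`|w k x - v x| `^ p)%:E @[k --> \oo] --> 0)%E ->
  (\int[mu]_(x in O) (r k x `^ p)%:E @[k --> \oo] --> 0)%E ->
  (\int[mu]_(x in O) (q k x `^ p)%:E @[k --> \oo] --> 0)%E.
Proof.
move=> mO p1 L0 mw mv ms mr mq s0 r0 q0 f1 fL qle sp wv rc.
have p0 : 0 < p by exact: lt_le_trans p1.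
have powD (a b : R) : 0 <= a -> 0 <= b -> (a + b) `^ p <= 2 `^ p * (a `^ p + b `^ p).
  move=> a0 b0; have [ab|ba] := leP a b.
    apply: (@le_trans _ _ ((2 * b) `^ p)).
      by rewrite ge0_ler_powR ?nnegrE ?addr_ge0 ?mulr_ge0 ?(ltW p0)//; lra.
    by rewrite powRM// ler_wpM2l ?powR_ge0// lerDr powR_ge0.
  apply: (@le_trans _ _ ((2 * a) `^ p)).
    by rewrite ge0_ler_powR ?nnegrE ?addr_ge0 ?mulr_ge0 ?(ltW p0)//; lra.
  by rewrite powRM// ler_wpM2l ?powR_ge0// lerDl powR_ge0.
have [K [K0 KE]] : exists K : R, 0 < K /\ forall a, 2 `^ p * (2 `^ p * a) = K * a.
  by exists (2 `^ p * 2 `^ p); split=> [|a]; rewrite ?mulrA// mulr_gt0// powR_gt0.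
pose S m := O `&` [set x | (m%:R < s x)%R].
have mS m : measurable (S m).
  have := ms mO `]m%:R, +oo[%classic (measurable_itv _).
  rewrite (_ : O `&` _ = S m)//.
  by apply/seteqP; split=> x /= [Ox]; rewrite in_itv /= andbT.
have ptw k m x : O x -> q k x `^ p <=
    K * (r k x `^ p) + K * (L * m%:R) `^ p * `|w k x - v x| `^ p +
    K * 2 `^ p * (\1_(S m) x * s x `^ p).
  move=> Ox.
  set dl := `|f (w k x) - f (v x)|.
  have dl0 : 0 <= dl by exact: normr_ge0.
  have dls0 : 0 <= dl * s x by rewrite mulr_ge0.
  apply: (@le_trans _ _ (K * (r k x `^ p + (dl * s x) `^ p))).
    apply: (@le_trans _ _ ((2 * (r k x + dl * s x)) `^ p)).
      by rewrite ge0_ler_powR ?nnegrE ?mulr_ge0 ?addr_ge0 ?(ltW p0).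
    by rewrite powRM ?addr_ge0// -KE ler_wpM2l ?powR_ge0// powD.
  rewrite mulrDr -addrA lerD2l -!mulrA -mulrDr ler_wpM2l ?(ltW K0)//.
  have [sm|ms'] := leP (s x) m%:R.
    apply: (@le_trans _ _ ((L * m%:R * `|w k x - v x|) `^ p)).
      rewrite ge0_ler_powR ?nnegrE ?mulr_ge0 ?(ltW p0)//.
      rewrite mulrAC ler_pM// ?fL//.
    by rewrite powRM ?mulr_ge0// lerDl !mulr_ge0// powR_ge0.
  have -> : \1_(S m) x = 1 :> R by rewrite indicE mem_set.
  rewrite mul1r (@le_trans _ _ ((2 * s x) `^ p))//.
    rewrite ge0_ler_powR ?nnegrE ?mulr_ge0 ?(ltW p0)// ler_wpM2r//.
    by rewrite (le_trans (ler_normB _ _))// (le_trans (lerD (f1 _) (f1 _))).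
  by rewrite powRM// lerDr mulr_ge0// powR_ge0.
have tail : (\int[mu]_(x in S m) (s x `^ p)%:E @[m --> \oo] --> 0)%E.
  apply: integral_tail => //; last by move=> x _; exact: powR_ge0.
  by apply/measurable_EFinP; exact: measurable_powR_fun.
have Iq0 k : (0 <= \int[mu]_(x in O) (q k x `^ p)%:E)%E.
  by apply: integral_ge0 => x _; rewrite lee_fin powR_ge0.
have mwv k : measurable_fun O (fun x => `|w k x - v x|).
  by apply: measurableT_comp => //; exact: measurable_funB.
have Iq k m : (\int[mu]_(x in O) (q k x `^ p)%:E <=
    K%:E * \int[mu]_(x in O) (r k x `^ p)%:E +
    (K * (L * m%:R) `^ p)%:E * \int[mu]_(x in O) (`|w k x - v x| `^ p)%:E +
    (K * 2 `^ p)%:E * \int[mu]_(x in S m) (s x `^ p)%:E)%E.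
  have mr' : measurable_fun O (fun x => r k x `^ p).
    exact/measurable_EFinP/measurable_powR_fun.
  have mwv' : measurable_fun O (fun x => `|w k x - v x| `^ p).
    exact/measurable_EFinP/measurable_powR_fun.
  have mi : measurable_fun O (fun x => \1_(S m) x * s x `^ p).
    apply: measurable_funM; first exact: measurable_indic.
    exact/measurable_EFinP/measurable_powR_fun.
  have -> : (\int[mu]_(x in S m) (s x `^ p)%:E =
      \int[mu]_(x in O) (\1_(S m) x * s x `^ p)%:E)%E.
    rewrite [LHS]integral_mkcond [RHS]integral_mkcond; apply: eq_integral => x _.
    rewrite !patchE indicE; have [xS|xS] := boolP (x \in S m).
      have [xO _] : S m x by move: xS; rewrite inE.
      by rewrite mem_set// mul1r.
    by rewrite mul0r; case: ifP.
  have K1 : 0 <= K * (L * m%:R) `^ p by rewrite mulr_ge0 ?powR_ge0 ?(ltW K0).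
  have K2 : 0 <= K * 2 `^ p by rewrite mulr_ge0 ?powR_ge0 ?(ltW K0).
  have i0 x : O x -> 0 <= \1_(S m) x * s x `^ p by rewrite mulr_ge0 ?powR_ge0.
  have E1 := ge0_integral_lin mO mr' mwv' (fun x _ => powR_ge0 (r k x) p)
    (fun x _ => powR_ge0 `|w k x - v x| p) (ltW K0) K1.
  have m1 : measurable_fun O
      (fun x => K * r k x `^ p + K * (L * m%:R) `^ p * `|w k x - v x| `^ p).
    by apply: measurable_funD; apply: measurable_funM.
  have i1 x : O x ->
      0 <= K * r k x `^ p + K * (L * m%:R) `^ p * `|w k x - v x| `^ p.
    by move=> _; rewrite addr_ge0 ?mulr_ge0 ?powR_ge0 ?(ltW K0).
  have E2 := ge0_integral_lin mO m1 mi i1 i0 ler01 K2.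
  rewrite -E1 -[X in (X + _)%E]mul1e -E2; apply: ge0_le_integral_real => //.
  - exact/measurable_EFinP/measurable_powR_fun.
  - by apply: measurable_funD; apply: measurable_funM.
  - by move=> x _; exact: powR_ge0.
  - by move=> x Ox; rewrite mul1r; exact: ptw.
apply/(cvge0P Iq0) => e e0.
have e30 : 0 < e / 3 by rewrite divr_gt0.
have IS0 m : (0 <= \int[mu]_(x in S m) (s x `^ p)%:E)%E.
  by apply: integral_ge0 => x _; rewrite lee_fin powR_ge0.
have small C (u : nat -> \bar R) : 0 <= C -> (forall n, 0 <= u n)%E ->
    u @ \oo --> 0%E -> \forall n \near \oo, (C%:E * u n <= (e / 3)%:E)%E.
  move=> C0 u0 cu.
  have d0 : 0 < e / 3 / (C + 1) by rewrite divr_gt0// ltr_wpDl.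
  apply: filterS ((cvge0P u0).1 cu _ d0) => n un.
  apply: (@le_trans _ _ (C%:E * (e / 3 / (C + 1))%:E)%E).
    by rewrite lee_wpmul2l.
  rewrite -EFinM lee_fin mulrA ler_pdivrMr ?ltr_wpDl// mulrC.
  by rewrite ler_wpM2l ?(ltW e30)// lerDl.
have [m Im] := filter_ex (small (K * 2 `^ p) _
  (mulr_ge0 (ltW K0) (powR_ge0 _ _)) IS0 tail).
have Ir0 k : (0 <= \int[mu]_(x in O) (r k x `^ p)%:E)%E.
  by apply: integral_ge0 => x _; rewrite lee_fin powR_ge0.
have Iw0 k : (0 <= \int[mu]_(x in O) (`|w k x - v x| `^ p)%:E)%E.
  by apply: integral_ge0 => x _; rewrite lee_fin powR_ge0.
apply: filterS2 (small K _ (ltW K0) Ir0 rc) (small (K * (L * m%:R) `^ p) _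
  (mulr_ge0 (ltW K0) (powR_ge0 _ _)) Iw0 wv) => k h1 h2.
apply: (le_trans (Iq k m)); apply: (le_trans (leeD (leeD h1 h2) Im)).
by rewrite -!EFinD lee_fin; lra.
Qed.

End composition_convergence.

Section W01p_composition.
Variables (R : realType) (N : nat).
Local Notation leb := (@lebesgue_rV R N).
Local Notation E := (euclidean R N).
Variables (Omega : set 'rV[R]_N) (p : R).
Hypotheses (p1 : 1 <= p) (oO : open Omega).
Hypothesis fO : (leb Omega < +oo)%E.
Let mO : measurable (Omega : set E).
Proof. exact: open_measurable_rV. Qed.

(** If phi_k are test functions approximating v, the functions F(phi_k) are
    test functions approximating F(v). *)
Lemma W01p_comp (v : W01p Omega p) (F f : R -> R) (L : R) :
  F 0 = 0 -> (forall t : R, is_derive t (1 : R) F (f t)) ->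
  (forall t, `|f t| <= 1) -> 0 <= L ->
  (forall s t, `|f s - f t| <= L * `|s - t|) ->
  (forall s t, `|F s - F t| <= 2 * `|s - t|) ->
  (forall w : 'rV[R]_N -> R, smooth w -> smooth (f \o w)) ->
  (\int[leb]_(x in Omega) (enorm (Wgrad v x) `^ p)%:E < +oo)%E ->
  exists w : W01p Omega p, (forall x, w x = F (v x)) /\
    (forall x, Wgrad w x = f (v x) *: Wgrad v x).
Proof.
move=> F0 dF f1 L0 fL FL fs sp.
have [phi [Cphi cphi cgrad]] := W01p_approx p1 v.
have cF : continuous F.
  move=> t; apply/differentiable_continuous; apply/derivable1_diffP.
  by have [] := dF t.
have mF : measurable_fun setT F by exact: continuous_measurable_fun.
have mf : measurable_fun setT f.
  by apply: continuous_measurable_fun; exact: continuous_lipschitz fL.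
have smphi k : smooth (phi k) by case: (Cphi k).
have mphi k : measurable_fun [set: E] (phi k).
  by apply: measurable_continuous_rV; exact: (smphi k [::]).1.
have mv := Wfun_measurable v.
have mFv : measurable_fun (Omega : set E) (F \o v) by exact: measurableT_comp.
have mfv i : measurable_fun (Omega : set E)
    (fun x => (f (v x) *: Wgrad v x) ord0 i).
  rewrite (_ : (fun _ => _) = fun x => f (v x) * Wgrad v x ord0 i).
    apply: measurable_funM; last exact: Wgrad_measurable.
    exact: (measurableT_comp mf mv).
  by apply/funext => x; rewrite mxE.
have Fphi k : smooth (F \o phi k) /\
    (forall i x, partial i (F \o phi k) x = f (phi k x) * partial i (phi k) x).
  by apply: smooth_comp => //; exact: fs.
have gradF k x : gradient (F \o phi k) x = f (phi k x) *: gradient (phi k) x.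
  by apply/rowP => i; rewrite !mxE (Fphi k).2.
have CF k : Cc_infty Omega (F \o phi k).
  have [_ cs sO] := Cphi k.
  have sub : Defs.support (F \o phi k) `<=` Defs.support (phi k).
    apply: closure_subset => x /=; apply: contra_neq => ->; exact: F0.
  split; [exact: (Fphi k).1| |exact: subset_trans sO].
  by apply: (subclosed_compact _ cs sub); exact: closed_closure.
have mwv k : measurable_fun (Omega : set E) (fun x => phi k x - v x).
  by apply: measurable_funB; [exact: measurable_funTS|exact: mv].
have mgrad k i : measurable_fun (Omega : set E) (fun x => gradient (phi k) x ord0 i).
  by apply: measurable_funTS; exact: measurable_gradient.
have mr k : measurable_fun (Omega : set E)
    (fun x => enorm (gradient (phi k) x - Wgrad v x)).
  apply: measurable_enorm => i.
  rewrite (_ : (fun _ => _) = fun x =>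
      gradient (phi k) x ord0 i - Wgrad v x ord0 i).
    by apply: measurable_funB; [exact: mgrad|exact: Wgrad_measurable].
  by apply/funext => x; rewrite !mxE.
pose q k x := enorm (gradient (F \o phi k) x - f (v x) *: Wgrad v x).
have mq k : measurable_fun (Omega : set E) (q k).
  apply: measurable_enorm => i.
  rewrite (_ : (fun _ => _) = fun x => f (phi k x) * gradient (phi k) x ord0 i -
      (f (v x) *: Wgrad v x) ord0 i).
    apply: measurable_funB; last exact: mfv.
    apply: measurable_funM; last exact: mgrad.
    by apply: (measurableT_comp mf); exact: measurable_funTS.
  by apply/funext => x; rewrite gradF !mxE.
have ms : measurable_fun (Omega : set E) (fun x => enorm (Wgrad v x)).
  by apply: measurable_enorm => i; exact: Wgrad_measurable.
have qle k x : q k x <= 2 * (enorm (gradient (phi k) x - Wgrad v x) +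
    `|f (phi k x) - f (v x)| * enorm (Wgrad v x)).
  rewrite /q gradF (_ : _ - _ = f (phi k x) *: (gradient (phi k) x - Wgrad v x) +
      (f (phi k x) - f (v x)) *: Wgrad v x); last first.
    by rewrite scalerBr scalerBl addrA subrK.
  rewrite (le_trans (enormD _ _))// !enormZ ler_wpM2l// lerD2r.
  by rewrite ler_piMl ?enorm_ge0.
have cq : (\int[leb]_(x in Omega) (q k x `^ p)%:E @[k --> \oo] --> 0)%E.
  apply: (@composition_cvg _ E R leb Omega p L phi v
    (fun x => enorm (Wgrad v x))
    (fun k x => enorm (gradient (phi k) x - Wgrad v x)) q f mO p1 L0 _ mv ms mr mq
    (fun x => enorm_ge0 _) (fun k x => enorm_ge0 _) (fun k x => enorm_ge0 _)
    f1 fL qle sp cphi cgrad) => k.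
  exact: measurable_funTS.
have p0 : 0 < p by exact: lt_le_trans p1.
have mwO k : measurable_fun (Omega : set E) (phi k) by exact: measurable_funTS.
have mabs k : measurable_fun (Omega : set E) (fun x => `|phi k x - v x|).
  by apply: measurableT_comp; [exact: normr_measurable|exact: mwv].
have mFd k : measurable_fun (Omega : set E) (fun x => `|F (phi k x) - F (v x)|).
  apply: measurableT_comp; first exact: normr_measurable.
  apply: measurable_funB; last exact: mFv.
  by apply: (measurableT_comp mF); exact: mwO.
have zero_int : (\int[leb]_(x in Omega) ((cst 0 : E -> R) x `^ p)%:E < +oo)%E.
  by under eq_integral do rewrite /cst powR0 ?gt_eqF//; rewrite integral0.
have Fle k x : `|F (phi k x) - F (v x)| <=
    2 * (`|phi k x - v x| + `|(cst 0 : R -> R) (phi k x) - (cst 0 : R -> R) (v x)| * (cst 0 : E -> R) x).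
  by rewrite /cst mulr0 addr0; exact: FL.
have cst_le (a : R) : `|(cst 0 : R -> R) a| <= 1 by rewrite normr0.
have cst_lip (a b : R) : `|(cst 0 : R -> R) a - cst 0 b| <= 0 * `|a - b|.
  by rewrite mul0r subrr normr0.
have zero_ge0 (x : E) : 0 <= (cst 0 : E -> R) x by [].
have r_ge0 k (x : E) : 0 <= `|phi k x - v x| by [].
have q_ge0 k (x : E) : 0 <= `|F (phi k x) - F (v x)| by [].
have cFv : (\int[leb]_(x in Omega) (`|F (phi k x) - F (v x)| `^ p)%:E
    @[k --> \oo] --> 0)%E.
  exact: (@composition_cvg _ E R leb Omega p 0 phi v
    (cst 0) (fun k x => `|phi k x - v x|)
    (fun k x => `|F (phi k x) - F (v x)|) (cst 0) mO p1 (lexx 0) mwO mv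
    (measurable_cst _) mabs mFd zero_ge0 r_ge0 q_ge0 cst_le cst_lip Fle
    zero_int cphi cphi).
have h1 : LnormOn Omega p%:E (fun x => (F \o phi k) x - (F \o v) x)
    @[k --> \oo] --> 0%E.
  exact: ((LnormOn_cvg0 Omega p1
    (fun k x => (F \o phi k) x - (F \o v) x)).2 cFv).
have h2 : LnormOn Omega p%:E
    (fun x => enorm (gradient (F \o phi k) x - f (v x) *: Wgrad v x))
      @[k --> \oo] --> 0%E.
  apply: (LnormOn_cvg0 Omega p1 (fun k x => enorm (gradient (F \o phi k) x -
    f (v x) *: Wgrad v x))).2.
  have E1 : (fun k => \int[leb]_(x in Omega) (`|enorm (gradient (F \o phi k) x -
        f (v x) *: Wgrad v x)| `^ p)%:E)%E =
      (fun k => \int[leb]_(x in Omega) (q k x `^ p)%:E)%E.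
    apply/funext => k; apply: eq_integral => x _.
    by rewrite ger0_norm// enorm_ge0.
  by rewrite E1; exact: cq.
exists (Build_W01p mFv mfv
  (ex_intro _ (fun k => F \o phi k) (And3 CF h1 h2))).
by split.
Qed.

End W01p_composition.

(** * Passing from smooth to sharp truncations *)

(** Both ends are included because at |u| = k and at |u| = h the slope of the
    truncation is the mean of its one-sided values. *)
Definition level (T : Type) (R : realType) (O : set T) (u : T -> R) (k h : R) :=
  O `&` [set x | k <= `|u x| <= h].

Definition superlevel (T : Type) (R : realType) (O : set T) (u : T -> R) (k : R) :=
  O `&` [set x | k <= `|u x|].

Section truncation_limits.
Context {d} {T : measurableType d} {R : realType}.
Variable mu : {measure set T -> \bar R}.
Variables (O : set T) (mO : measurable O).
Implicit Types (s g u : T -> R).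

Lemma integrable_real g : measurable_fun O g -> (forall x, O x -> 0 <= g x) ->
  (\int[mu]_(x in O) (g x)%:E < +oo)%E ->
  mu.-integrable O (fun x => (g x)%:E).
Proof.
move=> mg g0 ig; apply/integrableP; split; first exact/measurable_EFinP.
rewrite (eq_integral (fun x => (g x)%:E))// => x; rewrite inE => Ox.
by rewrite gee0_abs// lee_fin g0.
Qed.

Lemma dominated_cvg_real (f_ : nat -> T -> R) (f g : T -> R) :
  (forall n, measurable_fun O (f_ n)) ->
  (forall x, O x -> f_ n x @[n --> \oo] --> f x) ->
  mu.-integrable O (fun x => (g x)%:E) ->
  (forall n x, O x -> `|f_ n x| <= g x) ->
  [/\ measurable_fun O f, mu.-integrable O (fun x => (f x)%:E) &
    (\int[mu]_(x in O) (f_ n x)%:E @[n --> \oo] -->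
     \int[mu]_(x in O) (f x)%:E)%E].
Proof.
move=> mf_ cf ig fg.
have cfE x : O x -> (f_ n x)%:E @[n --> \oo] --> (f x)%:E.
  by move=> Ox; apply: cvg_EFin; [exact: nearW|exact: cf].
have mf_E n : measurable_fun O (fun x => (f_ n x)%:E) by exact/measurable_EFinP.
have mfE : measurable_fun O (fun x => (f x)%:E).
  exact: (emeasurable_fun_cvg (fun n x => (f_ n x)%:E)).
have ae1 : {ae mu, forall x, O x -> (f_ n x)%:E @[n --> \oo] --> (f x)%:E}.
  exact: aeW.
have ae2 : {ae mu, forall x n, O x -> (`|(f_ n x)%:E| <= (g x)%:E)%E}.
  by apply: aeW => x n Ox; rewrite lee_fin fg.
have [i1 _ c] := dominated_convergence mO mf_E mfE ae1 ig ae2.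
by split => //; exact/measurable_EFinP.
Qed.

Lemma measurable_superlevel u k : measurable_fun O u ->
  measurable (superlevel O u k).
Proof.
move=> mu'; have mn : measurable_fun O (fun x => `|u x|).
  exact: measurableT_comp.
have := mn mO `[k, +oo[%classic (measurable_itv _).
rewrite (_ : O `&` _ = superlevel O u k)//.
by apply/seteqP; split=> x /= [Ox]; rewrite in_itv /= andbT.
Qed.

Lemma measurable_level u k h : measurable_fun O u -> measurable (level O u k h).
Proof.
move=> mu'; have mn : measurable_fun O (fun x => `|u x|).
  exact: measurableT_comp.
have := mn mO `[k, h]%classic (measurable_itv _).
by rewrite (_ : O `&` _ = level O u k h).
Qed.

Lemma integral_indic_real (A : set T) g : A `<=` O ->
  (\int[mu]_(x in A) (g x)%:E = \int[mu]_(x in O) (\1_A x * g x)%:E)%E.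
Proof.
move=> AO; rewrite [LHS]integral_mkcond [RHS]integral_mkcond.
apply: eq_integral => x _; rewrite !patchE indicE.
have [xA|xA] := boolP (x \in A).
  by rewrite mem_set ?mul1r//; apply: AO; move: xA; rewrite inE.
by rewrite mul0r; case: ifP.
Qed.

Lemma measurable_smooth_trunc_deriv e k u : 0 < e -> measurable_fun O u ->
  measurable_fun O (fun x => smooth_trunc_deriv e k (u x)).
Proof.
move=> e0 mu'; apply: (@measurableT_comp _ _ _ _ _ _ (smooth_trunc_deriv e k)) => //.
apply: continuous_measurable_fun; apply: (@continuous_lipschitz _ _ (2 / e)).
  by rewrite divr_ge0// ltW.
by move=> s t; exact: smooth_trunc_deriv_lip.
Qed.

Lemma measurable_smooth_trunc e k u : 0 < e -> measurable_fun O u ->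
  measurable_fun O (fun x => smooth_trunc e k (u x)).
Proof.
move=> e0 mu'; apply: (@measurableT_comp _ _ _ _ _ _ (smooth_trunc e k)) => //.
apply: continuous_measurable_fun => t.
apply/differentiable_continuous/derivable1_diffP.
by have [] := is_derive_smooth_trunc k t e0.
Qed.

Let en (n : nat) : R := n.+1%:R^-1.
Let en0 n : 0 < en n. Proof. by rewrite invr_gt0. Qed.

(** The inequality for the difference of the smooth truncations at h and k
    passes to the limit: on A(h) that difference tends to h - k, and the
    difference of the slopes tends to a function bounded by the indicator of
    the strip, dominated by |Du| in L^1. *)
Lemma level_limit (I : finType) u (Du : I -> T -> R) (k h b : R) :
  0 <= k -> k <= h -> 0 <= b -> measurable_fun O u ->
  (forall i, measurable_fun O (Du i)) ->
  (forall i, mu.-integrable O (fun x => (`|Du i x|)%:E)) ->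
  (mu (superlevel O u h) < +oo)%E ->
  (forall n, \int[mu]_(x in superlevel O u h)
      (`|smooth_trunc (en n) h (u x) - smooth_trunc (en n) k (u x)|)%:E <=
    b%:E * \sum_i \int[mu]_(x in O)
      (`|(smooth_trunc_deriv (en n) h (u x) - smooth_trunc_deriv (en n) k (u x)) * Du i x|)%:E)%E ->
  ((h - k)%:E * mu (superlevel O u h) <=
    b%:E * \sum_i \int[mu]_(x in level O u k h) (`|Du i x|)%:E)%E.
Proof.
move=> k0 kh b0 mu' mDu iDu fA H.
have h0 := le_trans k0 kh.
set A := superlevel O u h.
have mA : measurable A by exact: measurable_superlevel.
have AO : A `<=` O by exact: subIsetl.
have finA : mu A \is a fin_num by rewrite ge0_fin_numE.
have lower n : ((h - k - 2 * en n)%:E * mu A <= \int[mu]_(x in A)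
    (`|smooth_trunc (en n) h (u x) - smooth_trunc (en n) k (u x)|)%:E)%E.
  have [neg|pos] := leP (h - k - 2 * en n) 0.
    apply: (@le_trans _ _ 0%E); last exact: integral_ge0.
    by rewrite mule_le0_ge0// lee_fin.
  rewrite -integral_cst//; apply: ge0_le_integral_real => //.
  - apply: measurableT_comp => //.
    apply: (measurable_funS mO AO).
    by apply: measurable_funB; exact: measurable_smooth_trunc.
  - by move=> x _; exact: ltW.
  - move=> x [Ox /= hx].
    have c1 := smooth_trunc_close h (u x) (ltW (en0 n)).
    have c2 := smooth_trunc_close k (u x) (ltW (en0 n)).
    have t1 : trunc h (u x) = Num.sg (u x) * h.
      rewrite truncE//; case: ifPn => // xh.
      have -> : h = `|u x| by apply/eqP; rewrite eq_le hx.
      exact: numEsg.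
    have t2 : trunc k (u x) = Num.sg (u x) * k.
      rewrite truncE//; case: ifPn => // xk.
      have -> : k = `|u x| by apply/eqP; rewrite eq_le xk (le_trans kh).
      exact: numEsg.
    move: c1 c2; rewrite t1 t2.
    have [ux|ux|ux] := sgrP (u x).
    + have h00 : h = 0 by apply/eqP; rewrite eq_le h0 andbT; move: hx; rewrite ux normr0.
      have k00 : k = 0 by apply/eqP; rewrite eq_le k0 andbT -h00.
      by rewrite h00 k00 => _ _; have := normr_ge0 (smooth_trunc (en n) 0 0 - smooth_trunc (en n) 0 0);
        have := en0 n; rewrite ?ux; lra.
    + rewrite !mul1r !ler_norml => /andP[? ?] /andP[? ?].
      by rewrite ler_normr; apply/orP; left; lra.
    + rewrite !mulN1r !ler_norml => /andP[? ?] /andP[? ?].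
      by rewrite ler_normr; apply/orP; right; lra.
have lcvg : (((h - k - 2 * en n)%:E * mu A) @[n --> \oo] --> (h - k)%:E * mu A)%E.
  rewrite -(fineK finA); apply: cvg_EFin; first exact: nearW.
  rewrite /= ; apply: cvgM; last exact: cvg_cst.
  rewrite -[X in _ --> X]subr0; apply: cvgB; first exact: cvg_cst.
  by rewrite -(mulr0 2); apply: cvgM; [exact: cvg_cst|exact: cvg_harmonic].
have dcvg i := @dominated_cvg_real
  (fun n x => `|(smooth_trunc_deriv (en n) h (u x) - smooth_trunc_deriv (en n) k (u x)) * Du i x|)
  (fun x => `|(trunc_deriv h (u x) - trunc_deriv k (u x)) * Du i x|)
  (fun x => `|Du i x|).
have ccvg i : (\int[mu]_(x in O)
      (`|(smooth_trunc_deriv (en n) h (u x) - smooth_trunc_deriv (en n) k (u x)) * Du i x|)%:E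
    @[n --> \oo] --> \int[mu]_(x in O)
      (`|(trunc_deriv h (u x) - trunc_deriv k (u x)) * Du i x|)%:E)%E /\
    measurable_fun O (fun x => `|(trunc_deriv h (u x) - trunc_deriv k (u x)) * Du i x|).
  have [] // := dcvg i.
  - move=> n; apply: measurableT_comp => //; apply: measurable_funM => //.
    by apply: measurable_funB; exact: measurable_smooth_trunc_deriv.
  - move=> x _; apply: cvg_norm; apply: cvgM; last exact: cvg_cst.
    by apply: cvgB; exact: smooth_trunc_deriv_cvg.
  - move=> n x Ox; rewrite normr_id normrM ler_piMl//.
    have := smooth_trunc_deriv_ge0 (u x) (en0 n) h0; have := smooth_trunc_deriv_ge0 (u x) (en0 n) k0.
    have := smooth_trunc_deriv_le1 h (u x) (en0 n); have := smooth_trunc_deriv_le1 k (u x) (en0 n).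
    by move=> *; rewrite ler_norml; apply/andP; split; lra.
have nneg (i : I) : true -> \forall n \near \oo, (0 <= \int[mu]_(x in O)
    (`|(smooth_trunc_deriv (en n) h (u x) - smooth_trunc_deriv (en n) k (u x)) * Du i x|)%:E)%E.
  by move=> _; apply: nearW => n; exact: integral_ge0.
have scvg := @cvg_nnesum _ _ eventually_filter _ _ (index_enum I) _ _ _
  nneg (fun i _ => (ccvg i).1).
apply: (@le_trans _ _ (b%:E * \sum_i \int[mu]_(x in O)
      (`|(trunc_deriv h (u x) - trunc_deriv k (u x)) * Du i x|)%:E)%E).
  have bfin : b%:E \is a fin_num by [].
  have rcvg := cvgeZl bfin scvg.
  apply: (lee_cvg_to lcvg rcvg).
  by apply: nearW => n; exact: le_trans (H n).
rewrite lee_wpmul2l ?lee_fin//; apply: lee_sum => i _.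
rewrite (integral_indic_real (A := level O u k h)); last exact: subIsetl.
apply: ge0_le_integral_real => //.
- exact: (ccvg i).2.
- apply: measurable_funM.
    by apply: measurable_indic; exact: measurable_level.
  by apply: measurableT_comp; [exact: normr_measurable|exact: mDu].
- move=> x Ox; rewrite normrM ler_wpM2r// (le_trans (norm_trunc_derivB (u x) k0 kh))//.
  rewrite indicE; case: (boolP (k <= `|u x| <= h)) => [xl|_] //=.
  by rewrite mem_set.
Qed.

Lemma integrable_le (g f : T -> R) : measurable_fun O g ->
  mu.-integrable O (fun x => (f x)%:E) -> (forall x, O x -> `|g x| <= `|f x|) ->
  mu.-integrable O (fun x => (g x)%:E).
Proof.
move=> mg fi gf; apply: (le_integrable mO _ _ fi); first exact/measurable_EFinP.
by move=> x Ox; rewrite lee_fin gf.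
Qed.

Lemma integrable_measurable (f : T -> R) :
  mu.-integrable O (fun x => (f x)%:E) -> measurable_fun O f.
Proof. by move=> /integrableP[/measurable_EFinP]. Qed.

(** The negative part of HD - fu is at most |fu|, hence integrable; an upper
    bound of the integral then controls the positive part. *)
Lemma energy_integrable (HD fu : T -> R) : measurable_fun O HD ->
  (forall x, 0 <= HD x) -> mu.-integrable O (fun x => (fu x)%:E) ->
  (\int[mu]_(x in O) (HD x - fu x)%:E <= 0)%E ->
  mu.-integrable O (fun x => (HD x)%:E).
Proof.
move=> mHD HD0 ifu J0; have mfu := integrable_measurable ifu.
have mf : measurable_fun O (fun x => HD x - fu x) by exact: measurable_funB.
pose fp x := Num.max (HD x - fu x) 0.
pose fn x := Num.max (- (HD x - fu x)) 0.
have mfp : measurable_fun O fp by apply: measurable_maxr.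
have mfn : measurable_fun O fn by apply: measurable_maxr => //; exact: measurableT_comp.
have ifn : mu.-integrable O (fun x => (fn x)%:E).
  apply: (integrable_le mfn ifu) => x _; rewrite /fn ger0_norm ?le_max ?lexx ?orbT//.
  rewrite ge_max normr_ge0 andbT opprB.
  by have := ler_norm (fu x); have := HD0 x; lra.
have Jpn : (\int[mu]_(x in O) (HD x - fu x)%:E =
    \int[mu]_(x in O) (fp x)%:E - \int[mu]_(x in O) (fn x)%:E)%E.
  rewrite integralE; congr (_ - _)%E; apply: eq_integral => x _.
    by rewrite funeposE /fp EFin_max.
  by rewrite funenegE /fn -EFinN EFin_max.
have fnfin : (\int[mu]_(x in O) (fn x)%:E)%E \is a fin_num by exact: integrable_fin_num.
have fpfin : (\int[mu]_(x in O) (fp x)%:E < +oo)%E.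
  move: J0; rewrite Jpn leeBlDr// add0e => /le_lt_trans; apply.
  by rewrite ltey_eq fnfin.
have ifp : mu.-integrable O (fun x => (fp x)%:E).
  by apply: integrable_real => // x _; rewrite /fp le_max lexx orbT.
have isum : mu.-integrable O (fun x => (fp x + `|fu x|)%:E).
  have -> : (fun x => (fp x + `|fu x|)%:E) =
      (fun x => (fp x)%:E + `|(fu x)%:E|)%E by [].
  by apply: integrableD => //; exact: integrable_abse.
apply: (integrable_le mHD isum) => x _; rewrite ger0_norm// ger0_norm.
  have : HD x - fu x <= fp x by rewrite /fp le_max lexx.
  by have := ler_norm (fu x); lra.
by rewrite addr_ge0// /fp le_max lexx orbT.
Qed.

(** One comparison of u with a competitor: HG is the density of the competitor
    and r its ratio to u. All integrals are finite, so that the terms may be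
    rearranged. *)
Lemma energy_step (HD HG fu g r : T -> R) :
  (forall x, 0 <= HD x) -> (forall x, 0 <= HG x) ->
  measurable_fun O HG -> measurable_fun O g -> measurable_fun O r ->
  mu.-integrable O (fun x => (HD x)%:E) ->
  mu.-integrable O (fun x => (fu x)%:E) ->
  (forall x, 0 <= g x <= 1) -> (forall x, 0 <= r x <= 1) ->
  (forall x, HG x <= g x * HD x) ->
  (\int[mu]_(x in O) (HD x - fu x)%:E <=
   \int[mu]_(x in O) (HG x - fu x * r x)%:E)%E ->
  (\int[mu]_(x in O) ((1 - g x) * HD x)%:E <=
   \int[mu]_(x in O) (fu x * (1 - r x))%:E)%E.
Proof.
move=> HD0 HG0 mHG mg mr iHD ifu g01 r01 HGle J.
have mHD := integrable_measurable iHD; have mfu := integrable_measurable ifu.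
have frac (a f : T -> R) : measurable_fun O a -> (forall x, 0 <= a x <= 1) ->
    mu.-integrable O (fun x => (f x)%:E) ->
    mu.-integrable O (fun x => (f x * a x)%:E).
  move=> ma a01 fi; apply: (integrable_le _ fi).
    by apply: measurable_funM => //; apply: integrable_measurable.
  move=> x _; rewrite normrM ler_piMr//; have /andP[a0 a1] := a01 x.
  by rewrite ger0_norm.
have c01 (a : T -> R) : (forall x, 0 <= a x <= 1) -> forall x, 0 <= 1 - a x <= 1.
  by move=> a01 x; have /andP[? ?] := a01 x; apply/andP; split; lra.
have ir := frac _ _ mr r01 ifu.
have m1 (a : T -> R) : measurable_fun O a -> measurable_fun O (fun x => 1 - a x).
  by move=> ma; apply: measurable_funB.
have i1r := frac _ _ (m1 _ mr) (c01 _ r01) ifu.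
have ig := frac _ _ mg g01 iHD.
have i1g := frac _ _ (m1 _ mg) (c01 _ g01) iHD.
have iHG : mu.-integrable O (fun x => (HG x)%:E).
  apply: (integrable_le mHG ig) => x _; rewrite !ger0_norm//.
    by rewrite mulrC HGle.
  by rewrite mulr_ge0//; have /andP[] := g01 x.
have fin (f : T -> R) : mu.-integrable O (fun x => (f x)%:E) ->
   (\int[mu]_(x in O) (f x)%:E)%E \is a fin_num by move=> ?; exact: integrable_fin_num.
have B (a b : T -> R) : mu.-integrable O (fun x => (a x)%:E) ->
    mu.-integrable O (fun x => (b x)%:E) ->
    (\int[mu]_(x in O) (a x - b x)%:E =
     \int[mu]_(x in O) (a x)%:E - \int[mu]_(x in O) (b x)%:E)%E.
  by move=> ia ib; rewrite -(integralB mO ia ib).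
have le1 : (\int[mu]_(x in O) (HG x)%:E <= \int[mu]_(x in O) (HD x * g x)%:E)%E.
  by apply: le_integral => // x _; rewrite lee_fin mulrC.
have E1 : (\int[mu]_(x in O) ((1 - g x) * HD x)%:E =
    \int[mu]_(x in O) (HD x)%:E - \int[mu]_(x in O) (HD x * g x)%:E)%E.
  by rewrite -B//; apply: eq_integral => x _; congr EFin; ring.
have E2 : (\int[mu]_(x in O) (fu x * (1 - r x))%:E =
    \int[mu]_(x in O) (fu x)%:E - \int[mu]_(x in O) (fu x * r x)%:E)%E.
  by rewrite -B//; apply: eq_integral => x _; congr EFin; ring.
move: J; rewrite E1 E2 !B//.
move: le1 (fin _ iHD) (fin _ ifu) (fin _ ig) (fin _ ir) (fin _ iHG).
case: (\int[mu]_(x in O) (HD x)%:E)%E => // a1.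
case: (\int[mu]_(x in O) (fu x)%:E)%E => // a2.
case: (\int[mu]_(x in O) (HD x * g x)%:E)%E => // a3.
case: (\int[mu]_(x in O) (fu x * r x)%:E)%E => // a4.
case: (\int[mu]_(x in O) (HG x)%:E)%E => // a5.
by rewrite -!EFinB !lee_fin => *; lra.
Qed.

Let ratio (k e t : R) : R := 2 * k / (smooth_abs e (t + k) + smooth_abs e (t - k)).

Lemma measurable_ratio k e u : 0 < e -> measurable_fun O u ->
  measurable_fun O (fun x => ratio k e (u x)).
Proof.
move=> e0 mu'; apply: (@measurableT_comp _ _ _ _ _ _ (ratio k e)) => //.
apply: continuous_measurable_fun => t.
have cs c : {for t, continuous (fun t => smooth_abs e (t + c))}.
  apply: (@continuous_lipschitz _ _ 1) => // a b; rewrite mul1r.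
  by rewrite (le_trans (smooth_abs_lip _ _ e0))// opprD addrACA subrr addr0.
have cV : {for t, continuous (fun t => (smooth_abs e (t + k) + smooth_abs e (t - k))^-1)}.
  apply: continuousV; first by rewrite gt_eqF// addr_gt0// smooth_abs_gt0.
  exact: (continuousD (cs k) (cs (- k))).
have cc : {for t, continuous (fun _ : R => 2 * k)} by exact: cst_continuous.
exact: (continuousM cc cV).
Qed.

(** The energy comparison for the sharp truncation, the limit of that for
    the smooth ones. The factor 1/2 is the bound of 1 - G' from below on
    {|u| >= k}; for k > 0 it cannot be improved to 1, since G' tends to 1/2
    where |u| = k. *)
Lemma energy_limit u (phi HD : T -> R) (HG : nat -> T -> R) (k : R) :
  0 <= k -> measurable_fun O u -> measurable_fun O HD ->
  (forall n, measurable_fun O (HG n)) ->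
  mu.-integrable O (fun x => (phi x * u x)%:E) ->
  (forall x, 0 <= HD x) -> (forall n x, 0 <= HG n x) ->
  (forall n x, HG n x <= smooth_trunc_deriv (en n) k (u x) * HD x) ->
  mu.-integrable O (fun x => (HD x)%:E) ->
  (forall n, \int[mu]_(x in O) (HD x - phi x * u x)%:E <=
     \int[mu]_(x in O) (HG n x - phi x * smooth_trunc (en n) k (u x))%:E)%E ->
  measurable_fun O (fun x => phi x * (u x - trunc k (u x))) /\
  ((2^-1)%:E * \int[mu]_(x in superlevel O u k) (HD x)%:E <=
   \int[mu]_(x in O) (phi x * (u x - trunc k (u x)))%:E)%E.
Proof.
move=> k0 mu' mHD mHG ifu HD0 HG0 HGle iHD J.
have mfu := integrable_measurable ifu.
have r01 n x : 0 <= ratio k (en n) (u x) <= 1.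
  have sp := smooth_abs_gt0 (u x + k) (en0 n); have sm := smooth_abs_gt0 (u x - k) (en0 n).
  rewrite /ratio divr_ge0 ?mulr_ge0// ?addr_ge0// ?(ltW sp) ?(ltW sm)//=.
  rewrite ler_pdivrMr ?addr_gt0// mul1r.
  have := le_norm_smooth_abs (en n) (u x + k); have := le_norm_smooth_abs (en n) (u x - k).
  have := ler_norm (u x + k); have := ler_norm (- (u x - k)).
  by rewrite normrN; lra.
have g01 n x : 0 <= smooth_trunc_deriv (en n) k (u x) <= 1.
  by rewrite smooth_trunc_deriv_ge0// smooth_trunc_deriv_le1.
have sE n x : phi x * smooth_trunc (en n) k (u x) = phi x * u x * ratio k (en n) (u x).
  by rewrite smooth_truncE// mulrA.
have step n : (\int[mu]_(x in O) ((1 - smooth_trunc_deriv (en n) k (u x)) * HD x)%:E <=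
   \int[mu]_(x in O) (phi x * u x * (1 - ratio k (en n) (u x)))%:E)%E.
  apply: (@energy_step HD (HG n)) => //.
  - exact: measurable_smooth_trunc_deriv.
  - exact: measurable_ratio.
  - by under [leRHS]eq_integral do rewrite -sE.
have lower n : ((2^-1)%:E * \int[mu]_(x in superlevel O u k) (HD x)%:E <=
    \int[mu]_(x in O) ((1 - smooth_trunc_deriv (en n) k (u x)) * HD x)%:E)%E.
  have AO : superlevel O u k `<=` O by exact: subIsetl.
  have mA := measurable_superlevel k mu'.
  rewrite -ge0_integralZl//; last 2 first.
  - by apply/measurable_EFinP; exact: measurable_funS AO mHD.
  - by move=> x _; rewrite lee_fin.
  rewrite [leLHS](_ : _ =
    \int[mu]_(x in superlevel O u k) (2^-1 * HD x)%:E)%E//.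
  rewrite (integral_indic_real _ AO); apply: ge0_le_integral_real => //.
  - apply: measurable_funM; first exact: measurable_indic.
    by apply: measurable_funM.
  - apply: measurable_funM => //; apply: measurable_funB => //.
    exact: measurable_smooth_trunc_deriv.
  - by move=> x _; rewrite !mulr_ge0.
  - move=> x Ox; rewrite mulrA ler_wpM2r// indicE.
    have [xA|_] := boolP (x \in superlevel O u k); last first.
      by rewrite mul0r subr_ge0; have /andP[] := g01 n x.
    have /= [_ kx] : superlevel O u k x by move: xA; rewrite inE.
    by have := smooth_trunc_deriv_le_half (en0 n) kx; lra.
have cv x : O x -> phi x * u x * (1 - ratio k (en n) (u x)) @[n --> \oo] -->
    phi x * (u x - trunc k (u x)).
  move=> Ox; have -> : (fun n => phi x * u x * (1 - ratio k (en n) (u x))) =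
      (fun n => phi x * (u x - smooth_trunc (en n) k (u x))).
    by apply/funext => n; rewrite smooth_truncE// -/(ratio k _ _); ring.
  apply: cvgM; first exact: cvg_cst.
  by apply: cvgB; [exact: cvg_cst|exact: smooth_trunc_cvg].
have iabs : mu.-integrable O (fun x => (`|phi x * u x|)%:E).
  exact: integrable_abse ifu.
have mrn n : measurable_fun O (fun x => phi x * u x * (1 - ratio k (en n) (u x))).
  apply: measurable_funM => //; apply: measurable_funB => //.
  exact: measurable_ratio.
have bn n x : O x ->
    `|phi x * u x * (1 - ratio k (en n) (u x))| <= `|phi x * u x|.
  move=> Ox; rewrite normrM ler_piMr//; have /andP[? ?] := r01 n x.
  by rewrite ger0_norm; lra.
have [m1 _ c1] := dominated_cvg_real mrn cv iabs bn.
split => //; apply: (lee_cvg_to (cvg_cst _) c1); apply: nearW => n.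
exact: le_trans (lower n) (step n).
Qed.

End truncation_limits.

(** * The two inequalities for an energy critical point *)

Section convex_continuity.
Variables (R : realType) (N : nat) (H : 'rV[R]_N -> R).
Hypothesis cH : convex_function (setT : set (convex_lmodType 'rV[R]_N)) H.

Lemma convex_functionE (t : R) (x y : 'rV[R]_N) : 0 <= t -> t <= 1 ->
  H (t *: x + (1 - t) *: y) <= t * H x + (1 - t) * H y.
Proof.
move=> t0 t1; have := @cH (Itv01 t0 t1) x y.
by rewrite !inE; apply.
Qed.

(** Bounds H on a cube centred at x by induction on the coordinates that are
    allowed to move, writing a point as a convex combination of points of
    opposite faces. *)
Lemma convex_bounded_box (s : seq 'I_N) (x : 'rV[R]_N) : exists K, forall z : 'rV[R]_N,
  (forall i, `|z ord0 i| <= 1) -> (forall i, i \notin s -> z ord0 i = 0) ->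
  H (x + z) <= K.
Proof.
elim: s x => [|i s IHs] x.
  exists (H x) => z _ z0; rewrite (_ : z = 0) ?addr0//.
  by apply/rowP => i; rewrite z0// mxE.
have [K1 HK1] := IHs (x + delta_mx ord0 i).
have [K2 HK2] := IHs (x - delta_mx ord0 i).
exists (Num.max K1 K2) => z z1 zs.
pose z' : 'rV[R]_N := \row_j (if j == i then 0 else z ord0 j).
have z'1 j : `|z' ord0 j| <= 1 by rewrite mxE; case: ifP; rewrite ?normr0.
have z's j : j \notin s -> z' ord0 j = 0.
  by move=> js; rewrite mxE; case: eqP => // /eqP ji; apply: zs; rewrite inE negb_or ji.
(* The i-th coordinate z_i is the convex combination t - (1 - t) of 1 and -1. *)
pose t := (1 + z ord0 i) / 2.
have := z1 i; rewrite ler_norml => /andP[zl zr].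
have t0 : 0 <= t by rewrite /t; lra.
have t1 : t <= 1 by rewrite /t; lra.
have -> : x + z = t *: (x + delta_mx ord0 i + z') + (1 - t) *: (x - delta_mx ord0 i + z').
  apply/rowP => j; rewrite !mxE /t; have [->|ji] /= := eqVneq j i.
    by rewrite ?eqxx /=; field.
  by rewrite ?(eq_sym i j) ?(negbTE ji) /=; ring.
apply: (le_trans (convex_functionE _ _ t0 t1)).
have h1 : H (x + delta_mx ord0 i + z') <= Num.max K1 K2.
  by rewrite le_max HK1.
have h2 : H (x - delta_mx ord0 i + z') <= Num.max K1 K2.
  by rewrite le_max HK2// orbT.
by nra.
Qed.

(** A convex function that is bounded above near x is continuous at x: its
    growth towards y is controlled by the upper bound beyond y, and its decay
    by the upper bound on the other side of x. Continuity makes H(Dv)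
    measurable. *)
Lemma convex_continuous : continuous H.
Proof.
move=> x; have [K HK] := convex_bounded_box (enum 'I_N) x.
have {}HK (z : 'rV[R]_N) : (forall i, `|z ord0 i| <= 1) -> H (x + z) <= K.
  by move=> z1; apply: HK => // i; rewrite mem_enum.
have KH : H x <= K.
  by rewrite -[x]addr0; apply: HK => i; rewrite mxE normr0.
apply/(@cvgrPdist_le _ _ _ (nbhs x) (nbhs_filter x)) => e e0.
pose dl := Num.min 1 (e / (K - H x + 1)).
have K1 : 0 < K - H x + 1 by lra.
have dl0 : 0 < dl by rewrite lt_min ltr01 divr_gt0.
have := nbhsx_ballx x dl dl0.
apply: (@filterS _ _ (nbhs_filter x)) => y [_ xy].
have xy' i : `|(y - x) ord0 i| <= dl.
  by rewrite !mxE distrC; have := xy ord0 i; rewrite /ball /= => /ltW.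
(* y lies between x and x + z, and x between y and x - z. *)
pose z := dl^-1 *: (y - x).
have z1 i : `|z ord0 i| <= 1.
  rewrite mxE normrM gtr0_norm ?invr_gt0// mulrC ler_pdivrMr// mul1r.
  exact: xy'.
have nz1 i : `|(- z) ord0 i| <= 1 by rewrite mxE normrN.
have yE : y = dl *: (x + z) + (1 - dl) *: x.
  rewrite scalerDr /z scalerA divff ?gt_eqF// scale1r scalerBl scale1r.
  by apply/rowP => i; rewrite !mxE; ring.
have dl1 : dl <= 1 by rewrite ge_min lexx.
have up := convex_functionE (x + z) x (ltW dl0) dl1; rewrite -yE in up.
have s0 : 0 <= (1 + dl)^-1 by rewrite invr_ge0; lra.
have s1 : (1 + dl)^-1 <= 1 by rewrite invf_le1; lra.
have xE : x = (1 + dl)^-1 *: y + (1 - (1 + dl)^-1) *: (x - z).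
  by apply/rowP => i; rewrite yE !mxE; field; rewrite gt_eqF//; lra.
have lo := convex_functionE y (x - z) s0 s1; rewrite -xE in lo.
have Hz := HK z z1; have Hnz : H (x - z) <= K by exact: HK.
have lo' : (1 + dl) * H x <= H y + dl * K.
  have d1 : 0 < 1 + dl by lra.
  have : (1 + dl) * H x <= (1 + dl) * ((1 + dl)^-1 * H y + (1 - (1 + dl)^-1) * H (x - z)).
    by rewrite ler_wpM2l// ltW.
  rewrite mulrDr !mulrA mulrBr mulr1 divff ?gt_eqF// mul1r addrAC subrr add0r.
  by have : dl * H (x - z) <= dl * K; [rewrite ler_wpM2l// ltW|lra].
have up' : H y <= H x + dl * (K - H x).
  by have : dl * H (x + z) <= dl * K; [rewrite ler_wpM2l// ltW|lra].
have dle : dl * (K - H x) <= e.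
  have : dl <= e / (K - H x + 1) by rewrite ge_min lexx orbT.
  rewrite ler_pdivlMr// => h; apply: le_trans h.
  by rewrite ler_wpM2l ?(ltW dl0)//; lra.
by rewrite ler_norml; apply/andP; split; lra.
Qed.

End convex_continuity.

Lemma measurable_fun_coordP_on d (T : measurableType d) (R : realType) n
    (D : set T) (g : T -> borel_rV R n) :
  (forall i, measurable_fun D (fun x => (g x : 'rV[R]_n) ord0 i)) ->
  measurable_fun D g.
Proof.
move=> mg mD; move: (mD).
apply: (@measurability _ _ T (borel_rV R n) _ _ (@rV_generators R n)) => //.
by move=> _ [_ [i _ [B mB <-]] <-]; exact: (mg i mD B mB).
Qed.

Section W01p_critical.
Variables (R : realType) (N : nat).
Local Notation leb := (@lebesgue_rV R N).
Local Notation E := (euclidean R N).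
Variables (p : R) (Omega : set 'rV[R]_N) (H : 'rV[R]_N -> R) (c : R).
Variable f : 'rV[R]_N -> R -> R.
Hypotheses (p1 : 1 <= p) (oO : open Omega) (fO : (leb Omega < +oo)%E).
Hypotheses (H_ge0 : forall z, 0 <= H z).
Hypothesis cH : convex_function (setT : set (convex_lmodType 'rV[R]_N)) H.
Hypotheses (H0 : H 0 = 0) (c0 : 0 < c).
Hypothesis H_coercive : forall z, c * enorm z `^ p <= H z.

Let mO : measurable (Omega : set E).
Proof. exact: open_measurable_rV. Qed.

(** The zero competitor, against which u has nonpositive energy. *)
Lemma W01p_zero : exists w : W01p Omega p,
  (forall x, w x = 0) /\ (forall x, Wgrad w x = 0).
Proof.
have p0 : p != 0 by rewrite gt_eqF// (lt_le_trans _ p1).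
pose z : 'rV[R]_N -> R := cst 0.
have Cz : Cc_infty Omega z.
  have s0 : Defs.support z = set0.
    rewrite /Defs.support (_ : [set x | _] = set0) ?closure0//.
    by apply/seteqP; split => // x /=; rewrite eqxx.
  split; rewrite ?s0; [|exact: compact0|by []].
  by apply/smoothP => n; exact: class_C_cst.
have gz x : gradient z x = 0.
  by apply/rowP => i; rewrite !mxE /partial derive_cst.
have L0 (w : 'rV[R]_N -> R) : (forall x, w x = 0) -> LnormOn Omega p%:E w = 0%E.
  move=> w0; rewrite /LnormOn (_ : EFin \o _ = cst 0%E) ?Lnorm0//.
  by apply/funext => x; rewrite /= patchE; case: ifP => // _; rewrite w0.
have h1 : LnormOn Omega p%:E (fun x => z x - (fun _ => 0) x) @[k --> \oo] --> 0%E.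
  by rewrite L0; [exact: cvg_cst|move=> x; rewrite subr0].
have h2 : LnormOn Omega p%:E (fun x => enorm (gradient z x - 0)) @[k --> \oo] --> 0%E.
  rewrite L0; first exact: cvg_cst.
  move=> x; rewrite gz subr0 /enorm big1 ?sqrtr0// => i _.
  by rewrite mxE expr0n.
have m1 : measurable_fun (Omega : set E) (fun _ : 'rV[R]_N => 0 : R).
  exact: measurable_cst.
have m2 i : measurable_fun (Omega : set E)
    (fun x => (fun _ : 'rV[R]_N => 0 : 'rV[R]_N) x ord0 i).
  by rewrite (_ : (fun _ => _) = cst 0)//; apply/funext => x; rewrite mxE.
by exists (Build_W01p m1 m2 (ex_intro _ (fun=> z) (And3 (fun=> Cz) h1 h2))).
Qed.

Lemma measurable_H_grad (g : 'rV[R]_N -> 'rV[R]_N) :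
  (forall i, measurable_fun (Omega : set E) (fun x => g x ord0 i)) ->
  measurable_fun (Omega : set E) (fun x => H (g x)).
Proof.
move=> mg.
have mH : measurable_fun [set: borel_rV R N] H.
  by apply: continuous_borel; exact: convex_continuous.
exact: (measurableT_comp mH (measurable_fun_coordP_on mg)).
Qed.

Variable u : W01p Omega p.
Hypothesis crit : energy_critical_point H f u.

Let phi x := f x (u x).

Lemma integrable_H_grad :
  leb.-integrable Omega (fun x => (H (Wgrad u x))%:E).
Proof.
have [_ iV min] := crit.
have [w [w0 gw0]] := W01p_zero.
have E0 : (fun x => (f x (u x) * w x)%:E) = (cst 0%E : E -> \bar R).
  by apply/funext => x; rewrite w0 mulr0.
have Vw : in_V f u w by rewrite /in_V E0; exact: integrable0.
have J0 := min _ Vw.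
have Jw : J_at H f u w = 0%E.
  rewrite /J_at (eq_integral (cst 0%E)) ?integral0// => x _.
  by rewrite gw0 H0 w0 mulr0 subrr.
apply: (@energy_integrable _ E R leb Omega mO (fun x => H (Wgrad u x))
  (fun x => phi x * u x)).
- by apply: measurable_H_grad; exact: Wgrad_measurable.
- by move=> x; exact: H_ge0.
- exact: iV.
- by move: J0; rewrite Jw; apply.
Qed.

Lemma measurable_enorm_grad : measurable_fun (Omega : set E)
  (fun x => enorm (Wgrad u x)).
Proof. by apply: measurable_enorm => i; exact: Wgrad_measurable. Qed.

Lemma integral_grad_powR_fin :
  (\int[leb]_(x in Omega) (enorm (Wgrad u x) `^ p)%:E < +oo)%E.
Proof.
have mH : measurable_fun (Omega : set E) (fun x => H (Wgrad u x)).
  by apply: measurable_H_grad; exact: Wgrad_measurable.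
have mp : measurable_fun (Omega : set E) (fun x => (enorm (Wgrad u x) `^ p)%:E).
  by apply: measurable_powR_fun; exact: measurable_enorm_grad.
have iH : (\int[leb]_(x in Omega) (H (Wgrad u x))%:E < +oo)%E.
  have /integrableP[_] := integrable_H_grad.
  by under eq_integral do rewrite gee0_abs ?lee_fin//.
have h : (c%:E * \int[leb]_(x in Omega) (enorm (Wgrad u x) `^ p)%:E <=
    \int[leb]_(x in Omega) (H (Wgrad u x))%:E)%E.
  rewrite -ge0_integralZl//; last 2 first.
  - by move=> x _; rewrite lee_fin powR_ge0.
  - by rewrite lee_fin ltW.
  apply: (@ge0_le_integral_real _ E R leb Omega
    (fun x => c * enorm (Wgrad u x) `^ p) (fun x => H (Wgrad u x)) mO).
  - apply: measurable_funM; first exact: measurable_cst.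
    exact/measurable_EFinP.
  - exact: mH.
  - by move=> x _; rewrite mulr_ge0 ?powR_ge0 ?(ltW c0).
  - by move=> x _; exact: H_coercive.
have := le_lt_trans h iH.
case: (\int[leb]_(x in Omega) (enorm (Wgrad u x) `^ p)%:E)%E => [r _| |//].
  exact: ltry.
by rewrite gt0_muley ?lte_fin// ltxx.
Qed.

(** The energy inequality: the competitors are the smooth truncations of u at
    height k. *)
Lemma energy_superlevel (k : R) : 0 <= k ->
  measurable_fun (Omega : set E) (fun x => phi x * (u x - trunc k (u x))) /\
  ((c / 2)%:E * \int[leb]_(x in superlevel Omega u k)
     (enorm (Wgrad u x) `^ p)%:E <=
   \int[leb]_(x in Omega) (phi x * (u x - trunc k (u x)))%:E)%E.
Proof.
move=> k0; have [_ iV min] := crit.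
have mu' := Wfun_measurable u.
pose en (n : nat) : R := n.+1%:R^-1.
have en0 n : 0 < en n by rewrite invr_gt0.
pose HG n x := H (smooth_trunc_deriv (en n) k (u x) *: Wgrad u x).
have mHG n : measurable_fun (Omega : set E) (HG n).
  apply: measurable_H_grad => i.
  rewrite (_ : (fun _ => _) =
      fun x => smooth_trunc_deriv (en n) k (u x) * Wgrad u x ord0 i); last first.
    by apply/funext => x; rewrite mxE.
  apply: measurable_funM; last exact: Wgrad_measurable.
  exact: measurable_smooth_trunc_deriv.
have HGle n x : HG n x <= smooth_trunc_deriv (en n) k (u x) * H (Wgrad u x).
  have := convex_functionE cH (Wgrad u x) 0 (smooth_trunc_deriv_ge0 (u x) (en0 n) k0)
    (smooth_trunc_deriv_le1 k (u x) (en0 n)).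
  by rewrite scaler0 addr0 H0 mulr0 addr0.
have J n : (\int[leb]_(x in Omega) (H (Wgrad u x) - phi x * u x)%:E <=
     \int[leb]_(x in Omega) (HG n x - phi x * smooth_trunc (en n) k (u x))%:E)%E.
  have L0 : 0 <= 2 / en n by rewrite divr_ge0// ltW.
  have g1 t : `|smooth_trunc_deriv (en n) k t| <= 1.
    by rewrite ger0_norm ?smooth_trunc_deriv_ge0 ?smooth_trunc_deriv_le1.
  have FL s t : `|smooth_trunc (en n) k s - smooth_trunc (en n) k t| <= 2 * `|s - t|.
    by have := smooth_trunc_lip k s t (en0 n); have := normr_ge0 (s - t); lra.
  have [w [wE gwE]] := W01p_comp p1 oO (v := u) (smooth_trunc0 (en n) k)
    (fun t => is_derive_smooth_trunc k t (en0 n)) g1 L0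
    (fun s t => smooth_trunc_deriv_lip k s t (en0 n)) FL
    (fun w => smooth_comp_trunc_deriv k (en0 n)) integral_grad_powR_fin.
  have E1 : (fun x => f x (u x) * w x) = (fun x => phi x * smooth_trunc (en n) k (u x)).
    by apply/funext => x; rewrite wE.
  have mphi : measurable_fun (Omega : set E) (fun x => phi x * smooth_trunc (en n) k (u x)).
    rewrite (_ : (fun _ => _) = fun x => phi x * u x *
        (2 * k / (smooth_abs (en n) (u x + k) + smooth_abs (en n) (u x - k)))).
      apply: measurable_funM; last exact: measurable_ratio.
      exact: integrable_measurable iV.
    by apply/funext => x; rewrite smooth_truncE// mulrA.
  have Vw : in_V f u w.
    rewrite /in_V (_ : (fun _ => _) =
      fun x => (phi x * smooth_trunc (en n) k (u x))%:E); last first.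
      by apply/funext => x; rewrite wE.
    apply: (@integrable_le _ E R leb Omega mO _ (fun x => phi x * u x) mphi iV).
    move=> x _; have [r /andP[r0 r1] ->] := smooth_trunc_factor (u x) (en0 n) k0.
    by rewrite mulrA [leLHS]normrM ler_piMr// ger0_norm.
  have := min _ Vw; rewrite /J_at.
  by under [leRHS]eq_integral do rewrite wE gwE.
have [m1 le1] := @energy_limit _ E R leb Omega mO u phi
  (fun x => H (Wgrad u x)) HG k k0 mu'
  (measurable_H_grad (Wgrad_measurable u)) mHG iV (fun x => H_ge0 _)
  (fun n x => H_ge0 _) HGle integrable_H_grad J.
split; first exact: m1.
apply: le_trans le1.
have mA := @measurable_superlevel _ E R Omega mO u k mu'.
have AO : superlevel Omega u k `<=` Omega by exact: subIsetl.
have mp : measurable_fun (superlevel Omega u k : set E)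
    (fun x => enorm (Wgrad u x) `^ p).
  apply/measurable_EFinP; apply: measurable_powR_fun.
  exact: measurable_funS mO AO measurable_enorm_grad.
have mH : measurable_fun (superlevel Omega u k : set E) (fun x => H (Wgrad u x)).
  exact: measurable_funS mO AO (measurable_H_grad (Wgrad_measurable u)).
rewrite mulrC EFinM -muleA lee_wpmul2l ?lee_fin ?invr_ge0//.
rewrite -ge0_integralZl; last 4 first.
- exact: mA.
- exact/measurable_EFinP.
- by move=> x _; rewrite lee_fin powR_ge0.
- by rewrite lee_fin ltW.
apply: (@ge0_le_integral_real _ E R leb _
    (fun x => c * enorm (Wgrad u x) `^ p) (fun x => H (Wgrad u x)) mA).
- by apply: measurable_funM; [exact: measurable_cst|exact: mp].
- exact: mH.
- by move=> x _; rewrite mulr_ge0 ?powR_ge0 ?(ltW c0).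
- by move=> x _; exact: H_coercive.
Qed.

Lemma integrable_grad_coord i :
  leb.-integrable Omega (fun x => (`|Wgrad u x ord0 i|)%:E).
Proof.
have mg := Wgrad_measurable u i.
have ms := measurable_enorm_grad.
apply: (@integrable_le _ E R leb Omega mO (fun x => `|Wgrad u x ord0 i|)
  (fun x => enorm (Wgrad u x))).
- by apply: measurableT_comp; [exact: normr_measurable|exact: mg].
- apply: (@integrable_real _ E R leb Omega (fun x => enorm (Wgrad u x)) ms).
    by move=> x _; exact: enorm_ge0.
  apply: (le_lt_trans (@integral_le_split _ E R leb Omega
    (fun x => enorm (Wgrad u x)) p 1 mO ms (fun x _ => enorm_ge0 _) p1 ltr01)).
  rewrite powR1 !mul1e; apply: lte_add_pinfty; first exact: fO.
  exact: integral_grad_powR_fin.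
- by move=> x _; rewrite normr_id (ger0_norm (enorm_ge0 _)) norm_coord_le_enorm.
Qed.

(** The gap inequality: the Poincare inequality on A(h) for the difference of
    the smooth truncations of u at h and at k, in the limit. *)
Lemma superlevel_gap (k h b : R) : 0 <= k -> k <= h -> 0 < b ->
  (leb (superlevel Omega u h) < (b ^+ N)%:E)%E ->
  ((h - k)%:E * leb (superlevel Omega u h) <=
   b%:E * (N%:R%:E * \int[leb]_(x in level Omega u k h) (enorm (Wgrad u x))%:E))%E.
Proof.
move=> k0 kh b0 Ab; have h0 := le_trans k0 kh.
have mu' := Wfun_measurable u.
have mA := @measurable_superlevel _ E R Omega mO u h mu'.
have AO : superlevel Omega u h `<=` Omega by exact: subIsetl.
have ml := @measurable_level _ E R Omega mO u k h mu'.
pose en (n : nat) : R := n.+1%:R^-1.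
have en0 n : 0 < en n by rewrite invr_gt0.
have Hn n : (\int[leb]_(x in superlevel Omega u h)
      (`|smooth_trunc (en n) h (u x) - smooth_trunc (en n) k (u x)|)%:E <=
    b%:E * \sum_(i < N) \int[leb]_(x in Omega)
      (`|(smooth_trunc_deriv (en n) h (u x) - smooth_trunc_deriv (en n) k (u x)) *
         Wgrad u x ord0 i|)%:E)%E.
  have L0 : 0 <= 4 / en n by rewrite divr_ge0// ltW.
  have F0 : smooth_trunc (en n) h 0 - smooth_trunc (en n) k 0 = 0 by rewrite !smooth_trunc0 subrr.
  have dF (t : R) : is_derive t (1 : R)
      (fun t => smooth_trunc (en n) h t - smooth_trunc (en n) k t)
      (smooth_trunc_deriv (en n) h t - smooth_trunc_deriv (en n) k t).
    exact: (is_deriveB (is_derive_smooth_trunc h t (en0 n)) (is_derive_smooth_trunc k t (en0 n))).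
  have g1 t : `|smooth_trunc_deriv (en n) h t - smooth_trunc_deriv (en n) k t| <= 1.
    have := smooth_trunc_deriv_ge0 t (en0 n) h0; have := smooth_trunc_deriv_ge0 t (en0 n) k0.
    have := smooth_trunc_deriv_le1 h t (en0 n); have := smooth_trunc_deriv_le1 k t (en0 n).
    by move=> *; rewrite ler_norml; apply/andP; split; lra.
  have tri (a a' e e' x : R) : `|a - a'| <= x -> `|e - e'| <= x ->
      `|(a - e) - (a' - e')| <= 2 * x.
    rewrite !ler_norml => /andP[? ?] /andP[? ?].
    by apply/andP; split; lra.
  have gL s t : `|(smooth_trunc_deriv (en n) h s - smooth_trunc_deriv (en n) k s) -
      (smooth_trunc_deriv (en n) h t - smooth_trunc_deriv (en n) k t)| <= 4 / en n * `|s - t|.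
    have := tri _ _ _ _ _ (smooth_trunc_deriv_lip h s t (en0 n)) (smooth_trunc_deriv_lip k s t (en0 n)).
    by rewrite (_ : 2 * (2 / en n * _) = 4 / en n * `|s - t|); last by ring.
  have FL s t : `|(smooth_trunc (en n) h s - smooth_trunc (en n) k s) -
      (smooth_trunc (en n) h t - smooth_trunc (en n) k t)| <= 2 * `|s - t|.
    exact: tri (smooth_trunc_lip h s t (en0 n)) (smooth_trunc_lip k s t (en0 n)).
  have gs (w : 'rV[R]_N -> R) : smooth w ->
      smooth ((fun t => smooth_trunc_deriv (en n) h t - smooth_trunc_deriv (en n) k t) \o w).
    by move=> sw; apply: smoothB; exact: smooth_comp_trunc_deriv.
  have [w [wE gwE]] := W01p_comp p1 oO (v := u) F0 dF g1 L0 gL FL gs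
    integral_grad_powR_fin.
  have := small_set_poincare_W01p p1 oO fO w b0 mA AO Ab.
  under eq_integral do rewrite wE.
  by under [X in (_ <= _ * X)%E -> _]eq_bigr do
    under eq_integral do rewrite gwE mxE.
have Afin : (leb (superlevel Omega u h) < +oo)%E by exact: lt_le_trans Ab (leey _).
have := @level_limit _ E R leb Omega mO 'I_N u (fun i x => Wgrad u x ord0 i)
  k h b k0 kh (ltW b0) mu' (Wgrad_measurable u) integrable_grad_coord Afin Hn.
move=> /le_trans; apply; rewrite lee_wpmul2l ?lee_fin ?(ltW b0)//.
rewrite -[X in (X%:R%:E * _)%E]card_ord.
have mDl i : measurable_fun (level Omega u k h : set E)
    (fun x => `|Wgrad u x ord0 i|).
  apply: measurableT_comp; first exact: normr_measurable.
  apply: (measurable_funS mO _ (Wgrad_measurable u i)); exact: subIsetl.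
have msl : measurable_fun (level Omega u k h : set E) (fun x => enorm (Wgrad u x)).
  by apply: (measurable_funS mO _ measurable_enorm_grad); exact: subIsetl.
apply: (@le_trans _ _ (\sum_(i < N)
    \int[leb]_(x in level Omega u k h) (enorm (Wgrad u x))%:E)%E).
  apply: lee_sum => i _; apply: (@ge0_le_integral_real _ E R leb _
    (fun x => `|Wgrad u x ord0 i|) (fun x => enorm (Wgrad u x)) ml (mDl i) msl).
    by move=> x _; exact: normr_ge0.
  by move=> x _; exact: norm_coord_le_enorm.
set X := (\int[leb]_(x in level Omega u k h) _)%E.
by rewrite sumr_const mule_natl.
Qed.

End W01p_critical.

(** * Iteration lemmas for real sequences *)

Section real_iterations.
Variable R : realType.

Lemma powR1D (x e : R) : 0 <= x -> 0 < e -> x `^ (1 + e) = x * x `^ e.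
Proof.
by move=> x0 e0; rewrite powRD ?powRr1// gt_eqF// addr_gt0.
Qed.

Lemma le_powR2 (x y e : R) : 0 <= e -> 0 <= x -> x <= y -> x `^ e <= y `^ e.
Proof.
by move=> e0 x0 xy; rewrite ge0_ler_powR ?nnegrE// (le_trans x0).
Qed.

(** Along the levels k_j = k0 + d (1 - 2^-j) one gets al(k_j) <= al(k0) rho^j
    with rho = 2^(-1/e); the condition on d is what makes this induction work,
    and monotonicity gives al(k0 + d) <= al(k_j) for all j. *)
Lemma stampacchia (al : R -> R) (k0 B e d : R) :
  (forall k, 0 <= al k) -> {homo al : x y /~ x <= y} ->
  0 <= B -> 0 < e -> 0 < d ->
  (forall k h, k0 <= k -> k < h -> (h - k) * al h <= B * al k `^ (1 + e)) ->
  2 `^ (1 + e^-1) * B * al k0 `^ e <= d -> al (k0 + d) = 0.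
Proof.
move=> al0 al_le B0 e0 d0 step dB.
pose rho : R := 2 `^ (- e^-1).
have rho0 : 0 < rho by rewrite powR_gt0.
have rhoE : rho `^ e = 2^-1.
  by rewrite /rho -powRrM mulNr mulVf ?gt_eqF// powRN powRr1.
have rhoe j : (rho ^+ j) `^ e = 2^-1 ^+ j.
  rewrite -powR_mulrn ?(ltW rho0)// -powRrM mulrC powRrM rhoE.
  by rewrite powR_mulrn// invr_ge0.
have rho1 : `|rho| < 1.
  rewrite gtr0_norm// /rho powRN invf_lt1 ?powR_gt0//.
  have : (1 : R) `^ e^-1 < 2 `^ e^-1.
    by rewrite gt0_ltr_powR ?invr_gt0 ?nnegrE ?ler01 ?ltr1n.
  by rewrite powR1.
(* The gaps d 2^-j lose a factor 2 at each step, which the power e of rho recovers. *)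
pose k j : R := k0 + d * (1 - 2^-1 ^+ j).
have half01 j : 0 < (2^-1 : R) ^+ j <= 1.
  by rewrite exprn_gt0//= exprn_ile1 ?invr_ge0// invf_le1 ?ler1n.
have kle j : k0 <= k j.
  rewrite lerDl mulr_ge0 ?(ltW d0)// subr_ge0; by have /andP[] := half01 j.
have kd j : k j.+1 - k j = d * 2^-1 ^+ j.+1.
  by rewrite /k exprS; field.
have key j : al (k j) <= al k0 * rho ^+ j.
  elim: j => [|j IH]; first by rewrite /k expr0 subrr mulr0 addr0 mulr1.
  have dj0 : 0 < d * 2^-1 ^+ j.+1 by rewrite mulr_gt0// exprn_gt0.
  have := step (k j) (k j.+1) (kle j); rewrite kd -subr_gt0 kd => /(_ dj0) h.
  rewrite -(ler_pM2l dj0); apply: (le_trans h).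
  apply: (@le_trans _ _ (B * (al k0 * rho ^+ j) `^ (1 + e))).
    by rewrite ler_wpM2l// le_powR2// addr_ge0// ltW.
  have r0 : 0 <= rho ^+ j by rewrite exprn_ge0// ltW.
  rewrite powR1D ?mulr_ge0// powRM// rhoe [rho ^+ j.+1]exprS [2^-1 ^+ j.+1]exprS.
  have E1 : 2 * B * al k0 `^ e <= rho * d.
    have rV : rho * 2 `^ e^-1 = 1 by rewrite /rho powRN mulVf// gt_eqF ?powR_gt0.
    have := ler_wpM2l (ltW rho0) dB; rewrite powR1D ?invr_gt0// !mulrA.
    by rewrite [rho * 2 * _]mulrAC rV mul1r.
  have Q0 : 0 <= (2^-1 : R) ^+ j by have /andP[/ltW] := half01 j.
  have APQ : 0 <= al k0 * rho ^+ j * (2^-1 : R) ^+ j by rewrite !mulr_ge0.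
  move: (ler_wpM2l APQ E1) r0 Q0.
  move: (al k0 `^ e) (rho ^+ j) ((2^-1 : R) ^+ j) => X P Q h2 _ _.
  apply: (@le_trans _ _ ((al k0 * P * Q * (2 * B * X)) / 2)); lra.
have cv : (fun j => al k0 * rho ^+ j) @ \oo --> (0 : R) by exact: cvg_geometric.
apply/eqP; rewrite eq_le al0 andbT.
apply: (ler_cvg_to (cvg_cst _) cv); apply: nearW => j.
apply: le_trans (key j); apply: al_le.
rewrite /k lerD2l ler_piMr ?(ltW d0)//.
Qed.

(** The factor 1/2 in front of a lets the term be absorbed when it is summed
    over all levels. *)
Lemma young_powR (K dl a p r : R) : 0 <= K -> 0 <= dl -> 0 <= a ->
  0 < p -> 1 < r ->
  K * dl `^ p^-1 * a `^ (1 - r^-1) <= a / 2 + (2 * K) `^ r * dl `^ (r / p).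
Proof.
move=> K0 d0 a0 p0 r1; have r0 : 0 < r by lra.
have rV : 0 < 1 - r^-1 by rewrite subr_gt0 invf_lt1.
have R0 : 0 <= (2 * K) `^ r * dl `^ (r / p) by rewrite mulr_ge0 ?powR_ge0.
have [h|h] := leP (K * dl `^ p^-1 * a `^ (1 - r^-1)) (a / 2).
  by rewrite (le_trans h)// lerDl.
have {}a0 : 0 < a.
  rewrite lt_neqAle a0 andbT; apply/negP => /eqP aE; move: h.
  by rewrite -aE powR0 ?gt_eqF// mulr0 mul0r ltxx.
set x := 2 * K * dl `^ p^-1.
have x0 : 0 <= x by rewrite !mulr_ge0 ?powR_ge0.
have aE : a = a `^ r^-1 * a `^ (1 - r^-1).
  by rewrite -powRD ?subrKC ?powRr1 ?(ltW a0)// oner_eq0.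
have ax : a `^ r^-1 <= x.
  rewrite -(@ler_pM2r _ (a `^ (1 - r^-1))) ?powR_gt0// -aE.
  by rewrite /x -!mulrA; move: h; rewrite -!mulrA; lra.
have ar : a `^ (1 - r^-1) <= x `^ (r - 1).
  have -> : 1 - r^-1 = r^-1 * (r - 1) by field; rewrite gt_eqF.
  by rewrite powRrM le_powR2 ?powR_ge0// subr_ge0 ltW.
have xr : x * x `^ (r - 1) = x `^ r by rewrite mulr_powRB1.
have xE : x `^ r = (2 * K) `^ r * dl `^ (r / p).
  by rewrite /x powRM ?mulr_ge0 ?powR_ge0// -powRrM [p^-1 * r]mulrC.
rewrite -xE -xr; apply: (@le_trans _ _ (x * a `^ (1 - r^-1))).
  rewrite /x ler_wpM2r ?powR_ge0// -mulrA ler_peMl ?mulr_ge0 ?powR_ge0//.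
  by rewrite ler1n.
by apply: (@le_trans _ _ (x * x `^ (r - 1))); [rewrite ler_wpM2l|rewrite lerDr; lra].
Qed.

Lemma fast_decay (Y : nat -> R) :
  (forall j, 0 <= Y j) -> (forall j, Y j.+1 <= Y j) ->
  (forall m, exists j1, forall j, (j1 <= j)%N -> 2 ^+ m * Y j.+1 <= Y j) ->
  forall m, exists K, forall j, 2 ^+ (j * m)%N * Y j <= K.
Proof.
move=> Y0 Yle fast m; have [j1 Hj1] := fast m.
have Yle0 j : Y j <= Y 0%N.
  by elim: j => // j IH; exact: le_trans (Yle j) IH.
have pow1 n : 1 <= 2 ^+ n :> R by rewrite exprn_ege1// ler1n.
exists (2 ^+ (j1 * m)%N * Y 0%N) => j.
have small i : (i <= j1)%N -> 2 ^+ (i * m)%N * Y i <= 2 ^+ (j1 * m)%N * Y 0%N.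
  move=> ij; apply: ler_pM => //.
  by rewrite ler_weXn2l ?ler1n// leq_mul2r ij orbT.
have [/small//|/ltnW] := leqP j j1.
elim: j => [|j IH]; first by rewrite leqn0 => /eqP j10; apply: small; rewrite j10.
rewrite leq_eqVlt => /orP[/eqP jE|]; first by apply: small; rewrite jE.
rewrite ltnS => jj; apply: le_trans (IH jj).
rewrite mulSn exprD [2 ^+ m * _]mulrC -mulrA ler_wpM2l ?exprn_ge0//.
exact: Hj1.
Qed.

(** Once Y_j is small, the factor Y_j^e is smaller than any given constant. *)
Lemma superlinear_decay (Y : nat -> R) (C e : R) :
  (forall j, 0 <= Y j) -> (forall j, Y j.+1 <= Y j) ->
  0 <= C -> 0 < e -> Y @ \oo --> (0 : R) ->
  (forall j, Y j <= 1 -> Y j.+1 <= C * Y j `^ (1 + e)) ->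
  forall m, exists j1, forall j, (j1 <= j)%N -> 2 ^+ m * Y j.+1 <= Y j.
Proof.
move=> Y0 Yle C0 e0 cY step m.
have C1 : 0 < 2 ^+ m * (C + 1) by rewrite mulr_gt0 ?exprn_gt0// ltr_wpDl.
pose eta : R := Num.min 1 ((2 ^+ m * (C + 1))^-1 `^ e^-1).
have eta0 : 0 < eta by rewrite lt_min ltr01 powR_gt0// invr_gt0.
have [j1 _ Hj1] : \forall j \near \oo, Y j <= eta.
  by apply: cvgr_le cY _ eta0.
exists j1 => j jj; have := Hj1 j jj; rewrite /= le_min => /andP[Y1 Ye].
apply: (@le_trans _ _ (2 ^+ m * (C * Y j `^ (1 + e)))).
  by rewrite ler_wpM2l ?exprn_ge0// step.
rewrite powR1D// [leLHS](_ : _ = (2 ^+ m * C * Y j `^ e) * Y j); last by ring.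
rewrite ler_piMl//.
have : Y j `^ e <= (2 ^+ m * (C + 1))^-1.
  have := le_powR2 (ltW e0) (Y0 j) Ye.
  by rewrite -powRrM mulVf ?gt_eqF// powRr1// invr_ge0 ltW.
move=> h; apply: (@le_trans _ _ (2 ^+ m * (C + 1) * (2 ^+ m * (C + 1))^-1)).
  apply: ler_pM => //; rewrite ?mulr_ge0 ?exprn_ge0 ?powR_ge0//.
  by rewrite ler_wpM2l ?exprn_ge0// lerDl.
by rewrite divff// gt_eqF.
Qed.

End real_iterations.

(** * Essential suprema and the growth condition *)

Section essential_bound.
Context {d} {T : measurableType d} {R : realType}.
Variable mu : {measure set T -> \bar R}.
Variables (O : set T) (u : T -> R).
Hypotheses (mO : measurable O) (mu_ : measurable_fun O u).

(** When the whole space is null the norm is 0 by convention, and the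
    right-hand side holds as well. *)
Lemma Lnorm_inftyP (K : R) : 0 <= K ->
  ('N[mu]_+oo[EFin \o (u \_ O)] <= K%:E)%E <->
  {ae mu, forall x, O x -> `|u x| <= K}.
Proof.
move=> K0; rewrite unlock.
have E1 x : (abse \o (EFin \o (u \_ O))) x = `|(u \_ O) x|%:E by [].
case: ifPn => [T0|]; last first.
  rewrite -leNgt => T0; split => _; last by rewrite lee_fin.
  exists setT; split => //.
  by apply/eqP; rewrite eq_le T0 measure_ge0.
split.
  move/ess_supP; apply: filterS => x; rewrite E1 lee_fin => h Ox.
  by rewrite patchE mem_set in h.
move=> h; apply/ess_supP; apply: filterS h => x h; rewrite E1 lee_fin patchE.
by case: ifPn => [|_]; [rewrite inE|rewrite normr0].
Qed.

Lemma Lnorm_le_level (K : R) : 0 <= K -> mu (superlevel O u K) = 0%E ->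
  ('N[mu]_+oo[EFin \o (u \_ O)] <= K%:E)%E.
Proof.
move=> K0 A0; apply/(Lnorm_inftyP K0).
exists (superlevel O u K); split => //.
  exact: measurable_superlevel.
move=> x /= /not_implyP[Ox /negP]; rewrite -ltNge => h.
by split => //=; exact: ltW.
Qed.

Lemma truncation_growth (f : T -> R -> R) (k m theta q : R) :
  0 <= k -> 0 <= m ->
  measurable_fun O (fun x => f x (u x) * (u x - trunc k (u x))) ->
  {ae mu, forall x, O x ->
    forall t, Num.sg t * f x t <= m * (`|t| + theta) `^ (q - 1)} ->
  (\int[mu]_(x in O) (f x (u x) * (u x - trunc k (u x)))%:E <=
   \int[mu]_(x in superlevel O u k)
     (m * (`|u x| + theta) `^ (q - 1) * (`|u x| - k))%:E)%E.
Proof.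
move=> k0 m0 mF sg_le; pose F x := (f x (u x) * (u x - trunc k (u x)))%:E.
pose g x := (m * (`|u x| + theta) `^ (q - 1) * (`|u x| - k))%:E.
have mau : measurable_fun O (fun x => `|u x|) by exact: measurableT_comp.
have mg : measurable_fun O g.
  apply/measurable_EFinP; apply: measurable_funM; last exact: measurable_funB.
  apply: measurable_funM; first exact: measurable_cst.
  apply/measurable_EFinP; apply: measurable_powR_fun; exact: measurable_funD.
have mS := measurable_superlevel mO k mu_.
have mFE : measurable_fun O F by exact/measurable_EFinP.
apply: (@le_trans _ _ (\int[mu]_(x in O) F^\+ x)%E).
  rewrite integralE geeDl// oppe_le0; apply: integral_ge0 => x _.
  exact: funeneg_ge0.
have -> : (\int[mu]_(x in superlevel O u k) g x =
    \int[mu]_(x in O) (g \_ (superlevel O u k)) x)%E.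
  by rewrite -integral_mkcondr /superlevel setIA setIid.
apply: ae_ge0_le_integral => //.
- exact: measurable_funepos.
- move=> x _; rewrite patchE; case: ifPn => //; rewrite inE => -[_ /= kx].
  by rewrite lee_fin !mulr_ge0 ?powR_ge0// subr_ge0.
- apply/(measurable_restrict _ mS mO).
  by apply: measurable_funS mg => // x [].
apply: filterS sg_le => x h Ox; have {}h := h Ox (u x).
rewrite funeposE ge_max patchE; case: ifPn => [|]; last first.
  rewrite notin_setE => nS; rewrite lexx andbT /F truncE//.
  have uk : `|u x| <= k by rewrite leNgt; apply/negP => /ltW ku; apply: nS.
  by rewrite uk subrr mulr0.
rewrite inE => -[_ /= kx].
have g0 : (0 <= g x)%E by rewrite lee_fin !mulr_ge0 ?powR_ge0// subr_ge0.
rewrite g0 andbT /F truncE//; case: ifPn => [uk|uk].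
  by rewrite subrr mulr0.
rewrite lee_fin [X in _ * (X - _)]numEsg -mulrBr mulrA (mulrC (f x (u x))).
by rewrite ler_wpM2r// subr_ge0.
Qed.

End essential_bound.

(** * The constant *)

Section constant.
Variables (R : realType) (N : nat).

(** The inverse of the exponent N + q - qN/p of M in [sup_power_bound]. *)
Definition scaling_exponent (z : R * R) : R :=
  z.1 / (z.1 * z.2 + (z.1 - z.2) * N%:R).

(** The power [scaling_exponent] of the constant of [sup_power_bound], written
    with an exponential so that its continuity in (p, q) is visible. *)
Definition bound_constant (z : R * R) : R :=
  expR (scaling_exponent z * (ln 2 * (z.2 + z.2 * N%:R / z.1) +
    N%:R * ln (2 `^ (3 + N%:R) * N%:R))).

Lemma exponent_domain_denominator (p q : R) : (0 < N)%N ->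
  1 <= p -> 1 <= q -> lt_pstar N p q%:E -> 0 < p * q + (p - q) * N%:R.
Proof.
move=> N0 p1 q1; have NR0 : 0 < N%:R :> R by rewrite ltr0n.
have p0 : 0 < p by lra.
rewrite /lt_pstar; case: ifPn => [pN|].
  rewrite lte_fin /sobolev_conjugate ltr_pdivlMr ?subr_gt0// => h.
  by rewrite mulrBl; have := h; lra.
rewrite -leNgt => Np _.
have h1 : 0 < p * N%:R by rewrite mulr_gt0.
have h2 : N%:R * q <= p * q by rewrite ler_wpM2r//; lra.
by rewrite mulrBl; have := h1; have := h2; lra.
Qed.

Lemma continuous_bound_constant : (0 < N)%N ->
  {within exponent_domain N, continuous bound_constant}.
Proof.
move=> N0; apply: continuous_in_subspaceT => z.
rewrite inE => -[z1 z2 zs].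
have h := exponent_domain_denominator N0 z1 z2 zs.
have p0 : z.1 != 0 by rewrite gt_eqF//; lra.
have c1 : {for z, continuous (fun z : R * R => z.1)} by exact: cvg_fst.
have c2 : {for z, continuous (fun z : R * R => z.2)} by exact: cvg_snd.
rewrite /bound_constant; apply: continuous_comp; last exact: continuous_expR.
apply: cvgM.
  apply: cvgM => //; apply: cvgV; first by rewrite gt_eqF.
  apply: cvgD; first exact: cvgM.
  apply: cvgM; last exact: cvg_cst.
  exact: cvgB.
apply: cvgD; last exact: cvg_cst.
apply: cvgM; first exact: cvg_cst.
apply: cvgD => //; apply: cvgM; last exact: cvgV.
by apply: cvgM => //; exact: cvg_cst.
Qed.

Lemma bound_constantE (p q : R) : (0 < N)%N ->
  bound_constant (p, q) =
  (2 `^ (q + q * N%:R / p) * (2 `^ (3 + N%:R) * N%:R) `^ N%:R)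
    `^ scaling_exponent (p, q).
Proof.
move=> N0; have G0 : 0 < 2 `^ (3 + N%:R) * N%:R :> R.
  by rewrite mulr_gt0 ?powR_gt0 ?ltr0n.
set W := _ * _ `^ N%:R; have W0 : 0 < W by rewrite mulr_gt0 ?powR_gt0.
have -> : W `^ scaling_exponent (p, q) = expR (scaling_exponent (p, q) * ln W).
  by rewrite /powR gt_eqF.
rewrite /bound_constant /=; congr (expR (_ * _)).
rewrite /W [RHS]lnM ?posrE; [|exact: powR_gt0|exact: powR_gt0].
by rewrite !(ln_powR _ N%:R) ln_powR (mulrC (ln 2)).
Qed.

Lemma sup_bound_of_power_bound (p q M c m I : R) : (0 < N)%N -> 0 < M -> 0 <= I ->
  1 <= p -> 1 <= q -> lt_pstar N p q%:E ->
  M `^ (N%:R + q - q * N%:R / p) <=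
  2 `^ (q + q * N%:R / p) * (2 `^ (3 + N%:R) * N%:R) `^ N%:R *
  ((m / c) `^ (N%:R / p) * I) ->
  M <= bound_constant (p, q) *
       ((m / c) `^ (N%:R / p) * I) `^ (p / (p * q + (p - q) * N%:R)).
Proof.
move=> N0 M0 I0 p1 q1 qs h.
have den := exponent_domain_denominator N0 p1 q1 qs.
have p0 : 0 < p by lra.
rewrite bound_constantE// /scaling_exponent /=.
set ep := p / _; have ep0 : 0 < ep by rewrite divr_gt0.
have X0 : 0 <= (m / c) `^ (N%:R / p) * I by rewrite mulr_ge0 ?powR_ge0.
have W0 : 0 <= 2 `^ (q + q * N%:R / p) * (2 `^ (3 + N%:R) * N%:R) `^ N%:R :> R.
  by rewrite mulr_ge0 ?powR_ge0.
rewrite -(powRM _ W0 X0).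
have ME : M = (M `^ (N%:R + q - q * N%:R / p)) `^ ep.
  rewrite -powRrM (_ : _ * ep = 1) ?powRr1 ?(ltW M0)//.
  by rewrite /ep; field; rewrite !gt_eqF.
by rewrite {1}ME; apply: le_powR2 h; [exact: ltW|exact: powR_ge0].
Qed.

End constant.

(** * From level sets to boundedness *)

Section level_iteration.
Context {d} {T : measurableType d} {R : realType}.
Variable mu : {measure set T -> \bar R}.
Variables (O : set T) (u s : T -> R) (p : R) (N : nat).
Hypotheses (mO : measurable O) (fO : (mu O < +oo)%E).
Hypotheses (mu_ : measurable_fun O u) (ms : measurable_fun O s).
Hypotheses (s0 : forall x, 0 <= s x) (p1 : 1 <= p) (N0 : (0 < N)%N).
Hypothesis sp : (\int[mu]_(x in O) (s x `^ p)%:E < +oo)%E.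
Hypothesis level_gap : forall k h b, 0 <= k -> k <= h -> 0 < b ->
  (mu (superlevel O u h) < (b ^+ N)%:E)%E ->
  ((h - k)%:E * mu (superlevel O u h) <=
   b%:E * (N%:R%:E * \int[mu]_(x in level O u k h) (s x)%:E))%E.

Let p0 : 0 < p. Proof. exact: lt_le_trans p1. Qed.
Let N0R : 0 < N%:R :> R. Proof. by rewrite ltr0n. Qed.

Definition level_measure k := fine (mu (superlevel O u k)).
Definition level_energy k :=
  fine (\int[mu]_(x in superlevel O u k) (s x `^ p)%:E)%E.
Definition strip_energy k h :=
  fine (\int[mu]_(x in level O u k h) (s x `^ p)%:E)%E.

Local Notation al := level_measure.
Local Notation D := level_energy.
Local Notation ds := strip_energy.

Let mA k := measurable_superlevel mO k mu_.
Let mL k h := measurable_level mO k h mu_.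
Let AO k : superlevel O u k `<=` O. Proof. exact: subIsetl. Qed.
Let LO k h : level O u k h `<=` O. Proof. exact: subIsetl. Qed.
Let LA k h : level O u k h `<=` superlevel O u k.
Proof. by move=> x [Ox /= /andP[]]. Qed.
Let AA k h : k <= h -> superlevel O u h `<=` superlevel O u k.
Proof. by move=> kh x [Ox /= hx]; split => //=; exact: le_trans hx. Qed.

Let msp : measurable_fun O (fun x => (s x `^ p)%:E).
Proof. exact: measurable_powR_fun. Qed.

Let sub_fin (B : set T) : measurable B -> B `<=` O -> mu B \is a fin_num.
Proof.
move=> mB BO; rewrite ge0_fin_numE//; apply: le_lt_trans fO.
by apply: le_measure; rewrite ?inE.
Qed.

Let int_fin (B : set T) : measurable B -> B `<=` O ->
  (\int[mu]_(x in B) (s x `^ p)%:E)%E \is a fin_num.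
Proof.
move=> mB BO; rewrite ge0_fin_numE//; last first.
  by apply: integral_ge0 => x _; rewrite lee_fin powR_ge0.
apply: le_lt_trans sp; apply: ge0_subset_integral => //.
by move=> x _; rewrite lee_fin powR_ge0.
Qed.

Lemma level_measureE k : mu (superlevel O u k) = (al k)%:E.
Proof. by rewrite fineK// sub_fin. Qed.

Lemma level_energyE k :
  (\int[mu]_(x in superlevel O u k) (s x `^ p)%:E)%E = (D k)%:E.
Proof. by rewrite fineK// int_fin. Qed.

Lemma strip_energyE k h :
  (\int[mu]_(x in level O u k h) (s x `^ p)%:E)%E = (ds k h)%:E.
Proof. by rewrite fineK// int_fin. Qed.

Lemma level_measure_ge0 k : 0 <= al k. Proof. exact: fine_ge0. Qed.

Lemma level_energy_ge0 k : 0 <= D k.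
Proof. by apply: fine_ge0; apply: integral_ge0 => x _; rewrite lee_fin powR_ge0. Qed.

Lemma strip_energy_ge0 k h : 0 <= ds k h.
Proof. by apply: fine_ge0; apply: integral_ge0 => x _; rewrite lee_fin powR_ge0. Qed.

Lemma level_measure_le : {homo al : x y /~ x <= y}.
Proof.
move=> x y xy; rewrite -lee_fin -!level_measureE.
by apply: le_measure; rewrite ?inE//; exact: AA.
Qed.

Lemma level_energy_le : {homo D : x y /~ x <= y}.
Proof.
move=> x y xy; rewrite -lee_fin -!level_energyE.
apply: ge0_subset_integral => //; last exact: AA.
- by apply: measurable_funS msp.
- by move=> z _; rewrite lee_fin powR_ge0.
Qed.

Lemma strip_energy_le k h : ds k h <= D k.
Proof.
rewrite -lee_fin -strip_energyE -level_energyE.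
apply: ge0_subset_integral => //.
- by apply: measurable_funS msp.
- by move=> z _; rewrite lee_fin powR_ge0.
Qed.

Lemma strip_energyD k h h' : k <= h -> h < h' -> ds k h + D h' <= D k.
Proof.
move=> kh hh'; rewrite -lee_fin EFinD -strip_energyE -!level_energyE.
rewrite -ge0_integral_setU//=.
- apply: ge0_subset_integral => //; first exact: measurableU.
  + by apply: measurable_funS msp.
  + by move=> z _; rewrite lee_fin powR_ge0.
  + rewrite subUset; split; first exact: LA.
    by apply: AA; rewrite (le_trans kh)// ltW.
- by apply: measurable_funS msp => //; rewrite subUset; split.
- by move=> z _; rewrite lee_fin powR_ge0.
- apply/disj_setPS => x [[_ /= /andP[_ xh]] [_ /= xh']].
  by have := le_lt_trans xh hh'; rewrite ltNge xh'.
Qed.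

(** The gap inequality for the best b, slightly larger than a(k)^(1/N), and
    for the best l in the splitting of int |Du| over the strip, namely
    (d(k, h) / a(k))^(1/p). *)
Lemma level_measure_step k h : 0 <= k -> k <= h ->
  (h - k) * al h <= 2 * N%:R * al k `^ (1 + N%:R^-1 - p^-1) * ds k h `^ p^-1.
Proof.
move=> k0 kh.
have RHS0 : 0 <= 2 * N%:R * al k `^ (1 + N%:R^-1 - p^-1) * ds k h `^ p^-1.
  by rewrite !mulr_ge0 ?powR_ge0.
have [ah0|ah0] := eqVneq (al h) 0; first by rewrite ah0 mulr0.
have {}ah0 : 0 < al h by rewrite lt_neqAle eq_sym ah0 level_measure_ge0.
have ak0 : 0 < al k by apply: lt_le_trans (level_measure_le kh).
have step1 b l : al h < b ^+ N -> 0 < b -> 0 < l ->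
    (h - k) * al h <= b * (N%:R * (l * al k + l `^ (1 - p) * ds k h)).
  move=> ab b0 l0; rewrite -lee_fin.
  have abE : (mu (superlevel O u h) < (b ^+ N)%:E)%E.
    by rewrite level_measureE lte_fin.
  have := level_gap k0 kh b0 abE; rewrite level_measureE -EFinM.
  move=> /le_trans; apply; rewrite !EFinM !lee_wpmul2l ?lee_fin ?(ltW b0)//.
  have msL : measurable_fun (level O u k h) s by exact: measurable_funS ms.
  apply: (le_trans (integral_le_split mu (mL k h) msL (fun x _ => s0 x) p1 l0)).
  rewrite strip_energyE EFinD !EFinM leeD//.
  rewrite lee_wpmul2l ?lee_fin ?(ltW l0)// -level_measureE.
  by apply: le_measure; rewrite ?inE//; exact: LA.
have step2 b : al h < b ^+ N -> 0 < b ->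
    (h - k) * al h <= b * (N%:R * (2 * ds k h `^ p^-1 * al k `^ (1 - p^-1))).
  move=> ab b0; have [d0|d0] := eqVneq (ds k h) 0.
    rewrite d0 powR0 ?invr_eq0 ?gt_eqF// mulr0 mul0r !mulr0.
    apply/ler_addgt0Pr => e e0; rewrite add0r.
    pose l := e / (b * N%:R * al k).
    have l0 : 0 < l by rewrite divr_gt0// !mulr_gt0.
    have := step1 b l ab b0 l0; rewrite d0 mulr0 addr0 /l => /le_trans; apply.
    rewrite le_eqVlt; apply/orP; left; apply/eqP; field.
    by rewrite !gt_eqF.
  have {}d0 : 0 < ds k h by rewrite lt_neqAle eq_sym d0 strip_energy_ge0.
  pose l := (ds k h / al k) `^ p^-1.
  have l0 : 0 < l by rewrite powR_gt0// divr_gt0.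
  have aV x : (al k)^-1 `^ x = al k `^ (- x).
    by rewrite -(powR_inv1 (ltW ak0)) -powRrM mulN1r.
  have lE x : l `^ x = ds k h `^ (p^-1 * x) * al k `^ (- (p^-1 * x)).
    by rewrite /l -powRrM powRM ?invr_ge0 ?(ltW d0) ?(ltW ak0)// aV.
  have E1 : l * al k = ds k h `^ p^-1 * al k `^ (1 - p^-1).
    rewrite -(powRr1 (ltW l0)) lE mulr1 -mulrA; congr (_ * _).
    rewrite -{2}(powRr1 (ltW ak0)) -powRD ?(gt_eqF ak0) ?implybT//.
    by rewrite addrC.
  have E2 : l `^ (1 - p) * ds k h = ds k h `^ p^-1 * al k `^ (1 - p^-1).
    rewrite lE -{2}(powRr1 (ltW d0)) mulrAC -powRD ?(gt_eqF d0) ?implybT//.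
    by congr (_ `^ _ * _ `^ _); field; rewrite gt_eqF.
  have := step1 b l ab b0 l0; rewrite E1 E2 => /le_trans; apply.
  rewrite !ler_wpM2l ?(ltW b0)//; lra.
pose b0 := al k `^ N%:R^-1.
have b00 : 0 < b0 by rewrite powR_gt0.
have b0N : b0 ^+ N = al k.
  by rewrite -powR_mulrn ?powR_ge0// -powRrM mulVf ?gt_eqF// powRr1// ltW.
have aE : al k `^ (1 + N%:R^-1 - p^-1) = b0 * al k `^ (1 - p^-1).
  by rewrite /b0 -powRD ?(gt_eqF ak0) ?implybT//; congr (_ `^ _); ring.
set X := 2 * ds k h `^ p^-1 * al k `^ (1 - p^-1).
have X0 : 0 <= X by rewrite !mulr_ge0 ?powR_ge0.
rewrite aE (_ : _ * _ * _ = b0 * (N%:R * X)); last by rewrite /X; ring.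
apply/ler_addgt0Pr => e e0.
(* The measure has to be strictly below b^N, hence the small excess t over b0. *)
pose t := e / (N%:R * X + 1).
have NX1 : 0 < N%:R * X + 1 by rewrite ltr_wpDl// mulr_ge0.
have t0 : 0 < t by rewrite divr_gt0.
have h1 : al h < (b0 + t) ^+ N.
  apply: (le_lt_trans (level_measure_le kh)); rewrite -b0N.
  by rewrite ltr_pXn2r ?nnegrE ?(ltW b00) ?addr_ge0 ?(ltW t0) ?(ltW b00)// ltrDl.
apply: (le_trans (step2 _ h1 (addr_gt0 b00 t0))).
rewrite mulrDl lerD2l /t mulrAC ler_pdivrMr//.
by rewrite ler_wpM2l ?(ltW e0)// lerDl.
Qed.

Lemma abs_moment_ge0 (B : set T) (r : R) :
  (0 <= \int[mu]_(x in B) (`|u x| `^ r)%:E)%E.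
Proof. by apply: integral_ge0 => x _; rewrite lee_fin powR_ge0. Qed.

Let mur (r : R) : measurable_fun O (fun x => (`|u x| `^ r)%:E).
Proof. by apply: measurable_powR_fun; exact: measurableT_comp. Qed.

Lemma chebyshev_level (k r : R) : 0 <= k -> 0 <= r ->
  ((k `^ r * al k)%:E <= \int[mu]_(x in superlevel O u k) (`|u x| `^ r)%:E)%E.
Proof.
move=> k0 r0; rewrite EFinM -level_measureE -integral_cst; last exact: mA.
apply: ge0_le_integral => //.
- by move=> x _; rewrite lee_fin powR_ge0.
- by apply: measurable_funS (mur r).
- by move=> x [Ox /= kx]; rewrite lee_fin le_powR2.
Qed.

(** Dyadic decomposition of the range of |u|. *)
Lemma moment_series (j : nat) (r : R) : 0 <= r ->
  (\int[mu]_(x in superlevel O u (2 ^+ j)) (`|u x| `^ r)%:E <=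
   \sum_(i <oo) (2 `^ r * ((2 ^+ (j + i)) `^ r * al (2 ^+ (j + i))))%:E)%E.
Proof.
move=> r0; pose c i : R := 2 `^ r * (2 ^+ (j + i)) `^ r.
have c0 i : 0 <= c i by rewrite mulr_ge0 ?powR_ge0.
pose g i (x : T) : \bar R := (c i * \1_(superlevel O u (2 ^+ (j + i))) x)%:E.
have g0 i x : (0 <= g i x)%E by rewrite lee_fin mulr_ge0.
have mg i : measurable_fun setT (g i).
  apply/measurable_EFinP; apply: measurable_funM; first exact: measurable_cst.
  by apply: measurable_indic; exact: mA.
have -> : (\sum_(i <oo) (2 `^ r * ((2 ^+ (j + i)) `^ r * al (2 ^+ (j + i))))%:E =
    \int[mu]_x \sum_(i <oo) g i x)%E.
  rewrite integral_nneseries//; apply: eq_eseriesr => i _.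
  have m1 : measurable_fun setT
      (fun x => (\1_(superlevel O u (2 ^+ (j + i))) x)%:E : \bar R).
    by apply/measurable_EFinP; apply: measurable_indic; exact: mA.
  have n1 (x : T) : setT x -> (0 <= (\1_(superlevel O u (2 ^+ (j + i))) x)%:E :> \bar R)%E.
    by rewrite lee_fin.
  have cE : (0 <= (c i)%:E)%E by rewrite lee_fin.
  have := ge0_integralZl mu measurableT m1 n1 cE.
  rewrite integral_indic ?setIT//.
  by rewrite level_measureE -EFinM /c -mulrA => <-.
rewrite integral_mkcond; apply: ge0_le_integral => //.
- by move=> x _; apply: erestrict_ge0 => y _; rewrite lee_fin powR_ge0.
- by apply/(measurable_restrictT _ (mA _)); exact: measurable_funS (mur r).
- by apply: ge0_emeasurable_sum.
move=> x _; rewrite patchE; case: ifPn => [|_]; last first.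
  by apply: nneseries_ge0 => i _ _; exact: g0.
rewrite inE => -[Ox /= jx].
have ex : exists i, `|u x| < 2 ^+ (j + i).+1.
  have [n un] : exists n : nat, `|u x| < n%:R.
    by exists (Num.bound `|u x|); rewrite archi_boundP.
  exists n; apply: (lt_le_trans un); rewrite -natrX ler_nat.
  by rewrite (leq_trans (ltnW (ltn_expl n (ltnSn 1))))// leq_exp2l// leqW// leq_addl.
have := ex_minnP ex => -[i iu imin].
have ui : 2 ^+ (j + i) <= `|u x|.
  case: i iu imin => [|i] iu imin; first by rewrite addn0.
  rewrite leNgt; apply/negP; rewrite addnS => h.
  by have := imin i h; rewrite ltnn.
apply: (@le_trans _ _ (g i x)).
  rewrite /g indicE mem_set//= mulr1 lee_fin /c -powRM ?exprn_ge0//.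
  by rewrite le_powR2// -exprS ltW.
apply: (@le_trans _ _ (\sum_(0 <= n < i.+1) g n x)%E).
  by rewrite big_nat_recr//= leeDr// sume_ge0.
by apply: nneseries_lim_ge.
Qed.

Lemma series_le (a : nat -> R) (B : R) : (forall i, 0 <= a i) ->
  (forall n, \sum_(0 <= i < n) a i <= B) -> (\sum_(i <oo) (a i)%:E <= B%:E)%E.
Proof.
move=> a0 aB; apply: lime_le.
  by apply: is_cvg_nneseries => i _ _; rewrite lee_fin.
by apply: nearW => n; rewrite sumEFin lee_fin.
Qed.

Definition rapid_decay := forall m : nat, exists K : R, forall j,
  2 ^+ (j * m)%N * al (2 ^+ j) <= K.

Lemma moments_of_rapid_decay (r : R) : rapid_decay -> 0 <= r ->
  (\int[mu]_(x in superlevel O u 1) (`|u x| `^ r)%:E < +oo)%E.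
Proof.
move=> dec r0; pose m := (Num.bound r).
have rm : r <= m%:R by apply: ltW; rewrite archi_boundP.
have [K HK] := dec m.+1.
have K0 : 0 <= K by apply: le_trans (HK 0%N); rewrite mulr_ge0 ?level_measure_ge0.
have := moment_series 0 r0; rewrite expr0 => /le_lt_trans; apply.
apply: (@le_lt_trans _ _ (2 `^ r * (K * 2))%:E); last exact: ltry.
apply: series_le => [i|n].
  by rewrite !mulr_ge0 ?powR_ge0// level_measure_ge0.
rewrite -mulr_sumr ler_wpM2l ?powR_ge0//.
have term i : (2 ^+ i) `^ r * al (2 ^+ i) <= K * (2^-1) ^+ i.
  rewrite -(@ler_pM2l _ (2 ^+ i)) ?exprn_gt0//.
  have -> : 2 ^+ i * (K * 2^-1 ^+ i) = K.
    by rewrite mulrCA -exprMn divff// expr1n mulr1.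
  apply: le_trans (HK i); rewrite mulrA ler_wpM2r ?level_measure_ge0//.
  rewrite mulnS exprD ler_wpM2l ?exprn_ge0// exprM -[leRHS]powR_mulrn ?exprn_ge0//.
  by rewrite ler_powR// exprn_ege1// ler1n.
apply: (@le_trans _ _ (K * \sum_(0 <= i < n) 2^-1 ^+ i)).
  by rewrite mulr_sumr; apply: ler_sum => i _; rewrite add0n.
rewrite ler_wpM2l//.
have -> : \sum_(0 <= i < n) 2^-1 ^+ i = 2 - 2 * 2^-1 ^+ n :> R.
  elim: n => [|n IH]; first by rewrite big_geq// expr0; lra.
  by rewrite big_nat_recr//= IH exprS; field.
by rewrite gerBl mulr_ge0// exprn_ge0.
Qed.

(** For p > N the exponent 1 + 1/N - 1/p of [level_measure_step] exceeds 1. *)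
Lemma bounded_supercritical : N%:R < p -> exists K, al K = 0.
Proof.
move=> Np; pose e := N%:R^-1 - p^-1.
have e0 : 0 < e by rewrite subr_gt0 ltf_pV2.
pose B := 2 * N%:R * D 0 `^ p^-1.
have B0 : 0 <= B by rewrite !mulr_ge0 ?powR_ge0.
pose t := 2 `^ (1 + e^-1) * B * al 0 `^ e.
have t0 : 0 <= t by rewrite !mulr_ge0 ?powR_ge0.
exists (0 + (t + 1)); apply: (@stampacchia _ al 0 B e) => //.
- exact: level_measure_ge0.
- exact: level_measure_le.
- by rewrite ltr_wpDl.
- move=> k h k0 kh; apply: (le_trans (level_measure_step k0 (ltW kh))).
  have -> : 1 + N%:R^-1 - p^-1 = 1 + e by rewrite /e addrA.
  have NN0 : 0 <= 2 * N%:R :> R by rewrite mulr_ge0.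
  rewrite /B [leRHS]mulrAC ler_wpM2l; [by []|by rewrite mulr_ge0// powR_ge0|].
  rewrite le_powR2 ?invr_ge0 ?(ltW p0) ?strip_energy_ge0//.
  by rewrite (le_trans (strip_energy_le _ _))// level_energy_le.
- by rewrite lerDl.
Qed.

(** Splitting |u|^q <= l + l^(1-M) |u|^(qM) and optimising over l gives
    D(k) <= C2 a(k)^(1 - 1/M). With M = N + 1 the exponent of a(k) in
    [level_measure_step] becomes 1 + 1/N - 1/(M p), which exceeds 1. *)
Lemma bounded_of_moments (C1 k1 q : R) : 0 <= C1 -> 1 <= k1 -> 0 <= q ->
  (forall r, 0 <= r ->
    (\int[mu]_(x in superlevel O u 1) (`|u x| `^ r)%:E < +oo)%E) ->
  (forall k, k1 <= k -> ((D k)%:E <= C1%:E *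
     \int[mu]_(x in superlevel O u k) (`|u x| `^ q)%:E)%E) ->
  exists K, al K = 0.
Proof.
move=> C10 k11 q0 mom HD.
pose M : R := N%:R + 1.
have M1 : 1 <= M by rewrite lerDr.
have M0 : 0 < M by lra.
pose Z := fine (\int[mu]_(x in superlevel O u 1) (`|u x| `^ (q * M))%:E)%E.
have ZE : (\int[mu]_(x in superlevel O u 1) (`|u x| `^ (q * M))%:E)%E = Z%:E.
  rewrite fineK; first by [].
  rewrite ge0_fin_numE; last exact: abs_moment_ge0.
  by apply: mom; rewrite mulr_ge0// ltW.
have Z0 : 0 <= Z by apply: fine_ge0; exact: abs_moment_ge0.
pose e := N%:R^-1 - (M * p)^-1.
have e0 : 0 < e.
  rewrite subr_gt0 ltf_pV2 ?posrE ?mulr_gt0//.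
  by apply: (@lt_le_trans _ _ M); [rewrite ltrDl|rewrite ler_peMr// ltW].
pose C2 := C1 * (1 + Z).
have C20 : 0 <= C2 by rewrite mulr_ge0// addr_ge0.
have Dk k : k1 <= k -> D k <= C2 * al k `^ (1 - M^-1).
  move=> kk; have k1' : 1 <= k by exact: le_trans kk.
  have [a0|a0] := eqVneq (al k) 0.
    have D0 : D k = 0.
      rewrite /level_energy null_set_integral//.
      - by apply: measurable_funS msp.
      - by rewrite level_measureE a0.
    by rewrite D0 mulr_ge0// powR_ge0.
  have {}a0 : 0 < al k by rewrite lt_neqAle eq_sym a0 level_measure_ge0.
  rewrite -lee_fin; apply: (le_trans (HD k kk)).
  rewrite /C2 -mulrA EFinM lee_wpmul2l ?lee_fin//.
  (* The value that balances the two terms of the splitting. *)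
  pose l := al k `^ (- M^-1).
  have l0 : 0 < l by rewrite powR_gt0.
  have muq : measurable_fun (superlevel O u k) (fun x => `|u x| `^ q).
    by apply/measurable_EFinP; apply: measurable_funS (mur q).
  apply: (le_trans (integral_le_split mu (mA k) muq (fun x _ => powR_ge0 _ _) M1 l0)).
  apply: (@le_trans _ _ (l%:E * (al k)%:E + (l `^ (1 - M))%:E * Z%:E)%E).
    rewrite level_measureE leeD2l// lee_wpmul2l ?lee_fin ?powR_ge0// -ZE.
    under eq_integral do rewrite -powRrM.
    apply: ge0_subset_integral; [exact: mA|exact: mA| | |exact: AA].
    - by apply: measurable_funS (mur _).
    - by move=> x _; rewrite lee_fin powR_ge0.
  have E1 : l * al k = al k `^ (1 - M^-1).
    rewrite /l -{2}(powRr1 (ltW a0)) -powRD ?(gt_eqF a0) ?implybT//.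
    by rewrite addrC.
  have E2 : l `^ (1 - M) = al k `^ (1 - M^-1).
    by rewrite /l -powRrM; congr (_ `^ _); field; rewrite gt_eqF.
  by rewrite -!EFinM -EFinD lee_fin E1 E2 mulrDl mul1r mulrC.
pose B := 2 * N%:R * C2 `^ p^-1.
have B0 : 0 <= B by rewrite !mulr_ge0 ?powR_ge0.
pose t := 2 `^ (1 + e^-1) * B * al k1 `^ e.
have t0 : 0 <= t by rewrite !mulr_ge0 ?powR_ge0.
exists (k1 + (t + 1)); apply: (@stampacchia _ al k1 B e) => //.
- exact: level_measure_ge0.
- exact: level_measure_le.
- by rewrite ltr_wpDl.
- move=> k h kk kh; have k0 : 0 <= k by lra.
  apply: (le_trans (level_measure_step k0 (ltW kh))).
  rewrite /B -!mulrA !ler_wpM2l//.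
  apply: (@le_trans _ _ (al k `^ (1 + N%:R^-1 - p^-1) *
      (C2 * al k `^ (1 - M^-1)) `^ p^-1)).
    apply: ler_wpM2l; first exact: powR_ge0.
    apply: le_powR2; [by rewrite invr_ge0 ltW|exact: strip_energy_ge0|].
    exact: le_trans (strip_energy_le _ _) (Dk k kk).
  rewrite powRM ?powR_ge0// mulrCA ler_wpM2l ?powR_ge0//.
  have [a0|a0] := eqVneq (al k) 0.
    have pV1 : p^-1 <= 1 by rewrite invf_le1.
    have NV0 : 0 < N%:R^-1 :> R by rewrite invr_gt0.
    rewrite a0 powR0 ?mul0r ?powR_ge0// gt_eqF//; lra.
  rewrite -powRrM -powRD ?a0 ?implybT//.
  rewrite le_eqVlt; apply/orP; left; apply/eqP; congr (_ `^ _).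
  by rewrite /e; field; rewrite !gt_eqF.
- by rewrite lerDl.
Qed.

Let pow2_le (i j : nat) : (i <= j)%N -> 2 ^+ i <= 2 ^+ j :> R.
Proof. by move=> ij; rewrite ler_weXn2l// ler1n. Qed.

Let natr_lt_pow2 (n : nat) : n%:R < 2 ^+ n :> R.
Proof. by rewrite -natrX ltr_nat ltn_expl. Qed.

Let pow2_step (n : nat) : 2 ^+ n.+1 - 2 ^+ n = 2 ^+ n :> R.
Proof. by rewrite exprS; lra. Qed.

(** For p = N the exponent of a(k) is exactly 1, and the gap 2^j between
    consecutive dyadic levels produces a factor 2^-j. *)
Lemma rapid_decay_borderline : p = N%:R -> rapid_decay.
Proof.
move=> pN; pose Y j := al (2 ^+ j).
have Y0 j : 0 <= Y j by exact: level_measure_ge0.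
have Yle j : Y j.+1 <= Y j by apply: level_measure_le; exact: pow2_le.
apply: (fast_decay Y0 Yle) => m.
pose C := 2 * N%:R * D 0 `^ p^-1.
have [j1 Cj] : exists j1 : nat, 2 ^+ m * C < 2 ^+ j1.
  exists (Num.bound (2 ^+ m * C)); apply: lt_trans (natr_lt_pow2 _).
  by rewrite archi_boundP// !mulr_ge0 ?exprn_ge0 ?powR_ge0.
exists j1 => j jj.
have step : 2 ^+ j * Y j.+1 <= C * Y j.
  have := @level_measure_step (2 ^+ j) (2 ^+ j.+1) (exprn_ge0 _ (ler0n _ 2))
    (pow2_le (leqnSn j)).
  rewrite pow2_step => /le_trans; apply.
  have -> : 1 + N%:R^-1 - p^-1 = 1 :> R by rewrite pN addrK.
  rewrite powRr1 ?level_measure_ge0// /C -/(Y j).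
  rewrite (_ : 2 * N%:R * D 0 `^ p^-1 * Y j = 2 * N%:R * Y j * D 0 `^ p^-1);
    last by ring.
  apply: ler_wpM2l; first by rewrite !mulr_ge0.
  apply: le_powR2; [by rewrite invr_ge0 ltW|exact: strip_energy_ge0|].
  apply: le_trans (strip_energy_le _ _) _; apply: level_energy_le.
  by rewrite exprn_ge0.
have pj : 0 < 2 ^+ j :> R by rewrite exprn_gt0.
rewrite -(ler_pM2l pj) mulrCA.
apply: (@le_trans _ _ (2 ^+ m * (C * Y j))).
  by rewrite ler_wpM2l// exprn_ge0.
rewrite mulrA ler_wpM2r// (le_trans (ltW Cj))//; exact: pow2_le.
Qed.

Section critical_growth.
Variables (C1 k1 : R).
Hypotheses (pN : p < N%:R) (C10 : 0 <= C1).
Let r := N%:R * p / (N%:R - p).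
Hypothesis energy_r : forall k, k1 <= k -> ((D k)%:E <= C1%:E *
     \int[mu]_(x in superlevel O u k) (`|u x| `^ r)%:E)%E.

Let Np0 : 0 < N%:R - p. Proof. by rewrite subr_gt0. Qed.
Let r0 : 0 < r. Proof. by rewrite divr_gt0// mulr_gt0. Qed.
Let rV : r^-1 = p^-1 - N%:R^-1.
Proof. by rewrite /r; field; rewrite !gt_eqF. Qed.
Let r1 : 1 < r.
Proof.
rewrite -invf_lt1// rV; have pV1 : p^-1 <= 1 by rewrite invf_le1.
by have NV0 : 0 < N%:R^-1 :> R; [rewrite invr_gt0|lra].
Qed.
Let rp : r / p = 1 + p / (N%:R - p).
Proof. by rewrite /r; field; rewrite !gt_eqF. Qed.

Let a n := (2 ^+ n) `^ r * al (2 ^+ n).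
Let dn n := ds (2 ^+ n) (2 ^+ n.+1).
Let Dn n := D (2 ^+ n).
Let K := 2 * N%:R * 2 `^ r.

Let a0 n : 0 <= a n.
Proof. by rewrite mulr_ge0 ?powR_ge0 ?level_measure_ge0. Qed.
Let K0 : 0 <= K. Proof. by rewrite !mulr_ge0 ?powR_ge0. Qed.

(** The gap inequality between 2^n and 2^(n+1), in terms of
    a_n = 2^(nr) a(2^n): the powers of 2 cancel since r is the critical exponent. *)
Let a_step n : a n.+1 <= K * dn n `^ p^-1 * a n `^ (1 - r^-1).
Proof.
have p2 : 0 < 2 ^+ n :> R by rewrite exprn_gt0.
have := @level_measure_step (2 ^+ n) (2 ^+ n.+1) (ltW p2) (pow2_le (leqnSn n)).
rewrite pow2_step (_ : 1 + N%:R^-1 - p^-1 = 1 - r^-1); last by rewrite rV; ring.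
rewrite -/(dn n) => h.
have aE : a n `^ (1 - r^-1) =
    (2 ^+ n) `^ (r - 1) * al (2 ^+ n) `^ (1 - r^-1).
  rewrite powRM ?powR_ge0 ?level_measure_ge0// -powRrM mulrBr mulr1.
  by rewrite divff ?gt_eqF.
have E1 : (2 ^+ n.+1) `^ r = 2 `^ r * ((2 ^+ n) `^ (r - 1) * 2 ^+ n).
  rewrite exprS powRM ?(ltW p2)//; congr (_ * _).
  by rewrite mulrC mulr_powRB1// ltW.
rewrite /a E1 aE /K.
have W0 : 0 <= 2 `^ r * (2 ^+ n) `^ (r - 1) by rewrite mulr_ge0 ?powR_ge0.
have := ler_wpM2l W0 h.
by rewrite [leLHS](_ : _ = 2 `^ r * ((2 ^+ n) `^ (r - 1) * 2 ^+ n) * al (2 ^+ n.+1));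
  [rewrite [leRHS](_ : _ = 2 * N%:R * 2 `^ r * dn n `^ p^-1 *
     ((2 ^+ n) `^ (r - 1) * al (2 ^+ n) `^ (1 - r^-1)))//; ring|ring].
Qed.

Let Y j := (\int[mu]_(x in superlevel O u (2 ^+ j)) (`|u x| `^ r)%:E)%E.

(** Sum [young_powR] over the dyadic levels from 2^j on. The halves of the a_n
    are absorbed; since r >= p, the powers d_n^(r/p) are at most
    d_n D_j^(r/p - 1), and the d_n add up to at most 2 D_j because
    d_n <= D_n - D_(n+2) telescopes. *)
Let Y_bound j : (Y j <=
  (2 `^ r * (2 * a j + 4 * (2 * K) `^ r * Dn j `^ (r / p)))%:E)%E.
Proof.
apply: (le_trans (moment_series j (ltW r0))).
apply: series_le => [i|J].
  by rewrite mulr_ge0 ?powR_ge0// a0.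
rewrite -mulr_sumr ler_wpM2l ?powR_ge0//.
pose S n := \sum_(0 <= i < n) a (j + i).
have S0 n : 0 <= S n by rewrite sumr_ge0.
have SE n : S n.+1 = a j + \sum_(0 <= i < n) a (j + i).+1.
  rewrite /S big_nat_recl// addn0; congr (_ + _).
  by apply: eq_bigr => i _; rewrite addnS.
have SS n : S n <= S n.+1 by rewrite /S big_nat_recr//= lerDl.
have Dj0 : 0 <= Dn j by exact: level_energy_ge0.
have rp1 : 0 <= r / p - 1.
  by rewrite rp addrC addKr divr_ge0 ?(ltW p0) ?(ltW Np0).
have rp0 : 0 < r / p by rewrite divr_gt0.
have d_le i : dn (j + i) `^ (r / p) <=
    (Dn (j + i) - Dn (j + i).+2) * Dn j `^ (r / p - 1).
  have d0 : 0 <= dn (j + i) by exact: strip_energy_ge0.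
  have dD : dn (j + i) <= Dn j.
    apply: (le_trans (strip_energy_le _ _)); apply: level_energy_le.
    by apply: pow2_le; rewrite leq_addr.
  rewrite -(mulr_powRB1 d0 rp0).
  apply: (ler_pM d0 (powR_ge0 _ _) _ (le_powR2 rp1 d0 dD)).
  rewrite lerBrDr; apply: strip_energyD; first exact: pow2_le.
  by rewrite ltr_eXn2l ?ltr1n.
have Dsum n : \sum_(0 <= i < n) (Dn (j + i) - Dn (j + i).+2) <= 2 * Dn j.
  have -> : \sum_(0 <= i < n) (Dn (j + i) - Dn (j + i).+2) =
      Dn j + Dn j.+1 - Dn (j + n) - Dn (j + n).+1.
    elim: n => [|n IH]; first by rewrite big_geq// addn0; ring.
    by rewrite big_nat_recr//= IH !addnS; ring.
  have h1 : Dn j.+1 <= Dn j by apply: level_energy_le; exact: pow2_le.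
  have h2 : 0 <= Dn (j + n) by exact: level_energy_ge0.
  have h3 : 0 <= Dn (j + n).+1 by exact: level_energy_ge0.
  by lra.
have dsum n : \sum_(0 <= i < n) dn (j + i) `^ (r / p) <= 2 * Dn j `^ (r / p).
  apply: (@le_trans _ _ (\sum_(0 <= i < n)
      (Dn (j + i) - Dn (j + i).+2) * Dn j `^ (r / p - 1))).
    by apply: ler_sum => i _; exact: d_le.
  rewrite -mulr_suml -(mulr_powRB1 Dj0 rp0) mulrA.
  by rewrite ler_wpM2r ?powR_ge0.
(* Each term after the first is bounded by half of its predecessor plus a strip term. *)
have half n : S n.+1 <= a j + S n / 2 + (2 * K) `^ r * (2 * Dn j `^ (r / p)).
  rewrite SE -addrA lerD2l.
  apply: (@le_trans _ _ (\sum_(0 <= i < n)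
      (a (j + i) / 2 + (2 * K) `^ r * dn (j + i) `^ (r / p)))).
    apply: ler_sum => i _; apply: (le_trans (a_step _)).
    by apply: young_powR => //; exact: strip_energy_ge0.
  rewrite big_split /= -mulr_suml lerD2l -mulr_sumr.
  by rewrite ler_wpM2l ?powR_ge0.
have := half J; have := SS J; rewrite -/(S J) => h1 h2.
have : S J <= a j + S J / 2 + (2 * K) `^ r * (2 * Dn j `^ (r / p)).
  exact: le_trans h1 h2.
rewrite (_ : 4 * (2 * K) `^ r * Dn j `^ (r / p) =
  2 * ((2 * K) `^ r * (2 * Dn j `^ (r / p)))); last by ring.
by lra.
Qed.

Let y j := fine (Y j).

Let YE j : Y j = (y j)%:E.
Proof.
rewrite /y fineK// ge0_fin_numE; last exact: abs_moment_ge0.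
exact: le_lt_trans (Y_bound j) (ltry _).
Qed.

Let y0 j : 0 <= y j. Proof. by apply: fine_ge0; exact: abs_moment_ge0. Qed.

Let y_le i j : (i <= j)%N -> y j <= y i.
Proof.
move=> ij; rewrite -lee_fin -!YE; apply: ge0_subset_integral.
- exact: mA.
- exact: mA.
- by apply: measurable_funS (mur r).
- by move=> x _; rewrite lee_fin powR_ge0.
- by apply: AA; exact: pow2_le.
Qed.

Let a_le n : a n <= y n.
Proof.
rewrite -lee_fin -YE; apply: chebyshev_level; last exact: ltW.
by rewrite exprn_ge0.
Qed.

Let y_cvg : y @ \oo --> 0.
Proof.
have mS := mA (2 ^+ 0).
have mur' : measurable_fun (superlevel O u (2 ^+ 0)) (fun x => `|u x| `^ r).
  by apply/measurable_EFinP; apply: measurable_funS (mur r).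
have mau : measurable_fun (superlevel O u (2 ^+ 0)) (fun x => `|u x|).
  by apply: measurableT_comp => //; exact: measurable_funS mu_.
have fin0 : (\int[mu]_(x in superlevel O u (2 ^+ 0)) (`|u x| `^ r)%:E < +oo)%E.
  by have := YE 0; rewrite /Y => ->; exact: ltry.
have tail := @integral_tail _ _ R mu _ _ _ mS mur' mau
  (fun x _ => powR_ge0 `|u x| r) fin0.
suff cY : Y @ \oo --> 0%:E by have [_] := (fine_cvgP _ _).1 cY.
apply: (squeeze_cvge _ (cvg_cst _) tail); apply: nearW => j.
rewrite abs_moment_ge0 /=; apply: ge0_subset_integral.
- exact: mA.
- have := @measurable_funS _ _ _ _ _ _ _ mO (@AO (2 ^+ 0)) mu_.
  move=> mu0; have := mau mS `]j%:R, +oo[%classic (measurable_itv _).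
  rewrite (_ : _ `&` _ = superlevel O u (2 ^+ 0) `&` [set x | j%:R < `|u x|])//.
  by apply/seteqP; split=> x /= [Ox]; rewrite in_itv /= andbT.
- by apply: measurable_funS (mur r) => // x [/AO].
- by move=> x _; rewrite lee_fin powR_ge0.
- move=> x [Ox /= ux]; split; first split => //=.
    by apply: le_trans ux; exact: pow2_le.
  by apply: lt_le_trans ux.
Qed.

(** By [Y_bound] at level j+1, with a_(j+1) estimated by [a_step] and D_j by
    C1 Y_j, the tail moment Y satisfies Y_(j+1) <= C Y_j^(1 + 1/N) when it is
    at most 1. The exponents add up because 1/p - 1/r = 1/N, and r/p is at least
    1 + 1/N. *)
Lemma rapid_decay_critical : rapid_decay.
Proof.
have [j1 kj1] : exists j1 : nat, k1 <= 2 ^+ j1.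
  exists (Num.bound `|k1|); apply: (le_trans (ler_norm _)); apply: ltW.
  by apply: lt_trans (natr_lt_pow2 _); rewrite archi_boundP.
have D_le n : (j1 <= n)%N -> Dn n <= C1 * y n.
  move=> jn; have := energy_r (le_trans kj1 (pow2_le jn)).
  by rewrite -/(Y n) YE -EFinM lee_fin.
pose Z j := y (j1 + j).
have Z0 j : 0 <= Z j by exact: y0.
have Zle j : Z j.+1 <= Z j by apply: y_le; rewrite addnS.
pose e : R := N%:R^-1.
have e0 : 0 < e by rewrite invr_gt0.
have pV0 : 0 <= p^-1 by rewrite invr_ge0 ltW.
have rp0 : 0 < r / p by rewrite divr_gt0.
pose A := K * C1 `^ p^-1.
pose B := (2 * K) `^ r * C1 `^ (r / p).
pose C := 2 `^ r * (2 * A + 4 * B).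
have A0 : 0 <= A by rewrite mulr_ge0 ?powR_ge0.
have B0 : 0 <= B by rewrite mulr_ge0 ?powR_ge0.
have C0 : 0 <= C by rewrite mulr_ge0 ?powR_ge0// addr_ge0// mulr_ge0.
have cZ : Z @ \oo --> (0 : R).
  have := y_cvg; rewrite -(cvg_shiftn j1); apply: cvg_trans.
  by apply: near_eq_cvg; apply: nearW => j; rewrite /= /Z addnC.
have step j : Z j <= 1 -> Z j.+1 <= C * Z j `^ (1 + e).
  rewrite /Z addnS; set n := (j1 + j)%N => y1.
  have Dn1 := D_le n (leq_addr _ _).
  have Dy0 : 0 <= C1 * y n by rewrite mulr_ge0.
  have d0 : 0 <= dn n by exact: strip_energy_ge0.
  have dy : dn n <= C1 * y n by exact: le_trans (strip_energy_le _ _) Dn1.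
  have Dy : Dn n.+1 <= C1 * y n.
    by apply: le_trans Dn1; apply: level_energy_le; exact: pow2_le.
  have aS : a n.+1 <= A * y n `^ (1 + e).
    apply: (le_trans (a_step n)).
    have -> : A * y n `^ (1 + e) = K * (C1 * y n) `^ p^-1 * y n `^ (1 - r^-1).
      rewrite (powRM _ C10 (y0 n)) /A -!mulrA; congr (_ * (_ * _)).
      have rV1 : 0 < 1 - r^-1 by rewrite subr_gt0 invf_lt1.
      have eE : p^-1 + (1 - r^-1) = 1 + e by rewrite rV /e; ring.
      rewrite -powRD; first by rewrite eE.
      by rewrite eE gt_eqF// addr_gt0.
    apply: ler_pM; [| exact: powR_ge0| |].
    - by rewrite mulr_ge0 ?powR_ge0.
    - by apply: ler_wpM2l => //; exact: le_powR2.
    - apply: le_powR2 (a0 n) (a_le n).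
      by rewrite subr_ge0 invf_le1// ltW.
  have DS : (2 * K) `^ r * Dn n.+1 `^ (r / p) <= B * y n `^ (1 + e).
    rewrite /B -mulrA; apply: ler_wpM2l; first exact: powR_ge0.
    have h := le_powR2 (ltW rp0) (level_energy_ge0 _) Dy.
    apply: (le_trans h); rewrite (powRM _ C10 (y0 n)).
    apply: ler_wpM2l; first exact: powR_ge0.
    have [yn0|yn0] := eqVneq (y n) 0.
      by rewrite yn0 powR0 ?gt_eqF// powR_ge0.
    apply: ger_powR.
      by rewrite y1 andbT lt_neqAle eq_sym yn0 y0.
    rewrite rp lerD2l /e; apply: (@le_trans _ _ (N%:R - p)^-1).
      by rewrite lef_pV2 ?posrE// gerBl ltW.
    by rewrite ler_peMl// invr_ge0 ltW.
  have := Y_bound n.+1; rewrite YE lee_fin => /le_trans; apply.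
  rewrite (_ : C * y n `^ (1 + e) =
      2 `^ r * (2 * (A * y n `^ (1 + e)) + 4 * (B * y n `^ (1 + e)))); last first.
    by rewrite /C; ring.
  apply: ler_wpM2l; first exact: powR_ge0.
  rewrite -(mulrA 4); apply: lerD; first by rewrite ler_wpM2l.
  by rewrite ler_wpM2l.
have dec := fast_decay Z0 Zle (superlinear_decay Z0 Zle C0 e0 cZ step).
have al_y n : al (2 ^+ n) <= y n.
  apply: le_trans (a_le n); rewrite /a ler_peMl ?level_measure_ge0//.
  have pn1 : 1 <= 2 ^+ n :> R by rewrite exprn_ege1// ler1n.
  by have := ler_powR pn1 (ltW r0); rewrite powRr0.
move=> m; have [M HM] := dec m.
have M0 : 0 <= M by apply: le_trans (HM 0%N); rewrite mulr_ge0.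
have al00 : 0 <= al 0 by exact: level_measure_ge0.
exists (2 ^+ (j1 * m) * (M + al 0)) => n.
have [nj|jn] := ltnP n j1.
  apply: (@le_trans _ _ (2 ^+ (j1 * m) * al 0)).
    apply: ler_pM; [exact: exprn_ge0|exact: level_measure_ge0| |].
      by apply: pow2_le; rewrite leq_mul2r ltnW// orbT.
    by apply: level_measure_le; rewrite exprn_ge0.
  by rewrite ler_wpM2l ?exprn_ge0// lerDr.
rewrite -(subnKC jn) mulnDl exprD -mulrA ler_wpM2l ?exprn_ge0//.
apply: (@le_trans _ _ (2 ^+ ((n - j1) * m) * Z (n - j1)%N)).
  by rewrite ler_wpM2l ?exprn_ge0// /Z; exact: al_y.
by apply: (le_trans (HM _)); rewrite lerDl.
Qed.

End critical_growth.

(** * Boundedness and the estimate under the growth condition *)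

Section growth.
Variables (c m theta q : R).
Hypotheses (c0 : 0 < c) (m0 : 0 <= m) (theta0 : 0 <= theta) (q1 : 1 <= q).
Hypothesis energy_growth : forall k, 0 <= k ->
  ((c / 2)%:E * \int[mu]_(x in superlevel O u k) (s x `^ p)%:E <=
   \int[mu]_(x in superlevel O u k)
     (m * (`|u x| + theta) `^ (q - 1) * (`|u x| - k))%:E)%E.

Let q0 : 0 < q. Proof. exact: lt_le_trans q1. Qed.
Let q10 : 0 <= q - 1. Proof. by rewrite subr_ge0. Qed.

Let growth x k : R := m * (`|u x| + theta) `^ (q - 1) * (`|u x| - k).

Let growth_ge0 k x : superlevel O u k x -> (0 <= (growth x k)%:E)%E.
Proof. by move=> [_ kx]; rewrite lee_fin !mulr_ge0 ?powR_ge0// subr_ge0. Qed.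

Let mau : measurable_fun O (fun x => `|u x|).
Proof. exact: measurableT_comp. Qed.

Let mgrowth k : measurable_fun O (fun x => (growth x k)%:E).
Proof.
apply/measurable_EFinP; apply: measurable_funM; last first.
  exact: measurable_funB.
apply: measurable_funM; first exact: measurable_cst.
apply/measurable_EFinP; apply: measurable_powR_fun.
exact: measurable_funD.
Qed.

Lemma level_energy_growth (k : R) (g : T -> R) : 0 <= k ->
  measurable_fun O g -> (forall x, 0 <= g x) ->
  {ae mu, forall x, superlevel O u k x -> growth x k <= g x} ->
  ((D k)%:E <= (2 / c)%:E * \int[mu]_(x in superlevel O u k) (g x)%:E)%E.
Proof.
move=> k0 mg g0 gle.
have gE : (\int[mu]_(x in superlevel O u k) (growth x k)%:E <=
    \int[mu]_(x in superlevel O u k) (g x)%:E)%E.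
  apply: ae_ge0_le_integral.
  - exact: mA.
  - exact: growth_ge0.
  - by apply: measurable_funS (mgrowth k).
  - by move=> x _; rewrite lee_fin.
  - by apply/measurable_EFinP; apply: measurable_funS mg.
  - by apply: filterS gle => x h /h; rewrite lee_fin.
have := le_trans (energy_growth k0) gE.
rewrite (level_energyE) => h.
have c20 : (0 <= (2 / c)%:E :> \bar R)%E by rewrite lee_fin divr_ge0// ltW.
have := lee_wpmul2l c20 h; rewrite -!EFinM mulrA.
have -> : 2 / c * (c / 2) = 1 by field; rewrite gt_eqF.
by rewrite mul1r.
Qed.

Let C1 := 2 / c * (m * 2 `^ (q - 1)).
Let C10 : 0 <= C1.
Proof. by rewrite !mulr_ge0 ?powR_ge0// ?invr_ge0 ltW. Qed.

(** At levels above theta + 1 the growth term is at most a multiple of |u|^q, and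
    powers of |u| increase with the exponent. *)
Lemma level_energy_power (r k : R) : q <= r -> theta + 1 <= k ->
  ((D k)%:E <= C1%:E * \int[mu]_(x in superlevel O u k) (`|u x| `^ r)%:E)%E.
Proof.
move=> qr kt; have k0 : 0 <= k by apply: le_trans kt; rewrite addr_ge0.
have mpow : measurable_fun O (fun x => `|u x| `^ r).
  by apply/measurable_EFinP; exact: measurable_powR_fun.
have c20 : (0 <= (m * 2 `^ (q - 1))%:E :> \bar R)%E.
  by rewrite lee_fin mulr_ge0// powR_ge0.
have E1 : (\int[mu]_(x in superlevel O u k)
     (m * 2 `^ (q - 1) * `|u x| `^ r)%:E =
   (m * 2 `^ (q - 1))%:E * \int[mu]_(x in superlevel O u k) (`|u x| `^ r)%:E)%E.
  have n0 x : superlevel O u k x -> (0 <= (`|u x| `^ r)%:E)%E.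
    by rewrite lee_fin powR_ge0.
  have mn : measurable_fun (superlevel O u k) (fun x => (`|u x| `^ r)%:E).
    by apply/measurable_EFinP; apply: measurable_funS mpow.
  rewrite -(ge0_integralZl mu (mA k) mn n0 c20).
  by apply: eq_integral => x _; rewrite EFinM.
rewrite /C1 EFinM -muleA -E1; apply: (level_energy_growth k0).
- by apply: measurable_funM => //; exact: measurable_cst.
- by move=> x; rewrite !mulr_ge0 ?powR_ge0.
apply: aeW => x [_ /= kx]; rewrite /growth.
have u1 : 1 <= `|u x| by apply: le_trans kx; apply: le_trans kt; rewrite lerDr.
have ut : theta <= `|u x| by apply: le_trans kx; apply: le_trans kt; rewrite lerDl.
have u0 : 0 < `|u x| by exact: lt_le_trans u1.
rewrite -!mulrA; apply: ler_wpM2l => //.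
apply: (@le_trans _ _ ((2 * `|u x|) `^ (q - 1) * `|u x|)).
  apply: ler_pM; [exact: powR_ge0|by rewrite subr_ge0| |by rewrite gerBl].
  apply: le_powR2 => //; first by rewrite addr_ge0.
  by rewrite mulr_natl mulr2n lerD2l.
rewrite powRM// -mulrA; apply: ler_wpM2l; first exact: powR_ge0.
rewrite mulrC (mulr_powRB1 (ltW u0) q0).
exact: ler_powR.
Qed.

Lemma bounded_of_growth : (p < N%:R -> q <= N%:R * p / (N%:R - p)) ->
  exists K, al K = 0.
Proof.
move=> qpstar.
have t1 : 1 <= theta + 1 by rewrite lerDr.
have mom_bound : rapid_decay -> exists K, al K = 0.
  move=> dec.
  apply: (bounded_of_moments C10 t1 (ltW q0)).
    by move=> r; exact: moments_of_rapid_decay.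
  by move=> k; exact: level_energy_power.
have [pN|Np|pN] := ltgtP p N%:R.
- apply: mom_bound.
  apply: (rapid_decay_critical pN C10).
  by move=> k; apply: level_energy_power; exact: qpstar.
- exact: (bounded_supercritical Np).
- apply: mom_bound.
  exact: (rapid_decay_borderline pN).
Qed.

Section estimate.
Variable M : R.
Hypotheses (tM : theta < M).
Hypothesis u_le : {ae mu, forall x, O x -> `|u x| <= M}.
Hypothesis M_min : forall k, k < M -> al k != 0.

Let M0 : 0 < M. Proof. exact: le_lt_trans tM. Qed.
Let Q := 2 `^ q * (m / c) * M `^ q.
Let Q0 : 0 <= Q. Proof. by rewrite !mulr_ge0 ?powR_ge0// invr_ge0 ltW. Qed.

Let D_le k : 0 <= k -> D k <= Q * al k.
Proof.
move=> k0; pose g := m * (2 * M) `^ (q - 1) * M.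
have g0 : 0 <= g by rewrite !mulr_ge0 ?powR_ge0// ltW.
have ae : {ae mu, forall x, superlevel O u k x -> growth x k <= g}.
  apply: filterS u_le => x uM [Ox /= kx]; have {}uM := uM Ox.
  rewrite /growth /g -!mulrA; apply: ler_wpM2l => //.
  apply: ler_pM; [exact: powR_ge0|by rewrite subr_ge0| |].
    apply: le_powR2 => //; first by rewrite addr_ge0.
    by rewrite mulr_natl mulr2n lerD// ltW.
  by apply: le_trans uM; rewrite gerBl.
have := @level_energy_growth k (cst g) k0 (measurable_cst g) (fun=> g0) ae.
have -> : (\int[mu]_(x in superlevel O u k) (cst g x)%:E =
    g%:E * mu (superlevel O u k))%E.
  by rewrite -integral_cst//; exact: mA.
rewrite (level_measureE) -!EFinM lee_fin => /le_trans; apply.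
rewrite le_eqVlt; apply/orP; left; apply/eqP.
have E2 : 2 `^ q = 2 * 2 `^ (q - 1) :> R by rewrite mulr_powRB1.
have EM : M `^ q = M * M `^ (q - 1) by rewrite mulr_powRB1// ltW.
by rewrite /Q /g E2 EM powRM ?(ltW M0)//; ring.
Qed.

Let B := 2 * N%:R * Q `^ p^-1.
Let B0 : 0 <= B. Proof. by rewrite !mulr_ge0 ?powR_ge0. Qed.

(** Otherwise Stampacchia's iteration started at M/2 would show that |u| stays
    below some level smaller than M. *)
Let half_le : M / 2 <= 2 `^ (1 + N%:R) * B * al (M / 2) `^ N%:R^-1.
Proof.
set t := (X in _ <= X).
have t0 : 0 <= t by rewrite !mulr_ge0 ?powR_ge0.
rewrite leNgt; apply/negP => tM2.
(* A distance that is long enough for the iteration and shorter than M/2. *)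
pose d' := (t + M / 2) / 2.
have d0 : 0 < d' by rewrite /d'; have := M0; lra.
have : al (M / 2 + d') = 0.
  apply: (@stampacchia _ al (M / 2) B N%:R^-1) => //.
  - by move=> k; exact: level_measure_ge0.
  - exact: (level_measure_le).
  - by rewrite invr_gt0.
  - move=> k h Mk kh; have k0 : 0 <= k by apply: le_trans Mk; rewrite divr_ge0// ltW.
    have := level_measure_step k0 (ltW kh).
    move/le_trans; apply.
    have pV0 : 0 <= p^-1 by rewrite invr_ge0 ltW.
    have ak0 : 0 <= al k by exact: level_measure_ge0.
    have -> : B * al k `^ (1 + N%:R^-1) =
        2 * N%:R * al k `^ (1 + N%:R^-1 - p^-1) * (Q * al k) `^ p^-1.
      rewrite (powRM _ Q0 ak0) /B.
      have -> : al k `^ (1 + N%:R^-1) =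
          al k `^ (1 + N%:R^-1 - p^-1) * al k `^ p^-1.
        by rewrite -powRD subrK// gt_eqF// addr_gt0// invr_gt0.
      by ring.
    apply: ler_wpM2l; first by rewrite !mulr_ge0 ?powR_ge0.
    apply: le_powR2 => //; first exact: strip_energy_ge0.
    apply: le_trans (strip_energy_le _ _) _; exact: D_le.
  - by rewrite invrK -/t /d'; lra.
apply/eqP; apply: M_min; rewrite /d'; lra.
Qed.

Lemma sup_power_bound (I : R) : (\int[mu]_(x in O) (`|u x| `^ q)%:E = I%:E)%E ->
  M `^ (N%:R + q - q * N%:R / p) <=
  2 `^ (q + q * N%:R / p) * (2 `^ (3 + N%:R) * N%:R) `^ N%:R *
  ((m / c) `^ (N%:R / p) * I).
Proof.
move=> IE.
have M2 : 0 < M / 2 by rewrite divr_gt0.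
have cheb : (M / 2) `^ q * al (M / 2) <= I.
  rewrite -lee_fin -IE; apply: (le_trans (chebyshev_level (ltW M2) (ltW q0))).
  apply: ge0_subset_integral.
  - exact: mA.
  - exact: mO.
  - exact: measurable_powR_fun.
  - by move=> x _; rewrite lee_fin powR_ge0.
  - exact: AO.
set a := al (M / 2) in cheb.
have a0 : 0 <= a by exact: level_measure_ge0.
have NR0 : 0 < N%:R :> R by rewrite ltr0n.
have h1 : M `^ N%:R <= (2 `^ (3 + N%:R) * N%:R) `^ N%:R * Q `^ (N%:R / p) * a.
  have -> : (2 `^ (3 + N%:R) * N%:R) `^ N%:R * Q `^ (N%:R / p) * a =
     (2 `^ (3 + N%:R) * N%:R * Q `^ p^-1 * a `^ N%:R^-1) `^ N%:R.
    rewrite [RHS]powRM ?mulr_ge0 ?powR_ge0// [X in _ = X * _]powRM ?mulr_ge0 ?powR_ge0//.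
    by rewrite -!(powRrM _ _ N%:R) mulVf ?gt_eqF// powRr1// (mulrC p^-1).
  apply: le_powR2; [exact: ltW|exact: ltW|].
  have := half_le; rewrite -/a /B.
  have -> : 2 `^ (3 + N%:R) = 2 * (2 * 2 `^ (1 + N%:R)) :> R.
    rewrite (_ : 3 + N%:R = (1 + (1 + (1 + N%:R)))); last by ring.
    by rewrite !powR1D ?addr_gt0.
  by lra.
have E1 : Q `^ (N%:R / p) =
    2 `^ (q * N%:R / p) * (m / c) `^ (N%:R / p) * M `^ (q * N%:R / p).
  have mc0 : 0 <= m / c by rewrite divr_ge0// ltW.
  have h2 : 0 <= 2 `^ q * (m / c) by rewrite mulr_ge0 ?powR_ge0.
  rewrite /Q (powRM _ h2 (powR_ge0 M q)) (powRM _ (powR_ge0 2 q) mc0).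
  by rewrite -!powRrM !mulrA.
have E2 : M `^ (N%:R + q - q * N%:R / p) * M `^ (q * N%:R / p) =
    2 `^ q * (M / 2) `^ q * M `^ N%:R.
  rewrite -powRD ?(gt_eqF M0) ?implybT// subrK.
  rewrite -powRM ?(ltW M2)// mulrCA divff ?mulr1//.
  by rewrite -powRD ?(gt_eqF M0) ?implybT// addrC.
have W0 : 0 < M `^ (q * N%:R / p) by rewrite powR_gt0.
rewrite -(ler_pM2r W0) E2.
have k20 : 0 <= 2 `^ q * (M / 2) `^ q by rewrite mulr_ge0 ?powR_ge0.
apply: (le_trans (ler_wpM2l k20 h1)); rewrite E1.
have -> : 2 `^ (q + q * N%:R / p) = 2 `^ q * 2 `^ (q * N%:R / p) :> R.
  by rewrite powRD// pnatr_eq0 implybT.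
set X := 2 `^ q * 2 `^ (q * N%:R / p) * (2 `^ (3 + N%:R) * N%:R) `^ N%:R *
   (m / c) `^ (N%:R / p) * M `^ (q * N%:R / p).
have X0 : 0 <= X by rewrite !mulr_ge0 ?powR_ge0.
have := ler_wpM2l X0 cheb; rewrite /X.
set x1 := 2 `^ q; set x2 := 2 `^ _; set x3 := _ `^ N%:R; set x4 := (m / c) `^ _.
set x5 := M `^ _; set x6 := (M / 2) `^ _.
rewrite (_ : x1 * x2 * x3 * x4 * x5 * (x6 * a) =
  x1 * x6 * (x3 * (x2 * x4 * x5) * a)); last by ring.
by rewrite (_ : x1 * x2 * x3 * x4 * x5 * I = x1 * x2 * x3 * (x4 * I) * x5)//; ring.
Qed.

End estimate.
End growth.
Local Notation norm := ('N[mu]_+oo[EFin \o (u \_ O)])%E.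

Lemma Lnorm_le_of_level (K : R) : al K = 0 -> (norm <= (Num.max K 0)%:E)%E.
Proof.
move=> aK; apply: (Lnorm_le_level mO mu_); first by rewrite le_max lexx orbT.
rewrite (level_measureE); congr (_%:E).
apply/eqP; rewrite eq_le level_measure_ge0 andbT -aK.
by apply: (level_measure_le); rewrite le_max lexx.
Qed.

Section critical_growth_bound.
Variables (c m theta q : R).
Hypotheses (c0 : 0 < c) (m0 : 0 <= m) (theta0 : 0 <= theta) (q1 : 1 <= q).
Hypothesis energy_growth : forall k, 0 <= k ->
  ((c / 2)%:E * \int[mu]_(x in superlevel O u k) (s x `^ p)%:E <=
   \int[mu]_(x in superlevel O u k)
     (m * (`|u x| + theta) `^ (q - 1) * (`|u x| - k))%:E)%E.

Lemma Lnorm_estimate : (norm < +oo)%E -> lt_pstar N p q%:E ->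
  (norm <= maxe theta%:E ((bound_constant N (p, q))%:E *
     (((m / c) `^ (N%:R / p))%:E * \int[mu]_(x in O) (`|u x| `^ q)%:E)
       `^ (p / (p * q + (p - q) * N%:R))))%E.
Proof.
move=> nfin qs.
have nE : norm = (fine norm)%:E by rewrite fineK// ge0_fin_numE// Lnorm_ge0.
set M := fine norm in nE; rewrite nE.
have M0 : 0 <= M by apply: fine_ge0; exact: Lnorm_ge0.
have [Mt|tM] := leP M theta; first by rewrite le_max lee_fin Mt.
have {}M0 : 0 < M by exact: le_lt_trans tM.
have u_le : {ae mu, forall x, O x -> `|u x| <= M}.
  by apply/(Lnorm_inftyP mu O u (ltW M0)); rewrite nE.
have M_min k : k < M -> al k != 0.
  move=> kM; apply/eqP => /Lnorm_le_of_level; rewrite nE lee_fin.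
  by apply/negP; rewrite -ltNge gt_max kM.
have muq : measurable_fun O (fun x => (`|u x| `^ q)%:E).
  by apply: measurable_powR_fun; exact: measurableT_comp.
pose I := fine (\int[mu]_(x in O) (`|u x| `^ q)%:E)%E.
have i0 : (0 <= \int[mu]_(x in O) (`|u x| `^ q)%:E)%E.
  by apply: integral_ge0 => x _; rewrite lee_fin powR_ge0.
have IE : (\int[mu]_(x in O) (`|u x| `^ q)%:E = I%:E)%E.
  rewrite /I fineK; first by [].
  rewrite (ge0_fin_numE i0).
  apply: (@le_lt_trans _ _ (\int[mu]_(x in O) (M `^ q)%:E)%E).
    apply: ae_ge0_le_integral.
    - exact: mO.
    - by move=> x _; rewrite lee_fin powR_ge0.
    - exact: muq.
    - by move=> x _; rewrite lee_fin powR_ge0.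
    - exact: measurable_cst.
    apply: filterS u_le => x h Ox; rewrite lee_fin.
    by apply: le_powR2; [exact: le_trans ler01 q1|exact: normr_ge0|exact: h].
  rewrite (_ : (\int[mu]_(x in O) (M `^ q)%:E = (M `^ q)%:E * mu O)%E); last first.
    by rewrite -integral_cst.
  by rewrite lte_mul_pinfty// lee_fin powR_ge0.
have I0 : 0 <= I by exact: fine_ge0.
rewrite IE -EFinM le_max; apply/orP; right.
rewrite lee_fin; apply: sup_bound_of_power_bound => //.
exact: (sup_power_bound c0 m0 theta0 q1
  energy_growth tM u_le M_min IE).
Qed.

End critical_growth_bound.
End level_iteration.

Theorem theorem1p3 (R : realType) (N : nat) (N_gt0 : (0 < N)%N) :
  exists C : R * R -> R,
  [/\ forall z, exponent_domain N z -> 0 < C z,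
      {within exponent_domain N, continuous C} &
      forall (p : R) (Omega : set 'rV[R]_N)
        (H : 'rV[R]_N -> R) (c : R)
        (f : 'rV[R]_N -> R -> R) (mu theta : R) (q : \bar R),
        1 <= p ->
        open Omega -> (lebesgue_rV Omega < +oo)%E ->
        (forall z, 0 <= H z) ->
        convex_function (setT : set (convex_lmodType 'rV[R]_N)) H ->
        H 0 = 0 ->
        0 < c -> (forall z, c * enorm z `^ p <= H z) ->
        caratheodory_function Omega f ->
        locally_bounded Omega f ->
        0 <= mu -> 0 <= theta -> (1 <= q)%E -> le_pstar N p q ->
        sign_growth Omega f mu theta q ->
        forall u : W01p Omega p,
          energy_critical_point H f u ->
          (LnormOn Omega +oo u < +oo)%E /\
          (lt_pstar N p q ->
           (LnormOn Omega +oo u <=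
            maxe theta%:E
              ((C (p, fine q))%:E *
               (((mu / c) `^ (N%:R / p))%:E *
                \int[@lebesgue_rV R N]_(x in Omega) (`|u x| `^ fine q)%:E)
                `^ (p / (p * fine q + (p - fine q) * N%:R))))%E)].
Proof.
exists (@bound_constant R N); split.
- by move=> z _; exact: expR_gt0.
- exact: continuous_bound_constant.
move=> p Omega H c f m theta q p1 oO fO Hge0 cH H0 c0 Hco cara _ m0 t0 q1 qs sg u crit.
pose E := euclidean R N; pose leb := @lebesgue_rV R N.
have mO : measurable (Omega : set E) by exact: open_measurable_rV.
have mu' : measurable_fun (Omega : set E) u := Wfun_measurable u.
have ms := measurable_enorm_grad u.
have sp := integral_grad_powR_fin p1 oO Hge0 cH H0 c0 Hco crit.
have small_set_poincare_borel := superlevel_gap p1 oO fO Hge0 cH H0 c0 Hco crit.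
have bounded K : level_measure leb (Omega : set E) u K = 0 ->
    (LnormOn Omega +oo u < +oo)%E.
  move=> /(@Lnorm_le_of_level _ E R leb Omega u mO fO mu') h.
  exact: le_lt_trans h (ltry _).
have e0 (x : 'rV[R]_N) : 0 <= enorm (Wgrad u x) by exact: sqrtr_ge0.
case: q q1 qs sg => [q| |] //; last first.
  move=> _ qs _; have Np : N%:R < p.
    move: qs; rewrite /le_pstar; case: ifP => // /negbT; rewrite -leNgt.
    by case: ifP => // /negbT pN Np _; rewrite lt_neqAle eq_sym pN.
  have [K aK] := @bounded_supercritical _ E R leb Omega u _ p N mO fO mu' ms e0
    p1 N_gt0 sp small_set_poincare_borel Np.
  split; first exact: bounded aK.
  by rewrite /lt_pstar ltNge (ltW Np).
rewrite lee_fin => q1 qs sg.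
have growth k : 0 <= k ->
  ((c / 2)%:E * \int[leb]_(x in superlevel Omega u k) (enorm (Wgrad u x) `^ p)%:E <=
   \int[leb]_(x in superlevel Omega u k)
     (m * (`|u x| + theta) `^ (q - 1) * (`|u x| - k))%:E)%E.
  move=> k0; have [mF] := energy_superlevel p1 oO Hge0 cH H0 c0 Hco crit k0.
  move=> /le_trans; apply.
  exact: (@truncation_growth _ E R leb Omega u mO mu' f k m theta q k0 m0 mF sg).
have qs' : p < N%:R -> q <= N%:R * p / (N%:R - p).
  by move=> pN; move: qs; rewrite /le_pstar pN lee_fin.
have [K aK] := @bounded_of_growth _ E R leb Omega u _ p N mO fO mu' ms e0
    p1 N_gt0 sp small_set_poincare_borel c m theta q c0 m0 t0 q1 growth qs'.
have fin_u := bounded K aK.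
split; first by [].
exact: (@Lnorm_estimate _ E R leb Omega u _ p N mO fO mu' ms e0
    p1 N_gt0 sp small_set_poincare_borel c m theta q c0 m0 t0 q1 growth fin_u).
Qed.
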